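(* Let $A$ be a ribbon Hopf algebra over a commutative ring $\Bbbk$ and let $W$ be a finite-free left $A$-module, with the induced traced XC-algebra structure on $\mathrm{End}_\Bbbk(W)$. Let $\iota_W:\mathcal{E}(\mathrm{End}_\Bbbk(W))\hookrightarrow\mathsf{fMod}_A^{\mathrm{str}}$ be the canonical (strict, traced) monoidal embedding. Then $$RT_W=\iota_W\circ Z_{\mathrm{End}_\Bbbk(W)}:\mathcal{T}^+\to\mathsf{fMod}_A^{\mathrm{str}},$$ that is, viewing $\mathcal{E}(\mathrm{End}_\Bbbk(W))$ as a traced monoidal subcategory of $\mathsf{fMod}_A^{\mathrm{str}}$ via $\iota_W$, the functors $Z_{\mathrm{End}_\Bbbk(W)}$ and $RT_W$ coincide.
   Context: Ribbon Hopf algebras. All Hopf algebras have invertible antipode $S$. A quasi-triangular structure on a Hopf algebra $A$ over $\Bbbk$ is an invertible $R=\sum_i\alpha_i\otimes\beta_i\in A\otimes A$ with $(\Delta\otimes\mathrm{id})(R)=R_{13}R_{23}$, $(\mathrm{id}\otimes\Delta)(R)=R_{13}R_{12}$, $\Delta^{\mathrm{op}}=R\,\Delta(-)\,R^{-1}$. Put $u=\sum_iS(\beta_i)\alpha_i$. A ribbon structure is an element $\kappa\in A$ (balancing element) with $\kappa^2=uS(u^{-1})$, $\Delta(\kappa)=\kappa\otimes\kappa$, $S^2=\kappa(-)\kappa^{-1}$; then $(A,R,\kappa)$ is a ribbon Hopf algebra with ribbon element $v=\kappa^{-1}u$. Modules. $\mathsf{fMod}_A$ is the ribbon category of left $A$-modules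 that are free of finite rank over $\Bbbk$ (finite-free), with $\otimes=\otimes_\Bbbk$ (action through $\Delta$), braiding $\tau_{V,W}(v\otimes w)=\sum_i\beta_iw\otimes\alpha_iv$, duals $V^*$ with $(a\omega)(v)=\omega(S(a)v)$, twist $\theta_W(w)=v^{-1}w$. $\mathsf{fMod}_A^{\mathrm{str}}$ is its strictification: objects are finite sequences of objects, morphisms are the morphisms between the left-parenthesised tensor products, and the monoidal product is concatenation. It is traced: the trace of $f:X\otimes U\to Y\otimes U$ is $(\mathrm{id}_Y\otimes\widetilde{\mathrm{ev}}_U)(f\otimes\mathrm{id}_{U^*})(\mathrm{id}_X\otimes\mathrm{coev}_U)$, with $\widetilde{\mathrm{ev}}_U=\mathrm{ev}_U\tau_{U,U^*}(\theta_U\otimes\mathrm{id}_{U^*})$. Tangles. $\mathcal{T}$ is the category of framed oriented tangles in the cube (objects words in $\pm$, composition by stacking on top, $\otimes$ juxtaposition), the free strict ribbon category on $+$, with $\tau_{+,+}$ the positive crossing (both strands up, the strand from bottom left to top right over) and $\theta_+$ the strand with framing $+1$. $\mathcal{T}^+\subset\mathcal{T}$ is the full subcategory on the objects $+^n$, $n\ge0$ (closed components allowed); it is a traced monoidal category, with trace $\mathrm{tr}_{+^n,+^n}^{+^m}$ closing up the $m$ rightmost strands by parallel planar arcs to the right. $RT_W:\mathcal{T}^+\to\mathsf{fMod}_A^{\mathrm{str}}$ is the restriction of the unique strict monoidal functor $\mathcal{T}\to\mathsf{fMod}_A^{\mathrm{str}}$ with $+\mapsto(W)$ preserving the ribbon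 structure. Endomorphism XC-algebra. Let $\rho:A\to B:=\mathrm{End}_\Bbbk(W)$ be the structure map of the module $W$. The induced traced XC-algebra structure on $B$ (product given by composition) consists of the invertible elements $R_B=(\rho\otimes\rho)(R)$, $\kappa_B=\rho(\kappa)$ and the usual trace $\mathrm{tr}:B\to\Bbbk$ of endomorphisms. Write $R_B=\sum_ia_i\otimes b_i$ and $\nu_B=\sum_ia_i\kappa_B^{-1}b_i$. The traced category of elements $\mathcal{E}(B)$. For $\sigma\in\mathfrak{S}_n$, $\sigma_*(x_1\otimes\cdots\otimes x_n)=x_{\sigma^{-1}(1)}\otimes\cdots\otimes x_{\sigma^{-1}(n)}$ (on $V^{\otimes n}$ for any $\Bbbk$-module $V$). $B^{\otimes n}\times\mathfrak{S}_n$ is a monoid with $(u,\sigma)(v,\tau)=(\tau_*^{-1}(u)\cdot v,\sigma\tau)$ and unit $(1\otimes\cdots\otimes1,\mathrm{id})$ (for $n=0$ it is $(\Bbbk,\cdot)$). Let $\mathcal{J}_n$ be the submonoid generated by the unit and $\hat R_i^{\pm1}$, $1\le i<n$, where $\hat R_i=(1\otimes\cdots\otimes R_B\otimes\cdots\otimes1,(i,i+1))$ with $R_B$ in factors $i,i+1$. Define $\varphi_{n,m}:B^{\otimes n+m}\times\mathfrak{S}_{n+m}\to B^{\otimes n}\times\mathfrak{S}_n$ by $\varphi_{n,0}=\mathrm{id}$, $\varphi_{n,m}=\varphi_{n,m-1}\circ\varphi_{n+m-1,1}$ for $m>1$, and for $(u,\sigma)=(\sum x_1\otimes\cdots\otimes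 x_{n+1},\sigma)$: if $j=\sigma^{-1}(n+1)\neq n+1$, $\varphi_{n,1}(u,\sigma)=(\sum x_1\otimes\cdots\otimes x_{n+1}\kappa_Bx_j\otimes\cdots\otimes x_n,\widehat\sigma)$ with $x_{n+1}\kappa_Bx_j$ in the $j$-th factor, $\widehat\sigma(j)=\sigma(n+1)$, $\widehat\sigma(i)=\sigma(i)$ otherwise; if $\sigma(n+1)=n+1$, $\varphi_{n,1}(u,\sigma)=(\sum\mathrm{tr}(\kappa_Bx_{n+1})\,x_1\otimes\cdots\otimes x_n,\sigma|_{\{1,\dots,n\}})$. For $n>0$ let $\mathcal{I}_n$ be the smallest submonoid of $B^{\otimes n}\times\mathfrak{S}_n$ containing $\varphi_{n,m}(\mathcal{J}_{n+m})$ for all $m\ge0$, and set $\mathcal{I}_0:=\Bbbk$ with its multiplicative monoid structure. $\mathcal{E}(B)$ has objects the integers $n\ge0$, $\mathrm{End}(n)=\mathcal{I}_n$, no other morphisms, $(u,\sigma)\otimes(v,\xi)=(u\otimes v,\sigma\otimes\xi)$ (block permutation), where tensoring $(u,\sigma)$ with $\lambda\in\mathcal{I}_0=\Bbbk$ gives $(\lambda u,\sigma)$ and on $\mathcal{I}_0\times\mathcal{I}_0$ the product is multiplication in $\Bbbk$; it is a strict traced monoidal category (in the sense of Joyal-Street-Verity) with $\tau_{1,1}=(R_B,(12))$, $\theta_1=(\nu_B,\mathrm{id})$ (other components forced by the axioms) and trace $\mathrm{tr}_{n,n}^m=\varphi_{n,m}$. $Z_B:\mathcal{T}^+\to\mathcal{E}(B)$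 is the unique strict monoidal functor with $+\mapsto1$ preserving braiding, twist and trace. The embedding $\iota_W$. $\iota_W:\mathcal{E}(\mathrm{End}_\Bbbk(W))\hookrightarrow\mathsf{fMod}_A^{\mathrm{str}}$ is the strict monoidal, traced embedding (that is, a functor injective on objects and faithful) given by $n\mapsto(W)^{\otimes n}=(W,\dots,W)$, $(\sum f_1\otimes\cdots\otimes f_n,\sigma)\mapsto\sigma_*\circ(\sum f_1\otimes\cdots\otimes f_n):W^{\otimes n}\to W^{\otimes n}$, using $\mathrm{End}_\Bbbk(W)^{\otimes n}\cong\mathrm{End}_\Bbbk(W^{\otimes n})$ (for $n=0$, multiplication by the scalar). *)

(* Defs.v *)
From HB Require Import structures.
From mathcomp Require Import all_boot all_order all_algebra all_fingroup.
From mathcomp Require Import boolp.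

Set Implicit Arguments.
Unset Strict Implicit.
Unset Printing Implicit Defensive.

Import GRing.Theory VectorInternalTheory.
Local Open Scope ring_scope.
Local Open Scope quotient_scope.

(** * Finite tensor products of modules over a commutative ring

   A finite sequence [s] of labels, together with a module [c a] for every
   label [a], has a tensor product [tens c s], the quotient of the formal
   linear combinations of pure tensors by the relation of being identified by
   every multilinear map.  For the empty sequence this is the base ring. *)

Section Tensor.

Variables (k : comNzRingType) (X : Type) (c : X -> lmodType k).
Implicit Types (s t : seq X) (M : lmodType k).

Fixpoint hlist s : choiceType :=
  if s is a :: s' then (c a * hlist s')%type else unit.

Fixpoint mlin s M : (hlist s -> M) -> Prop :=
  if s is a :: s' return (hlist s -> M) -> Prop then
    fun f => (forall h : hlist s', linear (fun v => f (v, h)))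
             /\ (forall v, mlin (fun h : hlist s' => f (v, h)))
  else fun _ => True.

Definition fsum s := seq (k * hlist s)%type.

Definition ev s M (f : hlist s -> M) (x : fsum s) : M :=
  \sum_(p <- x) p.1 *: f p.2.

Definition tens_rel s : rel (fsum s) := fun x y =>
  `[< forall M (f : hlist s -> M), mlin f -> ev f x = ev f y >].

Lemma tens_rel_refl s : reflexive (@tens_rel s).
Proof. by move=> x; apply/asboolP. Qed.

Lemma tens_rel_sym s : symmetric (@tens_rel s).
Proof.
by move=> x y; apply/asboolP/asboolP => h M f Hf; rewrite h.
Qed.

Lemma tens_rel_trans s : transitive (@tens_rel s).
Proof.
move=> y x z /asboolP h1 /asboolP h2; apply/asboolP => M f Hf.
by rewrite h1 // h2.
Qed.

Canonical tens_equiv s :=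
  EquivRel (@tens_rel s) (@tens_rel_refl s) (@tens_rel_sym s)
    (@tens_rel_trans s).

Definition tens s := {eq_quot @tens_rel s}.


HB.instance Definition _ s := Choice.on (tens s).
HB.instance Definition _ s := EqQuotient.on (tens s).

(* For multilinear [f] this is the linear map induced by [f]; it is used for
   multilinear [f] only. *)
Definition lift s M (f : hlist s -> M) (x : tens s) : M := ev f (generic_quotient.repr x).

Definition pure s (h : hlist s) : tens s := \pi_(tens s) ([:: (1, h)] : fsum s).

Lemma lift_pi s M (f : hlist s -> M) (x : fsum s) :
  mlin f -> lift f (\pi x) = ev f x.
Proof.
move=> Hf; rewrite /lift.
have /eqmodP /asboolP H : generic_quotient.repr (\pi_(tens s) x) = x %[mod tens s].
  by rewrite reprK.
exact: H.
Qed.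

Lemma lift_pure s M (f : hlist s -> M) h : mlin f -> lift f (pure h) = f h.
Proof. by move=> Hf; rewrite lift_pi // /ev big_seq1 scale1r. Qed.

Lemma tensP s (x y : tens s) :
  (forall M (f : hlist s -> M), mlin f -> lift f x = lift f y) -> x = y.
Proof.
rewrite -[x]reprK -[y]reprK => H; apply/eqmodP/asboolP => M f Hf.
by rewrite -(lift_pi _ Hf) H // lift_pi.
Qed.

Definition tadd s (x y : tens s) : tens s := 
  \pi_(tens s) (generic_quotient.repr x ++ generic_quotient.repr y : fsum s).
Definition tscale s (a : k) (x : tens s) : tens s :=
  \pi_(tens s)
    ([seq (a * p.1, p.2) | p <- generic_quotient.repr x] : fsum s).
Definition tzero s : tens s := \pi_(tens s) ([::] : fsum s).
Definition topp s (x : tens s) : tens s := tscale (-1) x.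

Section LiftOps.
Variables (s : seq X) (M : lmodType k) (f : hlist s -> M).
Hypothesis Hf : mlin f.

Lemma lift_tadd x y : lift f (tadd x y) = lift f x + lift f y.
Proof. by rewrite lift_pi // /ev big_cat. Qed.

Lemma lift_tscale a x : lift f (tscale a x) = a *: lift f x.
Proof.
rewrite lift_pi // /ev big_map scaler_sumr.
by apply: eq_bigr => p _; rewrite scalerA.
Qed.

Lemma lift_tzero : lift f (tzero s) = 0.
Proof. by rewrite lift_pi // /ev big_nil. Qed.

Lemma lift_topp x : lift f (topp x) = - lift f x.
Proof. by rewrite lift_tscale scaleN1r. Qed.

End LiftOps.

Definition liftE := (lift_tadd, lift_topp, lift_tscale, lift_tzero).

Lemma taddA s : associative (@tadd s).
Proof. by move=> x y z; apply: tensP => M f Hf; rewrite !liftE // addrA. Qed.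
Lemma taddC s : commutative (@tadd s).
Proof. by move=> x y; apply: tensP => M f Hf; rewrite !liftE // addrC. Qed.
Lemma tadd0 s : left_id (tzero s) (@tadd s).
Proof. by move=> x; apply: tensP => M f Hf; rewrite !liftE // add0r. Qed.
Lemma taddN s : left_inverse (tzero s) (@topp s) (@tadd s).
Proof. by move=> x; apply: tensP => M f Hf; rewrite !liftE // addNr. Qed.

HB.instance Definition _ s :=
  GRing.isZmodule.Build (tens s) (@taddA s) (@taddC s) (@tadd0 s) (@taddN s).

Lemma tscaleA s a b (x : tens s) : tscale a (tscale b x) = tscale (a * b) x.
Proof. by apply: tensP => M f Hf; rewrite !liftE // scalerA. Qed.
Lemma tscale1 s : left_id 1 (@tscale s).
Proof. by move=> x; apply: tensP => M f Hf; rewrite !liftE // scale1r. Qed.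
Lemma tscaleDr s : right_distributive (@tscale s) +%R.
Proof. by move=> a x y; apply: tensP => M f Hf; rewrite !liftE // scalerDr. Qed.
Lemma tscaleDl s (x : tens s) : {morph (@tscale s)^~ x : a b / a + b}.
Proof. by move=> a b; apply: tensP => M f Hf; rewrite !liftE // scalerDl. Qed.

HB.instance Definition _ s :=
  GRing.Zmodule_isLmodule.Build k (tens s)
    (@tscaleA s) (@tscale1 s) (@tscaleDr s) (@tscaleDl s).

Lemma lift_linear s M (f : hlist s -> M) : mlin f -> linear (lift f).
Proof.
move=> Hf a x y.
by rewrite -[a *: x]/(tscale a x) -[_ + y]/(tadd _ y) !liftE.
Qed.

Fixpoint hcat s t : hlist s -> hlist t -> hlist (s ++ t) :=
  if s is a :: s' return hlist s -> hlist t -> hlist (s ++ t) then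
    fun h h' => (h.1, hcat h.2 h')
  else fun _ h' => h'.

Fixpoint htake s t : hlist (s ++ t) -> hlist s :=
  if s is a :: s' return hlist (s ++ t) -> hlist s then
    fun h => (h.1, htake h.2)
  else fun _ => tt.

Fixpoint hdrop s t : hlist (s ++ t) -> hlist t :=
  if s is a :: s' return hlist (s ++ t) -> hlist t then
    fun h => hdrop h.2
  else id.

Definition tcat s t (x : tens s) (y : tens t) : tens (s ++ t) :=
  lift (fun h => lift (fun h' => pure (hcat h h')) y) x.

Fixpoint hmk (a : X) n : ('I_n -> c a) -> hlist (nseq n a) :=
  if n is n'.+1 return ('I_n -> c a) -> hlist (nseq n a) then
    fun x => (x ord0, hmk (fun i => x (fintype.lift ord0 i)))
  else fun _ => tt.

Fixpoint hnth (a : X) n : hlist (nseq n a) -> 'I_n -> c a :=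
  if n is n'.+1 return hlist (nseq n a) -> 'I_n -> c a then
    fun h i => if unlift ord0 i is Some j then hnth h.2 j else h.1
  else fun _ _ => 0.

(* sigma_* (x_1 ⊗ .. ⊗ x_n) has x_{sigma^-1 (i)} in factor i *)
Definition sperm (a : X) n (sigma : 'S_n) (x : tens (nseq n a)) :
    tens (nseq n a) :=
  lift (fun h => pure (hmk (fun i => hnth h (sigma^-1%g i)))) x.

End Tensor.

Arguments hmk {k X} c a {n} x.

Definition tpow (k : comNzRingType) (V : lmodType k) n :=
  tens (fun _ : unit => V) (nseq n tt).

Section TensorPower.

Variables (k : comNzRingType) (V : lmodType k).

Definition tvec n (x : 'I_n -> V) : tpow V n :=
  pure (hmk (fun _ : unit => V) tt x).

(* [tsum F (\sum_r x_r1 ⊗ .. ⊗ x_rn) = \sum_r F x_r] for [F] multilinear *)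
Definition tsum n (M : lmodType k) (F : ('I_n -> V) -> M) : tpow V n -> M :=
  lift (fun h => F (@hnth k unit (fun _ => V) tt n h)).

Definition ten2 (a b : V) : tpow V 2 := pure ((a, (b, tt)) : hlist _ (nseq 2 tt)).
Definition ten3 (a b c : V) : tpow V 3 :=
  pure ((a, (b, (c, tt))) : hlist _ (nseq 3 tt)).

(* [tsum2 F (\sum_r a_r ⊗ b_r) = \sum_r F a_r b_r] for [F] bilinear *)
Definition tsum2 (M : lmodType k) (F : V -> V -> M) (t : tpow V 2) : M :=
  lift (fun h : hlist (fun _ : unit => V) (nseq 2 tt) => F h.1 h.2.1) t.

Definition tsum3 (M : lmodType k) (F : V -> V -> V -> M) (t : tpow V 3) : M :=
  lift (fun h : hlist (fun _ : unit => V) (nseq 3 tt) => F h.1 h.2.1 h.2.2.1) t.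

Definition tmul (mul : V -> V -> V) n (x y : tpow V n) : tpow V n :=
  tsum (fun a => tsum (fun b => tvec (fun i => mul (a i) (b i))) y) x.

Definition bilin (M : lmodType k) (F : V -> V -> M) :=
  (forall b, linear (F^~ b)) /\ (forall a, linear (F a)).

Definition trilin (M : lmodType k) (F : V -> V -> V -> M) :=
  (forall b c, linear (fun a => F a b c)) /\ (forall a, bilin (F a)).

Lemma bilin_mlin (M : lmodType k) (F : V -> V -> M) : bilin F ->
  mlin (fun h : hlist (fun _ : unit => V) (nseq 2 tt) => F h.1 h.2.1).
Proof. by case=> H1 H2; split=> [h|v /=]; [exact: H1 | split]. Qed.

Lemma trilin_mlin (M : lmodType k) (F : V -> V -> V -> M) : trilin F ->
  mlin (fun h : hlist (fun _ : unit => V) (nseq 3 tt) => F h.1 h.2.1 h.2.2.1).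
Proof.
case=> H1 H2; split=> [h|v /=]; first exact: H1.
by case: (H2 v) => H3 H4; split=> [h|w /=]; [exact: H3 | split].
Qed.

Lemma tsum2_ten2 (M : lmodType k) (F : V -> V -> M) a b : bilin F ->
  tsum2 F (ten2 a b) = F a b.
Proof. by move=> HF; rewrite /tsum2 /ten2 lift_pure //; exact: bilin_mlin. Qed.

Lemma tsum3_ten3 (M : lmodType k) (F : V -> V -> V -> M) a b c : trilin F ->
  tsum3 F (ten3 a b c) = F a b c.
Proof. by move=> HF; rewrite /tsum3 /ten3 lift_pure //; exact: trilin_mlin. Qed.

Lemma tsum2_linear (M : lmodType k) (F : V -> V -> M) :
  bilin F -> linear (tsum2 F).
Proof. by move=> HF; apply: lift_linear; exact: bilin_mlin. Qed.

Lemma tsum3_linear (M : lmodType k) (F : V -> V -> V -> M) :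
  trilin F -> linear (tsum3 F).
Proof. by move=> HF; apply: lift_linear; exact: trilin_mlin. Qed.

Lemma linear_tsum2 (M N : lmodType k) (g : M -> N) (F : V -> V -> M) t :
  linear g -> g (tsum2 F t) = tsum2 (fun a b => g (F a b)) t.
Proof.
move=> Hg; pose g' : {linear M -> N} :=
  HB.pack g (GRing.isLinear.Build k M N *:%R g Hg).
rewrite -[g]/(g' : M -> N) /tsum2 /lift /ev linear_sum.
by apply: eq_bigr => p _; rewrite linearZ.
Qed.

Lemma eq_tsum2 (M : lmodType k) (F G : V -> V -> M) t :
  (forall a b, F a b = G a b) -> tsum2 F t = tsum2 G t.
Proof. by move=> E; apply: eq_bigr => p _; rewrite E. Qed.

Lemma tsum2C (M : lmodType k) (F : V -> V -> V -> V -> M) t u :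
  tsum2 (fun a b => tsum2 (F a b) u) t =
  tsum2 (fun c d => tsum2 (fun a b => F a b c d) t) u.
Proof.
rewrite /tsum2 /lift /ev.
under eq_bigr => p _ do rewrite scaler_sumr.
rewrite exchange_big; apply: eq_bigr => q _.
rewrite scaler_sumr; apply: eq_bigr => p _.
by rewrite !scalerA mulrC.
Qed.

Lemma tsum2_lin_r (U M : lmodType k) (F : U -> V -> V -> M) t :
  (forall a b, linear (fun v => F v a b)) -> linear (fun v => tsum2 (F v) t).
Proof.
move=> HF c u v; rewrite /tsum2 /lift /ev scaler_sumr -big_split.
by apply: eq_bigr => p _; rewrite HF scalerDr !scalerA mulrC.
Qed.

End TensorPower.

Record hopfAlg (k : comNzRingType) := HopfAlg {
  hcar :> algType k;
  cop : {linear hcar -> tpow hcar 2};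
  cou : {linear hcar -> k^o};
  antip : {linear hcar -> hcar};
  antip_inv : hcar -> hcar;
  cop_assoc : forall x,
    tsum2 (fun a b => tsum2 (fun a1 a2 => ten3 a1 a2 b) (cop a)) (cop x) =
    tsum2 (fun a b => tsum2 (fun b1 b2 => ten3 a b1 b2) (cop b)) (cop x);
  cou_l : forall x, tsum2 (fun a b => cou a *: b) (cop x) = x;
  cou_r : forall x, tsum2 (fun a b => cou b *: a) (cop x) = x;
  cop_mul : forall x y, cop (x * y) = tmul *%R (cop x) (cop y);
  cop_one : cop 1 = ten2 1 1;
  cou_mul : forall x y, cou (x * y) = cou x * cou y;
  cou_one : cou 1 = 1;
  antip_l : forall x, tsum2 (fun a b => antip a * b) (cop x) = (cou x : k)%:A;
  antip_r : forall x, tsum2 (fun a b => a * antip b) (cop x) = (cou x : k)%:A;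
  antipK : cancel antip antip_inv;
  antip_invK : cancel antip_inv antip
}.

Section Antipode.

Variables (k : comNzRingType) (A : hopfAlg k).
Local Notation Delta := (@cop k A).
Local Notation S := (@antip k A).

Lemma ten2_bilin (V : lmodType k) : bilin (@ten2 k V).
Proof.
split=> [b|a] c u v; apply: tensP => M f Hf;
  rewrite (lift_linear Hf) /ten2 !lift_pure //; case: Hf => /= H1 H2.
  exact: H1.
by case: (H2 a) => H3 _; exact: H3.
Qed.

Lemma tmul2E (mul : A -> A -> A) (x y : tpow A 2) :
  tmul mul x y =
  tsum2 (fun a b => tsum2 (fun c d => ten2 (mul a c) (mul b d)) y) x.
Proof.
apply: eq_bigr => p _; congr (_ *: _); apply: eq_bigr => q _; congr (_ *: _).
by rewrite /tvec /ten2 /= !unlift_none !liftK /= !unlift_none.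
Qed.

Lemma linear_bilin_tsum2 (M : lmodType k) (F : A -> A -> M) (t : tpow A 2)
    (G : A -> A -> tpow A 2) : bilin F ->
  tsum2 F (tsum2 G t) = tsum2 (fun a b => tsum2 F (G a b)) t.
Proof. by move=> HF; apply: (linear_tsum2 _ _ (tsum2_linear HF)). Qed.

Lemma cop_mul_sum (M : lmodType k) (F : A -> A -> M) x y : bilin F ->
  tsum2 F (Delta (x * y)) =
  tsum2 (fun a b => tsum2 (fun c d => F (a * c) (b * d)) (Delta y)) (Delta x).
Proof.
move=> HF; rewrite cop_mul tmul2E linear_bilin_tsum2 //.
apply: eq_tsum2 => a b; rewrite linear_bilin_tsum2 //.
by apply: eq_tsum2 => c d; rewrite tsum2_ten2.
Qed.

Lemma cop_assoc_sum (M : lmodType k) (F : A -> A -> A -> M) x : trilin F ->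
  tsum2 (fun a b => tsum2 (fun a1 a2 => F a1 a2 b) (Delta a)) (Delta x) =
  tsum2 (fun a b => tsum2 (fun b1 b2 => F a b1 b2) (Delta b)) (Delta x).
Proof.
move=> HF; have L := tsum3_linear HF.
transitivity (tsum3 F
   (tsum2 (fun a b => tsum2 (fun a1 a2 => ten3 a1 a2 b) (Delta a)) (Delta x))).
  rewrite (linear_tsum2 _ _ L); apply: eq_tsum2 => a b.
  rewrite (linear_tsum2 _ _ L); apply: eq_tsum2 => a1 a2.
  by rewrite tsum3_ten3.
rewrite cop_assoc (linear_tsum2 _ _ L); apply: eq_tsum2 => a b.
rewrite (linear_tsum2 _ _ L); apply: eq_tsum2 => b1 b2.
by rewrite tsum3_ten3.
Qed.

Lemma mulr_lin (a : A) : linear ( *%R a : A -> A).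
Proof. by move=> c u v; rewrite mulrDr scalerAr. Qed.

Lemma mull_lin (a : A) : linear ( *%R^~ a : A -> A).
Proof. by move=> c u v /=; rewrite mulrDl scalerAl. Qed.

Lemma antip_bilin : bilin (fun a b : A => S a * b).
Proof.
split=> [b|a] c u v /=; last by rewrite mulrDr scalerAr.
by rewrite linearD linearZ /= mulrDl scalerAl.
Qed.

Lemma antip1 : S 1 = 1.
Proof.
have := antip_l (1 : A); rewrite cop_one tsum2_ten2; last first.
  exact: antip_bilin.
by rewrite mulr1 cou_one scale1r.
Qed.

Lemma antipM (x y : A) : S (x * y) = S y * S x.
Proof.
pose P (x1 y1 x2 y2 x3 y3 : A) : A := S (x1 * y1) * (x2 * y2) * (S y3 * S x3).
have inner (x2 y2 : A) : tsum2 (fun a b => tsum2 (fun c d =>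
    (a * c) * (S d * S b)) (Delta y2)) (Delta x2) =
    ((@cou k A x2 : k) * (@cou k A y2 : k))%:A.
  transitivity (tsum2 (fun a b => a * ((@cou k A y2 : k)%:A * S b)) (Delta x2)).
    apply: eq_tsum2 => a b; rewrite -(antip_r y2); symmetry.
    have Lz : linear (fun z : A => a * (z * S b)).
      by move=> c u v; rewrite mulrDl mulrDr -scalerAl -scalerAr.
    apply: (etrans (linear_tsum2 _ _ Lz)).
    by apply: eq_tsum2 => c d; rewrite !mulrA.
  rewrite mulrC -scalerA -(antip_r x2); symmetry.
  have Lz : linear (fun z : A => (@cou k A y2 : k) *: z).
    by move=> c u v; rewrite scalerDr !scalerA mulrC.
  apply: (etrans (linear_tsum2 _ _ Lz)).
  by apply: eq_tsum2 => a b; rewrite -scalerAl mul1r scalerAr.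
have outer (x1 y1 : A) : tsum2 (fun a b => tsum2 (fun c d =>
    S (a * c) * (b * d)) (Delta y1)) (Delta x1) =
    ((@cou k A x1 : k) * (@cou k A y1 : k))%:A.
  rewrite -[X in X%:A](cou_mul x1 y1) -antip_l cop_mul_sum //.
  exact: antip_bilin.
transitivity (tsum2 (fun x1 x2 => tsum2 (fun y1 y2 =>
  tsum2 (fun a b => tsum2 (fun c d => P x1 y1 a c b d) (Delta y2)) (Delta x2))
  (Delta y)) (Delta x)).
  have Lx : linear (fun z : A => S (z * y)).
    by move=> c u v; rewrite mulrDl linearD -scalerAl linearZ.
  rewrite -{1}(cou_r x); apply: (etrans (linear_tsum2 _ _ Lx)).
  apply: eq_tsum2 => x1 x2; rewrite -{1}(cou_r y).
  have Ly : linear (fun z : A => S (((@cou k A x2 : k) *: x1) * z)).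
    by move=> c u v; rewrite mulrDr linearD -scalerAr linearZ.
  apply: (etrans (linear_tsum2 _ _ Ly)); apply: eq_tsum2 => y1 y2.
  transitivity (S (x1 * y1) * ((@cou k A x2 : k) * (@cou k A y2 : k))%:A).
    by rewrite -scalerAl -!scalerAr scalerA linearZ mulr1.
  rewrite -inner; apply: (etrans (linear_tsum2 _ _ (@mulr_lin _))).
  apply: eq_tsum2 => a b; apply: (etrans (linear_tsum2 _ _ (@mulr_lin _))).
  by apply: eq_tsum2 => c d; rewrite /P !mulrA.
have Plin (x1 y1 x2 y2 y3 : A) : linear (fun v => P x1 y1 x2 y2 v y3) /\
    linear (fun v => P x1 y1 x2 y2 y3 v) /\
    linear (fun v => P x1 y1 v x2 y2 y3) /\
    linear (fun v => P x1 y1 x2 v y2 y3) /\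
    linear (fun v => P v x1 y1 x2 y2 y3) /\
    linear (fun v => P x1 v y1 x2 y2 y3).
  by split; [|split; [|split; [|split; [|split]]]] => c u v; rewrite /P /= ?(mulrDl, mulrDr, =^~ scalerAl,
    =^~ scalerAr, linearD, linearZ) /= ?(mulrDl, mulrDr, =^~ scalerAl,
    =^~ scalerAr, linearD, linearZ).
transitivity (tsum2 (fun x1 x2 => tsum2 (fun y1 y2 =>
  tsum2 (fun a b => tsum2 (fun c d => P a c b d x2 y2) (Delta y1)) (Delta x1))
  (Delta y)) (Delta x)).
  rewrite tsum2C.
  transitivity (tsum2 (fun y1 y2 => tsum2 (fun x1 x2 =>
    tsum2 (fun a b => tsum2 (fun c d => P a y1 b c x2 d) (Delta y2)) (Delta x1))
    (Delta x)) (Delta y)).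
    apply: eq_tsum2 => y1 y2; symmetry.
    apply: (cop_assoc_sum (F := fun a b x2 =>
      tsum2 (fun c d => P a y1 b c x2 d) (Delta y2))).
    split=> [b c|a]; last split=> [b|b].
    - by apply: tsum2_lin_r => c' d; case: (Plin y1 b c' c d) => _ [_ [_ [_ []]]].
    - by apply: tsum2_lin_r => c' d; case: (Plin a y1 c' b d) => _ [_ []].
    - by apply: tsum2_lin_r => c' d; case: (Plin a y1 b c' d) => [? _].
  rewrite tsum2C; apply: eq_tsum2 => x1 x2.
  rewrite tsum2C [RHS]tsum2C; apply: eq_tsum2 => a b; symmetry.
  apply: (cop_assoc_sum (F := fun c d y2 => P a c b d x2 y2)).
  split=> [c d|c]; last split=> [d|d].
  - by case: (Plin a b c x2 d) => _ [_ [_ [_ [_ ?]]]].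
  - by case: (Plin a c b x2 d) => _ [_ [_ []]].
  - by case: (Plin a c b d x2) => _ [? _].
transitivity (tsum2 (fun x1 x2 => tsum2 (fun y1 y2 =>
  ((@cou k A x1 : k) * (@cou k A y1 : k)) *: (S y2 * S x2)) (Delta y)) (Delta x)).
  apply: eq_tsum2 => x1 x2; apply: eq_tsum2 => y1 y2.
  rewrite -[RHS]mulr_algl -outer; symmetry.
  apply: (etrans (linear_tsum2 _ _ (@mull_lin _))); apply: eq_tsum2 => a b.
  exact: (etrans (linear_tsum2 _ _ (@mull_lin _))).
transitivity (tsum2 (fun x1 x2 => (@cou k A x1 : k) *: (S y * S x2)) (Delta x)).
  apply: eq_tsum2 => x1 x2; rewrite -{2}(cou_l y); symmetry.
  have Lz : linear (fun z : A => (@cou k A x1 : k) *: (S z * S x2)).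
    move=> c u v; rewrite linearD linearZ mulrDl scalerDr -scalerAl !scalerA.
    by rewrite mulrC.
  apply: (etrans (linear_tsum2 _ _ Lz)).
  by apply: eq_tsum2 => y1 y2; rewrite linearZ -scalerAl scalerA.
have Lz : linear (fun z : A => S y * S z).
  by move=> c u v; rewrite linearD linearZ mulrDr -scalerAr.
rewrite -{2}(cou_l x); symmetry; apply: (etrans (linear_tsum2 _ _ Lz)).
by apply: eq_tsum2 => x1 x2; rewrite linearZ -scalerAr.
Qed.

End Antipode.

Record ribbonHopf (k : comNzRingType) := RibbonHopf {
  rhopf :> hopfAlg k;
  Rmx : tpow rhopf 2;
  Rmx_inv : tpow rhopf 2;
  Rmx_mulV : tmul *%R Rmx Rmx_inv = ten2 1 1;
  Rmx_mulVl : tmul *%R Rmx_inv Rmx = ten2 1 1;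
  (* (Delta ⊗ id)(R) = R_13 R_23 *)
  Rmx_cop_l :
    tsum2 (fun a b : rhopf => tsum2 (fun a1 a2 : rhopf => ten3 a1 a2 b) (cop rhopf a)) Rmx =
    tmul *%R (tsum2 (fun a b : rhopf => ten3 a 1 b) Rmx)
             (tsum2 (fun a b : rhopf => ten3 1 a b) Rmx);
  (* (id ⊗ Delta)(R) = R_13 R_12 *)
  Rmx_cop_r :
    tsum2 (fun a b : rhopf => tsum2 (fun b1 b2 : rhopf => ten3 a b1 b2) (cop rhopf b)) Rmx =
    tmul *%R (tsum2 (fun a b : rhopf => ten3 a 1 b) Rmx)
             (tsum2 (fun a b : rhopf => ten3 a b 1) Rmx);
  Rmx_quasi : forall x : rhopf,
    tsum2 (fun a b : rhopf => ten2 b a) (cop rhopf x) =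
    tmul *%R (tmul *%R Rmx (cop rhopf x)) Rmx_inv;
  (* the Drinfeld element u and its inverse *)
  drin : rhopf := tsum2 (fun a b : rhopf => antip rhopf b * a) Rmx;
  drin_inv : rhopf;
  drin_mulV : drin * drin_inv = 1;
  drin_mulVl : drin_inv * drin = 1;
  (* the balancing element kappa and its inverse *)
  bal : rhopf;
  bal_inv : rhopf;
  bal_mulV : bal * bal_inv = 1;
  bal_mulVl : bal_inv * bal = 1;
  bal_sq : bal * bal = drin * antip rhopf drin_inv;
  bal_cop : cop rhopf bal = ten2 bal bal;
  bal_antip2 : forall x, antip rhopf (antip rhopf x) = bal * x * bal_inv
}.

Definition ribbon_elt (k : comNzRingType) (A : ribbonHopf k) : A :=
  bal_inv A * drin A.

Definition ribbon_elt_inv (k : comNzRingType) (A : ribbonHopf k) : A :=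
  drin_inv A * bal A.

(* A [vectType k] is a [k]-module with an isomorphism to some [k^n] *)
Record fMod (k : comNzRingType) (A : hopfAlg k) := FMod {
  fcar :> vectType k;
  fmod_act : {linear A -> 'End(fcar)};
  fmod_act1 : fmod_act 1 = \1%VF;
  fmod_actM : forall a b, fmod_act (a * b) = (fmod_act a \o fmod_act b)%VF
}.

Section Dual.

Variables (k : comNzRingType) (A : hopfAlg k) (W : fMod A).

Definition dual_car : vectType k := 'Hom(W, k^o).

Definition dual_act_fun (a : A) (omega : dual_car) : dual_car :=
  (omega \o fmod_act W (antip A a))%VF.

Lemma dual_act_fun_linear a : linear (dual_act_fun a).
Proof.
move=> c u v; apply/lfunP => w; by rewrite /dual_act_fun
  !(add_lfunE, scale_lfunE, comp_lfunE).
Qed.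

HB.instance Definition _ a :=
  GRing.isLinear.Build k dual_car dual_car *:%R (dual_act_fun a)
    (dual_act_fun_linear a).

Definition dual_act (a : A) : 'End(dual_car) := linfun (dual_act_fun a).

Lemma dual_actE a omega w :
  dual_act a omega w = omega (fmod_act W (antip A a) w).
Proof. by rewrite lfunE /= comp_lfunE. Qed.

Lemma dual_act_linear : linear dual_act.
Proof.
move=> c a b; apply/lfunP => omega; apply/lfunP => w.
rewrite !(add_lfunE, scale_lfunE, dual_actE) !linearP.
by rewrite add_lfunE scale_lfunE linearP.
Qed.

HB.instance Definition _ :=
  GRing.isLinear.Build k A 'End(dual_car) *:%R dual_act dual_act_linear.

Lemma dual_act1 : dual_act 1 = \1%VF.
Proof.
apply/lfunP => omega; apply/lfunP => w.
by rewrite dual_actE antip1 fmod_act1 !lfunE.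
Qed.

Lemma dual_actM a b : dual_act (a * b) = (dual_act a \o dual_act b)%VF.
Proof.
apply/lfunP => omega; apply/lfunP => w.
by rewrite comp_lfunE !dual_actE antipM fmod_actM comp_lfunE.
Qed.

Definition dual : fMod A := @FMod k A dual_car dual_act dual_act1 dual_actM.

End Dual.

(** * Strict monoidal categories and functors

   The operations of a strict monoidal category.  The morphisms are those
   arrows that satisfy [hom], and two arrows denote the same morphism when they
   are related by [eqarr]. *)

Record smcat := SMCat {
  ob : Type;
  arr : ob -> ob -> Type;
  hom : forall a b, arr a b -> Prop;
  eqarr : forall a b, arr a b -> arr a b -> Prop;
  idc : forall a, arr a a;
  cmp : forall a b c, arr b c -> arr a b -> arr a c;
  unit_ob : ob;
  tob : ob -> ob -> ob;
  tarr : forall a b c d, arr a b -> arr c d -> arr (tob a c) (tob b d)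
}.

Arguments cmp {s a b c} _ _.
Arguments tarr {s a b c d} _ _.
Arguments unit_ob {s}.
Arguments tob {s} _ _.

Definition castm (O : Type) (H : O -> O -> Type) (a a' b b' : O)
    (ea : a = a') (eb : b = b') (f : H a b) : H a' b' :=
  ecast z (H a' z) eb (ecast z (H z b) ea f).

Record premap (C D : smcat) := PreMap {
  pob :> ob C -> ob D;
  parr : forall a b, arr a b -> arr (pob a) (pob b)
}.

Arguments parr {C D} p {a b} _.

Definition premap_comp (C D E : smcat) (G : premap D E) (F : premap C D) :
    premap C E :=
  @PreMap C E (fun a => G (F a)) (fun a b f => parr G (parr F f)).

Definition premap_eq (C D : smcat) (F G : premap C D) : Prop :=
  exists e : forall a, F a = G a,
    forall a b (f : arr a b), hom f ->
      eqarr (castm (e a) (e b) (parr F f)) (parr G f).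

Record strict_functor (C D : smcat) := StrictFunctor {
  fpre :> premap C D;
  fhom : forall a b (f : arr a b), hom f -> hom (parr fpre f);
  feq : forall a b (f g : arr a b), hom f -> hom g -> eqarr f g ->
    eqarr (parr fpre f) (parr fpre g);
  fid : forall a, eqarr (parr fpre (idc a)) (idc (fpre a));
  fcmp : forall a b c (g : arr b c) (f : arr a b), hom g -> hom f ->
    eqarr (parr fpre (cmp g f)) (cmp (parr fpre g) (parr fpre f));
  fone : fpre unit_ob = unit_ob;
  ftob : forall a b, fpre (tob a b) = tob (fpre a) (fpre b);
  ftarr : forall a b c d (f : arr a b) (g : arr c d), hom f -> hom g ->
    eqarr (castm (ftob a c) (ftob b d) (parr fpre (tarr f g)))
      (tarr (parr fpre f) (parr fpre g))
}.

(** * Tangles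

   The free strict ribbon category on one object: the words in [true] (for +)
   and [false] (for -), and the terms generated by identities, composition,
   tensor product, braiding, twist, and the evaluation and coevaluation
   exhibiting - as the left dual of +, modulo the congruence [teq] generated by
   the axioms of a strict ribbon category. *)

Definition word := seq bool.

Inductive tangle : word -> word -> Type :=
| Tid a : tangle a a
| Tcmp a b c : tangle b c -> tangle a b -> tangle a c
| Tten a b c d : tangle a b -> tangle c d -> tangle (a ++ c) (b ++ d)
| Tbr a b : tangle (a ++ b) (b ++ a)
| TbrV a b : tangle (b ++ a) (a ++ b)
| Ttw a : tangle a a
| TtwV a : tangle a a
| Tev : tangle [:: false; true] [::]
| Tcoev : tangle [::] [:: true; false].

Notation castT := (@castm word tangle _ _ _ _).

(* The relation is heterogeneous, as the two sides of the strict associativity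
   and right unit laws have source and target that are equal, but not
   convertible. *)
Inductive teq : forall a b, tangle a b -> forall a' b', tangle a' b' -> Prop :=
| teq_refl a b (f : tangle a b) : teq f f
| teq_sym a b (f : tangle a b) a' b' (f' : tangle a' b') : teq f f' -> teq f' f
| teq_trans a b (f : tangle a b) a' b' (f' : tangle a' b') a'' b''
    (f'' : tangle a'' b'') : teq f f' -> teq f' f'' -> teq f f''
| teq_cmp a b c (g : tangle b c) (f : tangle a b)
    a' b' c' (g' : tangle b' c') (f' : tangle a' b') :
    teq g g' -> teq f f' -> teq (Tcmp g f) (Tcmp g' f')
| teq_ten a b c d (f : tangle a b) (g : tangle c d)
    a' b' c' d' (f' : tangle a' b') (g' : tangle c' d') :
    teq f f' -> teq g g' -> teq (Tten f g) (Tten f' g')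
| teq_idl a b (f : tangle a b) : teq (Tcmp (Tid b) f) f
| teq_idr a b (f : tangle a b) : teq (Tcmp f (Tid a)) f
| teq_cmpA a b c d (h : tangle c d) (g : tangle b c) (f : tangle a b) :
    teq (Tcmp h (Tcmp g f)) (Tcmp (Tcmp h g) f)
| teq_ten_id a b : teq (Tten (Tid a) (Tid b)) (Tid (a ++ b))
| teq_ten_cmp a b c a' b' c' (g : tangle b c) (f : tangle a b)
    (g' : tangle b' c') (f' : tangle a' b') :
    teq (Tten (Tcmp g f) (Tcmp g' f')) (Tcmp (Tten g g') (Tten f f'))
| teq_tenA a b c d a' b' (f : tangle a b) (g : tangle c d)
    (h : tangle a' b') : teq (Tten f (Tten g h)) (Tten (Tten f g) h)
| teq_ten1l a b (f : tangle a b) : teq (Tten (Tid [::]) f) f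
| teq_ten1r a b (f : tangle a b) : teq (Tten f (Tid [::])) f
| teq_brV a b : teq (Tcmp (TbrV a b) (Tbr a b)) (Tid (a ++ b))
| teq_Vbr a b : teq (Tcmp (Tbr a b) (TbrV a b)) (Tid (b ++ a))
| teq_br_nat a b c d (f : tangle a b) (g : tangle c d) :
    teq (Tcmp (Tbr b d) (Tten f g)) (Tcmp (Tten g f) (Tbr a c))
| teq_hexl a b c :
    teq (Tbr (a ++ b) c)
        (Tcmp (Tten (Tbr a c) (Tid b))
              (castT erefl (catA a c b) (Tten (Tid a) (Tbr b c))))
| teq_hexr a b c :
    teq (Tbr a (b ++ c))
        (Tcmp (Tten (Tid b) (Tbr a c))
              (castT erefl (esym (catA b a c)) (Tten (Tbr a b) (Tid c))))
| teq_twV a : teq (Tcmp (TtwV a) (Ttw a)) (Tid a)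
| teq_Vtw a : teq (Tcmp (Ttw a) (TtwV a)) (Tid a)
| teq_tw_nat a b (f : tangle a b) : teq (Tcmp (Ttw b) f) (Tcmp f (Ttw a))
| teq_tw_ten a b :
    teq (Ttw (a ++ b))
        (Tcmp (Tbr b a) (Tcmp (Tbr a b) (Tten (Ttw a) (Ttw b))))
| teq_zigzag_pos :
    teq (Tcmp (Tten (Tid [:: true]) Tev) (Tten Tcoev (Tid [:: true])))
        (Tid [:: true])
| teq_zigzag_neg :
    teq (Tcmp (Tten Tev (Tid [:: false])) (Tten (Tid [:: false]) Tcoev))
        (Tid [:: false])
(* the twist of - is the transpose of the twist of + *)
| teq_tw_dual :
    teq (Tcmp Tev (Tten (Ttw [:: false]) (Tid [:: true])))
        (Tcmp Tev (Tten (Tid [:: false]) (Ttw [:: true]))).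

Definition Tcat : smcat := {|
  ob := word;
  arr := tangle;
  hom := fun _ _ _ => True;
  eqarr := fun _ _ f g => teq f g;
  idc := Tid;
  cmp := Tcmp;
  unit_ob := [::];
  tob := cat;
  tarr := Tten
|}.

Definition plus n : word := nseq n true.

Lemma plusD n m : plus (n + m) = plus n ++ plus m.
Proof. exact: nseqD. Qed.

Definition Tplus : smcat := {|
  ob := nat;
  arr := fun n m => tangle (plus n) (plus m);
  hom := fun _ _ _ => True;
  eqarr := fun _ _ f g => teq f g;
  idc := fun n => Tid (plus n);
  cmp := fun _ _ _ g f => Tcmp g f;
  unit_ob := 0%N;
  tob := addn;
  tarr := fun n m n' m' f g =>
    castT (esym (plusD n n')) (esym (plusD m m')) (Tten f g)
|}.

Definition Tincl : premap Tplus Tcat :=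
  @PreMap Tplus Tcat plus (fun _ _ f => f).

(* The right evaluation ev τ_{+,-} (θ_+ ⊗ id) *)
Definition Tevr : tangle [:: true; false] [::] :=
  Tcmp Tev (Tcmp (Tbr [:: true] [:: false])
                 (Tten (Ttw [:: true]) (Tid [:: false]))).

Definition Tclose (a b : word) (f : tangle (a ++ [:: true]) (b ++ [:: true])) :
    tangle a b :=
  Tcmp (castT erefl (cats0 b) (Tten (Tid b) Tevr))
    (Tcmp (castT (esym (catA a [:: true] [:: false]))
                 (esym (catA b [:: true] [:: false]))
             (Tten f (Tid [:: false])))
          (castT (cats0 a) erefl (Tten (Tid a) Tcoev))).

Lemma plusSr n m : plus (n + m.+1) = plus (n + m) ++ [:: true].
Proof. by rewrite addnS -addn1 plusD. Qed.

(* Closure of the [u] rightmost strands *)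
Fixpoint Ttr (n m u : nat) :
    tangle (plus (n + u)) (plus (m + u)) -> tangle (plus n) (plus m) :=
  if u is u'.+1
    return tangle (plus (n + u)) (plus (m + u)) -> tangle (plus n) (plus m)
  then fun f => @Ttr n m u' (Tclose (castT (plusSr n u') (plusSr m u') f))
  else fun f =>
    castT (congr1 plus (addn0 n)) (congr1 plus (addn0 m)) f.

Section FModCat.

Variables (k : comNzRingType) (A : ribbonHopf k).

Definition fmodl (V : fMod A) : lmodType k := fcar V.

Local Notation T s := (tens fmodl s).

Definition tcons (V : fMod A) s (v : V) (x : T s) : T (V :: s) :=
  lift (fun h : hlist fmodl s => pure ((v, h) : hlist fmodl (V :: s))) x.

(* a (v ⊗ x) = \sum a_(1) v ⊗ a_(2) x *)
Fixpoint hact s (a : A) : hlist fmodl s -> T s :=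
  if s is V :: s' return hlist fmodl s -> T s then
    fun h => tsum2 (fun a1 a2 : A => tcons (fmod_act V a1 h.1) (hact a2 h.2))
               (cop A a)
  else fun h => (cou A a : k) *: pure (h : hlist fmodl [::]).

Definition tact s (a : A) (x : T s) : T s := lift (hact a) x.

(* The linearity conditions are imposed by [hom]; [tarr f g] is the tensor
   product of [f] and [g] when these are linear. *)
Definition FModStr : smcat := {|
  ob := seq (fMod A);
  arr := fun s t => T s -> T t;
  hom := fun s t f => linear f /\ forall a x, f (tact a x) = tact a (f x);
  eqarr := fun _ _ f g => f =1 g;
  idc := fun s x => x;
  cmp := fun _ _ _ g f x => g (f x);
  unit_ob := [::];
  tob := cat;
  tarr := fun s t s' t' f g =>
    lift (fun h => tcat (f (pure (htake h))) (g (pure (hdrop h))))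
|}.

(* v ⊗ w |-> \sum_r b_r w ⊗ a_r v, for R = \sum_r a_r ⊗ b_r *)
Definition fbraid s t : T (s ++ t) -> T (t ++ s) :=
  lift (fun h => tsum2 (fun a b : A =>
    tcat (tact b (pure (hdrop h))) (tact a (pure (htake h)))) (Rmx A)).

Definition ftwist s : T s -> T s := tact (ribbon_elt_inv A).

Definition fev (W : fMod A) : T [:: dual W; W] -> T [::] :=
  lift (fun h : hlist fmodl [:: dual W; W] =>
    ((h.1 : 'Hom(W, k^o)) h.2.1 : k) *: pure (tt : hlist fmodl [::])).

Definition fbasis (W : fMod A) (i : 'I_(dim W)) : W := r2v (delta_mx 0 i).

Definition fcoord (W : fMod A) (i : 'I_(dim W)) : dual W :=
  linfun (fun w : W => v2r w 0 i : k^o).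

Definition fcoev (W : fMod A) : T [::] -> T [:: W; dual W] :=
  lift (fun _ : hlist fmodl [::] =>
    \sum_i pure ((fbasis i, (fcoord i, tt)) : hlist fmodl [:: W; dual W])).

Definition sgn_mod (W : fMod A) (e : bool) : fMod A := if e then W else dual W.

Lemma fob_word (W : fMod A) (F : strict_functor Tcat FModStr) :
  (forall e, F [:: e] = [:: sgn_mod W e]) ->
  forall w, F w = [seq sgn_mod W e | e <- w].
Proof.
move=> F1; elim=> [|e w IH]; first exact: fone.
by rewrite -[e :: w]/(tob (s := Tcat) [:: e] w) ftob F1 IH.
Qed.

(* [F] sends + to the one-term sequence of [W] and preserves braiding, twist
   and the duality between + and -. *)
Definition preserves_ribbon (W : fMod A) (F : strict_functor Tcat FModStr) :=
  exists F1 : forall e, F [:: e] = [:: sgn_mod W e],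
  [/\ forall a b, castm (ftob F a b) (ftob F b a) (parr F (Tbr a b)) =1
                  @fbraid (F a) (F b),
      forall a, parr F (Ttw a) =1 @ftwist (F a),
      castm (fob_word F1 _) (fob_word F1 _) (parr F Tev) =1 @fev W
    & castm (fob_word F1 _) (fob_word F1 _) (parr F Tcoev) =1 @fcoev W].

End FModCat.

Record xcAlg (k : comNzRingType) := XCAlg {
  xcar :> lmodType k;
  xmul : xcar -> xcar -> xcar;
  xone : xcar;
  xR : tpow xcar 2;
  xkap : xcar;
  xkap_inv : xcar;
  xtr : xcar -> k
}.

Section Perms.

Lemma block_perm_inj n m (s : 'S_n) (t : 'S_m) :
  injective (fun i : 'I_(n + m) => match split i with
                                   | inl j => lshift m (s j)
                                   | inr j => rshift n (t j)
                                   end).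
Proof.
move=> i j; rewrite -{2}(splitK i) -{2}(splitK j).
case: (split i) => i'; case: (split j) => j' /= E; have := congr1 val E => /=.
- by move/val_inj/perm_inj->.
- by move=> E'; have := ltn_ord (s i'); rewrite E' ltnNge leq_addr.
- by move=> E'; have := ltn_ord (s j'); rewrite -E' ltnNge leq_addr.
- by move/addnI/val_inj/perm_inj->.
Qed.

Definition block_perm n m (s : 'S_n) (t : 'S_m) : 'S_(n + m) :=
  perm (@block_perm_inj n m s t).

(* Removing the largest index from its cycle; if that index is fixed this is
   the restriction to the other ones *)
Definition del_perm_fun n (s : 'S_n.+1) (i : 'I_n) : 'I_n :=
  let l := fintype.lift ord_max i in
  odflt i (unlift ord_max (if s l == ord_max then s ord_max else s l)).

Lemma del_perm_inj n (s : 'S_n.+1) : injective (del_perm_fun s).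
Proof.
pose g i := let l := fintype.lift ord_max i in
  if s l == ord_max then s ord_max else s l.
have gE i : fintype.lift ord_max (del_perm_fun s i) = g i.
  rewrite /del_perm_fun -/(g i); case: unliftP => [j ->//|]; rewrite /g /=.
  case: ifP => [/eqP E1 E2|E1 E2]; last by rewrite E2 eqxx in E1.
  by have := neq_lift ord_max i; rewrite -(inj_eq (@perm_inj _ s)) E1 E2 eqxx.
move=> i j E; apply: (@lift_inj _ ord_max); apply: (@perm_inj _ s).
have : g i = g j by rewrite -!gE E.
rewrite /g /=; case: ifP => [/eqP->|Ei]; case: ifP => [/eqP->|Ej] // /perm_inj.
  by move/eqP; rewrite (negPf (neq_lift _ _)).
by move/eqP; rewrite eq_sym (negPf (neq_lift _ _)).
Qed.

Definition del_perm n (s : 'S_n.+1) : 'S_n := perm (@del_perm_inj n s).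

End Perms.

Section Elements.

Variables (k : comNzRingType) (B : xcAlg k).

(* Composition in the permutation groups ['S_n] is written from left to
   right. *)
Definition elt n := (tpow B n * 'S_n)%type.

Definition elt1 n : elt n := (tvec (fun=> xone B), 1%g).

Definition emul n (x y : elt n) : elt n :=
  (tmul (@xmul k B) (sperm (y.2^-1)%g x.1) y.1, (y.2 * x.2)%g).

Inductive submonoid n (S : elt n -> Prop) : elt n -> Prop :=
| submonoid_one : submonoid S (elt1 n)
| submonoid_gen x : S x -> submonoid S x
| submonoid_mul x y : submonoid S x -> submonoid S y -> submonoid S (emul x y).

Definition Rhat n (i j : 'I_n) : elt n :=
  (tsum2 (fun a b : B => tvec (fun l =>
     if l == i then a else if l == j then b else xone B)) (xR B),
   tperm i j).

Definition Jgen n (x : elt n) : Prop :=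
  exists i j : 'I_n, j = i.+1 :> nat /\
    (x = Rhat i j \/
     emul x (Rhat i j) = elt1 n /\ emul (Rhat i j) x = elt1 n).

Definition Jmon n : elt n -> Prop := submonoid (@Jgen n).

Definition phi1 n (x : elt n.+1) : elt n :=
  let j := (x.2^-1)%g ord_max in
  (tsum (fun u : 'I_n.+1 -> B =>
     if j == ord_max then
       xtr (xmul (xkap B) (u ord_max)) *:
         tvec (fun i : 'I_n => u (fintype.lift ord_max i))
     else
       tvec (fun i : 'I_n => let l := fintype.lift ord_max i in
         if l == j then xmul (u ord_max) (xmul (xkap B) (u j)) else u l)) x.1,
   del_perm x.2).

Fixpoint phi n m : elt (n + m) -> elt n :=
  if m is m'.+1 return elt (n + m) -> elt n then
    fun x => phi (phi1 (ecast z (elt z) (addnS n m') x))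
  else fun x => ecast z (elt z) (addn0 n) x.

Definition Imon n : elt n -> Prop :=
  if n is 0 then fun _ => True
  else submonoid (fun x => exists m (y : elt (n + m)), Jmon y /\ x = phi y).

Record earr n m := EArr { earr_eq : n = m; earr_el : elt n }.

Definition ecmp n m p (g : earr m p) (f : earr n m) : earr n p :=
  EArr (etrans (earr_eq f) (earr_eq g))
    (emul (ecast z (elt z) (esym (earr_eq f)) (earr_el g)) (earr_el f)).

Definition eten n m n' m' (f : earr n m) (g : earr n' m') :
    earr (n + n') (m + m') :=
  EArr (f_equal2 addn (earr_eq f) (earr_eq g))
    (tsum (fun u : 'I_n -> B => tsum (fun v : 'I_n' -> B =>
       tvec (fun i : 'I_(n + n') => match split i with
                                    | inl j => u j
                                    | inr j => v j
                                    end)) (earr_el g).1) (earr_el f).1,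
     block_perm (earr_el f).2 (earr_el g).2).

Definition Ecat : smcat := {|
  ob := nat;
  arr := earr;
  hom := fun _ _ f => Imon (earr_el f);
  eqarr := fun _ _ f g => f = g;
  idc := fun n => EArr erefl (elt1 n);
  cmp := ecmp;
  unit_ob := 0%N;
  tob := addn;
  tarr := eten
|}.

Definition ebraid11 : earr 2 2 := EArr erefl (Rhat (ord0 : 'I_2) ord_max).

Definition etwist1 : earr 1 1 :=
  EArr erefl
    (tvec (fun=> tsum2 (fun a b : B => xmul a (xmul (xkap_inv B) b)) (xR B)),
     1%g).

Definition etr n m u (f : earr (n + u) (m + u)) : earr n m :=
  EArr (addIn (earr_eq f)) (phi (earr_el f)).

Lemma fob_nat (F : strict_functor Tplus Ecat) :
  F 1%N = 1%N -> forall n, F n = n.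
Proof.
move=> F1; elim=> [|n IH]; first exact: fone.
by rewrite -addn1 -[(n + 1)%N]/(tob (s := Tplus) n 1%N) ftob F1 IH.
Qed.

(* The components of the braiding and of the twist at all other objects are
   determined, in the source and in the target, by those at the generator. *)
Definition preserves_traced (F : strict_functor Tplus Ecat) :=
  exists F1 : F 1%N = 1%N,
  [/\ castm (fob_nat F1 2) (fob_nat F1 2)
        (@parr _ _ F 2%N 2%N (Tbr [:: true] [:: true])) = ebraid11,
      castm (fob_nat F1 1) (fob_nat F1 1)
        (@parr _ _ F 1%N 1%N (Ttw [:: true])) = etwist1
    & forall n m u (f : tangle (plus (n + u)) (plus (m + u))),
        castm (fob_nat F1 n) (fob_nat F1 m) (@parr _ _ F n m (Ttr f)) =
        etr (castm (fob_nat F1 (n + u)) (fob_nat F1 (m + u))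
               (@parr _ _ F (n + u)%N (m + u)%N f))].

End Elements.

Section Endo.

Variables (k : comNzRingType) (A : ribbonHopf k) (W : fMod A).

Definition end_xc : xcAlg k := {|
  xcar := 'End(W);
  xmul := fun f g => (f \o g)%VF;
  xone := \1%VF;
  xR := tsum2 (fun a b : A => ten2 (fmod_act W a) (fmod_act W b)) (Rmx A);
  xkap := fmod_act W (bal A);
  xkap_inv := fmod_act W (bal_inv A);
  xtr := fun f => \tr (f2mx f)
|}.

(* (\sum f_1 ⊗ .. ⊗ f_n, sigma) |-> sigma_* o (\sum f_1 ⊗ .. ⊗ f_n) *)
Definition iota_elt n (x : elt end_xc n) (w : tens (@fmodl k A) (nseq n W)) :
    tens (@fmodl k A) (nseq n W) :=
  sperm x.2 (tsum (fun f : 'I_n -> 'End(W) =>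
    lift (fun h : hlist (@fmodl k A) (nseq n W) =>
      pure (hmk (@fmodl k A) W (fun i => f i (hnth h i)))) w) x.1).

Definition iota_emb : premap (Ecat end_xc) (FModStr A) :=
  @PreMap (Ecat end_xc) (FModStr A) (fun n => nseq n W)
    (fun n m (f : earr end_xc n m) =>
       ecast z (tens (@fmodl k A) (nseq n W) -> tens (@fmodl k A) (nseq z W))
         (earr_eq f) (iota_elt (earr_el f))).

End Endo.

(* Main.v *)
Require Import Defs.
From mathcomp Require Import all_boot all_algebra.
From HB Require Import structures.
From mathcomp Require Import all_fingroup boolp.
From Stdlib Require Import Setoid Morphisms.
(* [lift] and [pure] denote the tensor operations rather than their MathComp
   homonyms. *)
Require Import Defs.

(** The functors agree on the crossing by a direct computation and both respect
   composition, tensor products and traces, so it is enough that these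
   operations generate all tangles with positive end points from the crossing
   and its inverse (the twist is the trace of the crossing).  To see this, call
   [h : +^m -> c] bent when turning the last [-] of [c] down into a new input
   strand, and iterating, ends in a generated tangle.  Bent tangles are stable
   under every elementary slice: an evaluation closes a strand, hence becomes a
   trace; a coevaluation adds a straight strand; a [-] passing to the left of a
   [+] changes nothing; and the other crossings of a [-] are rotations of these.
   For the traces, the right evaluation sends [w ⊗ ω] to [ω (κ w)], so that the
   partial trace of [σ_* ∘ (f_1 ⊗ .. ⊗ f_n)] inserts [κ] as [phi1] does. *)

Set Implicit Arguments.
Unset Strict Implicit.
Unset Printing Implicit Defensive.

Import GRing.Theory VectorInternalTheory.

(** The universal property of tangles does not settle the comparison: it concerns functors on all
    words, whereas [Z] lives on positive words only and [Ecat] has no object for [-]. What is left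
    is a generation statement, and the obstacle is that a tangle with positive ends is still a
    composite of slices whose intermediate words contain [-] in arbitrary positions. Bending is the
    invariant that survives such words: it trades each [-] of the target for one more positive
    input, so that a partial composite is recorded by a positive tangle. The last [-] is the one to
    bend, because only positive strands lie to its right, and the crossings that lead the new input
    past them are then generated ones. The trace closes a strand with the right evaluation, which
    contains a braiding and a twist; turning an evaluation into a trace therefore costs an inverse
    twist and inverse crossings, and the inverse twist too must be obtained as a trace. Closing
    several strands is iterated closing of one, in [Ttr] as in [phi], so traces over one strand
    suffice. *)

Local Notation castT := (@castm word tangle _ _ _ _).

(** * Untyped terms for tangles *)

#[local] Arguments castm : simpl never.

(* Source and target are computed rather than being indices, so that the strict
   associativity and unit laws of the tensor product need no casts. *)
Inductive raw :=
| Rid of word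
| Rcmp of raw & raw
| Rten of raw & raw
| Rbr of word & word
| RbrV of word & word
| Rtw of word
| RtwV of word
| Rev
| Rcoev.

Fixpoint src r : word :=
  match r with
  | Rid a | Rtw a | RtwV a => a
  | Rcmp g f => src f
  | Rten f g => src f ++ src g
  | Rbr a b => a ++ b
  | RbrV a b => b ++ a
  | Rev => [:: false; true]
  | Rcoev => [::]
  end.

Fixpoint tgt r : word :=
  match r with
  | Rid a | Rtw a | RtwV a => a
  | Rcmp g f => tgt g
  | Rten f g => tgt f ++ tgt g
  | Rbr a b => b ++ a
  | RbrV a b => a ++ b
  | Rev => [::]
  | Rcoev => [:: true; false]
  end.

Fixpoint wf r : bool :=
  match r with
  | Rcmp g f => [&& wf g, wf f & tgt f == src g]
  | Rten f g => wf f && wf g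
  | _ => true
  end.

Lemma wf_cmp1 g f : wf (Rcmp g f) -> wf g. Proof. by case/and3P. Qed.
Lemma wf_cmp2 g f : wf (Rcmp g f) -> wf f. Proof. by case/and3P. Qed.
Lemma wf_cmp3 g f : wf (Rcmp g f) -> src g = tgt f.
Proof. by case/and3P=> _ _ /eqP. Qed.
Lemma wf_ten1 f g : wf (Rten f g) -> wf f. Proof. by case/andP. Qed.
Lemma wf_ten2 f g : wf (Rten f g) -> wf g. Proof. by case/andP. Qed.

(** A cast occurs only at the middle word of a composite, where well-formedness supplies an equality
    instead of convertibility. *)
Fixpoint den r : wf r -> tangle (src r) (tgt r) :=
  match r return wf r -> tangle (src r) (tgt r) with
  | Rid a => fun=> Tid a
  | Rcmp g f => fun H =>
      Tcmp (castT (wf_cmp3 H) erefl (den (wf_cmp1 H))) (den (wf_cmp2 H))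
  | Rten f g => fun H => Tten (den (wf_ten1 H)) (den (wf_ten2 H))
  | Rbr a b => fun=> Tbr a b
  | RbrV a b => fun=> TbrV a b
  | Rtw a => fun=> Ttw a
  | RtwV a => fun=> TtwV a
  | Rev => fun=> Tev
  | Rcoev => fun=> Tcoev
  end.

Lemma teq_cast a a' b b' (ea : a = a') (eb : b = b') (f : tangle a b) :
  teq (castT ea eb f) f.
Proof. by case: _ / ea; case: _ / eb; exact: teq_refl. Qed.

Lemma den_irr r (H H' : wf r) : den H = den H'.
Proof. by rewrite (bool_irrelevance H H'). Qed.

(* Ill-formed terms are only related to ill-formed ones, so that most of the
   axioms below hold without any composability hypothesis. *)
Definition req r s :=
  [/\ src r = src s, tgt r = tgt s, wf r = wf s &
      forall H H', teq (@den r H) (@den s H')].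

Local Infix "≈" := req (at level 70).

Lemma req_refl r : r ≈ r.
Proof. by split=> // H H'; rewrite (den_irr H H'); exact: teq_refl. Qed.

Lemma req_sym r s : r ≈ s -> s ≈ r.
Proof. by case=> ? ? ? T; split=> // H H'; exact/teq_sym/T. Qed.

Lemma req_trans r s t : r ≈ s -> s ≈ t -> r ≈ t.
Proof.
case=> e1 e2 e3 T [e1' e2' e3' T']; split=> [|||H H'].
- exact: etrans e1'.
- exact: etrans e2'.
- exact: etrans e3'.
- have H0 : wf s by rewrite -e3.
  exact: teq_trans (T H H0) (T' H0 H').
Qed.

#[local] Instance req_equiv : Equivalence req.
Proof. by split; [exact: req_refl | exact: req_sym | exact: req_trans]. Qed.

Lemma teq_castl a a' b b' (ea : a = a') (eb : b = b') (f : tangle a b)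
    c d (g : tangle c d) :
  teq f g -> teq (castT ea eb f) g.
Proof. exact/teq_trans/teq_cast. Qed.

Lemma teq_castr a a' b b' (ea : a = a') (eb : b = b') (f : tangle a b)
    c d (g : tangle c d) :
  teq g f -> teq g (castT ea eb f).
Proof. by move=> H; apply: teq_trans H (teq_sym (teq_cast _ _ _)). Qed.

Lemma Rcmp_congr g g' f f' : g ≈ g' -> f ≈ f' -> Rcmp g f ≈ Rcmp g' f'.
Proof.
case=> a1 a2 a3 a4 [b1 b2 b3 b4]; split=> //=; first by rewrite a3 b3 a1 b2.
move=> H H'; apply: teq_cmp; last exact: b4.

by apply: teq_castl; apply: teq_castr; exact: a4.
Qed.

Lemma Rten_congr g g' f f' : g ≈ g' -> f ≈ f' -> Rten g f ≈ Rten g' f'.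
Proof.
case=> a1 a2 a3 a4 [b1 b2 b3 b4].
split=> /=; rewrite ?a1 ?a2 ?a3 ?b1 ?b2 ?b3 // => H H'.
by apply: teq_ten; [exact: a4 | exact: b4].
Qed.

#[local] Instance Rcmp_proper : Proper (req ==> req ==> req) Rcmp.
Proof. by move=> g g' Eg f f' Ef; exact: Rcmp_congr. Qed.

#[local] Instance Rten_proper : Proper (req ==> req ==> req) Rten.
Proof. by move=> g g' Eg f f' Ef; exact: Rten_congr. Qed.

(** Compares the denotation of a composite with a typed composite factor by factor, without
    mentioning the cast inserted by [den]. The factors are compared for every proof of
    well-formedness, so no particular proof has to be exhibited. *)
Lemma den_cmpE g f a b c (g' : tangle b c)
    (f' : tangle a b) :
  (forall Hg, teq (@den g Hg) g') -> (forall Hf, teq (@den f Hf) f') ->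
  forall H : wf (Rcmp g f), teq (den H) (Tcmp g' f').
Proof. by move=> Eg Ef H /=; apply: teq_cmp => //; apply: teq_castl. Qed.

Lemma den_tenE f g a b c d (f' : tangle a b)
    (g' : tangle c d) :
  (forall Hf, teq (@den f Hf) f') -> (forall Hg, teq (@den g Hg) g') ->
  forall H : wf (Rten f g), teq (den H) (Tten f' g').
Proof. by move=> Ef Eg H /=; apply: teq_ten. Qed.

#[local] Arguments den : simpl never.

Lemma den_self r (H : wf r) (H' : wf r) : teq (den H') (den H).
Proof. by rewrite (den_irr H' H); exact: teq_refl. Qed.

Lemma den_selfc r (H : wf r) a b (ea : src r = a) (eb : tgt r = b)
  (H' : wf r) : teq (den H') (castT ea eb (den H)).
Proof. by apply/teq_castr/den_self. Qed.

Lemma den_idE a (H : wf (Rid a)) : teq (den H) (Tid a).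
Proof. exact: teq_refl. Qed.
Lemma den_brE a b (H : wf (Rbr a b)) : teq (den H) (Tbr a b).
Proof. exact: teq_refl. Qed.
Lemma den_twE a (H : wf (Rtw a)) : teq (den H) (Ttw a).
Proof. exact: teq_refl. Qed.

Lemma cmpA h g f : Rcmp (Rcmp h g) f ≈ Rcmp h (Rcmp g f).
Proof.
split=> // [|H H'].
  by rewrite /=; case: (wf h); case: (wf g); case: (wf f); case: eqP; case: eqP.
have := H; have := H' => /=.
case/and3P=> Hh /and3P [Hg Hf /eqP efg] /eqP ehg _.
have D := den_selfc.
apply: teq_trans (den_cmpE (den_cmpE (D _ Hh _ _ (esym ehg) erefl)
  (D _ Hg _ _ (esym efg) erefl)) (den_self Hf) _) _.
apply: teq_trans (teq_sym (teq_cmpA _ _ _)) _; apply: teq_sym.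
exact: (den_cmpE (D _ Hh _ _ (esym ehg) erefl)
  (den_cmpE (D _ Hg _ _ (esym efg) erefl) (den_self Hf)) H').
Qed.

Lemma cmp1l r a : a = tgt r -> Rcmp (Rid a) r ≈ r.
Proof.
move->; split=> // [|H H']; first by rewrite /= eqxx andbT.
apply: teq_trans (teq_idl (den H')).
exact: (den_cmpE (@den_idE _) (den_self H') H).
Qed.

Lemma cmp1r r a : a = src r -> Rcmp r (Rid a) ≈ r.
Proof.
move->; split=> // [|H H']; first by rewrite /= eqxx !andbT.
apply: teq_trans (teq_idr (den H')).
exact: (den_cmpE (den_self H') (@den_idE _) H).
Qed.

Lemma ten_id a b : Rten (Rid a) (Rid b) ≈ Rid (a ++ b).
Proof. by split=> // H H'; exact: teq_ten_id. Qed.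

Lemma tenA f g h : Rten f (Rten g h) ≈ Rten (Rten f g) h.
Proof.
split=> [|||H H']; [by rewrite /= catA | by rewrite /= catA |
  by rewrite /= andbA |].
have := H; have := H' => /=.
case/andP=> /andP [Hf Hg] Hh _.
apply: teq_trans (den_tenE (den_self Hf)
  (den_tenE (den_self Hg) (den_self Hh)) _) _.
apply: teq_trans (teq_tenA _ _ _) (teq_sym _).
exact: (den_tenE (den_tenE (den_self Hf) (den_self Hg)) (den_self Hh) H').
Qed.

Lemma ten1l f : Rten (Rid [::]) f ≈ f.
Proof.
split=> // H H'; apply: teq_trans (teq_ten1l _).
exact: (den_tenE (@den_idE _) (den_self H') H).
Qed.

Lemma ten1r f : Rten f (Rid [::]) ≈ f.
Proof.
split=> [|||H H']; [by rewrite /= cats0 | by rewrite /= cats0 |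
  by rewrite /= andbT |].
apply: teq_trans (teq_ten1r _).
exact: (den_tenE (den_self H') (@den_idE _) H).
Qed.

(** The hypothesis fixes where the middle word is cut: without it, the right side may be composable
    although neither pair of factors is. *)
Lemma ten_cmp g f g' f' : src g = tgt f ->
  Rten (Rcmp g f) (Rcmp g' f') ≈ Rcmp (Rten g g') (Rten f f').
Proof.
move=> e; split=> // [|H H'].
  rewrite /= e eqseq_cat // eqxx andbT /=.
  by case: (wf g); case: (wf g'); case: (wf f); case: (wf f').
have := H => /=.
case/andP=> /and3P[Hg Hf _] /and3P[Hg' Hf' /eqP e'].
have D := den_selfc.
apply: teq_trans (den_tenE (den_cmpE (D _ Hg _ _ e erefl) (den_self Hf))
  (den_cmpE (D _ Hg' _ _ (esym e') erefl) (den_self Hf')) _) _.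
apply: teq_trans (teq_ten_cmp _ _ _ _) (teq_sym _).
exact: (den_cmpE (den_tenE (D _ Hg _ _ e erefl)
  (D _ Hg' _ _ (esym e') erefl)) (den_tenE (den_self Hf) (den_self Hf')) H').
Qed.

Lemma br_nat f g :
  Rcmp (Rbr (tgt f) (tgt g)) (Rten f g) ≈ Rcmp (Rten g f) (Rbr (src f) (src g)).
Proof.
split=> // [|H H']; first by rewrite /= !eqxx !andbT andbC.
have := H => /=; case/andP=> /andP [Hf Hg] _.
apply: teq_trans (den_cmpE (@den_brE _ _)
  (den_tenE (den_self Hf) (den_self Hg)) _) _.
apply: teq_trans (teq_br_nat _ _) (teq_sym _).
exact: (den_cmpE (den_tenE (den_self Hg) (den_self Hf)) (@den_brE _ _) H').
Qed.

Lemma hexl a b c : Rbr (a ++ b) c ≈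
  Rcmp (Rten (Rbr a c) (Rid b)) (Rten (Rid a) (Rbr b c)).
Proof.
split=> [|||H H']; [by rewrite /= !catA | by rewrite /= !catA |
  by rewrite /= catA eqxx |].
apply: teq_trans (teq_hexl _ _ _) (teq_sym _).
apply: den_cmpE => [Hg|Hf]; first exact: teq_refl.
by apply: teq_castr; exact: teq_refl.
Qed.

Lemma hexr a b c : Rbr a (b ++ c) ≈
  Rcmp (Rten (Rid b) (Rbr a c)) (Rten (Rbr a b) (Rid c)).
Proof.
split=> [|||H H']; [by rewrite /= !catA | by rewrite /= !catA |
  by rewrite /= catA eqxx |].
apply: teq_trans (teq_hexr _ _ _) (teq_sym _).
apply: den_cmpE => [Hg|Hf]; first exact: teq_refl.
by apply: teq_castr; exact: teq_refl.
Qed.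

Ltac req_by l :=
  split=> [|||H H']; [by [] | by [] | by rewrite /= ?eqxx |
  apply: teq_trans l; apply: den_cmpE => ?; exact: teq_refl].

Lemma brVbr a b : Rcmp (RbrV a b) (Rbr a b) ≈ Rid (a ++ b).
Proof. by req_by (teq_brV a b). Qed.

Lemma brbrV a b : Rcmp (Rbr a b) (RbrV a b) ≈ Rid (b ++ a).
Proof. by req_by (teq_Vbr a b). Qed.

Lemma twVtw a : Rcmp (RtwV a) (Rtw a) ≈ Rid a.
Proof. by req_by (teq_twV a). Qed.

Lemma twtwV a : Rcmp (Rtw a) (RtwV a) ≈ Rid a.
Proof. by req_by (teq_Vtw a). Qed.

Lemma tw_nat f : Rcmp (Rtw (tgt f)) f ≈ Rcmp f (Rtw (src f)).
Proof.
split=> // [|H H']; first by rewrite /= !eqxx !andbT.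
have Hf : wf f by exact: wf_cmp2 H.
apply: teq_trans (den_cmpE (@den_twE _) (den_self Hf) _) _.
apply: teq_trans (teq_tw_nat _) (teq_sym _).
exact: (den_cmpE (den_self Hf) (@den_twE _) H').
Qed.

Lemma tw_ten a b : Rtw (a ++ b) ≈
  Rcmp (Rbr b a) (Rcmp (Rbr a b) (Rten (Rtw a) (Rtw b))).
Proof.
split=> // [|H H']; first by rewrite /= !eqxx.
apply: teq_trans (teq_tw_ten _ _) (teq_sym _).
apply: den_cmpE => [?|?]; first exact: teq_refl.
apply: den_cmpE => ?; exact: teq_refl.
Qed.

Lemma zz_pos :
  Rcmp (Rten (Rid [:: true]) Rev) (Rten Rcoev (Rid [:: true])) ≈ Rid [:: true].
Proof. by req_by (teq_zigzag_pos). Qed.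

Lemma zz_neg :
  Rcmp (Rten Rev (Rid [:: false])) (Rten (Rid [:: false]) Rcoev)
  ≈ Rid [:: false].
Proof. by req_by (teq_zigzag_neg). Qed.

Lemma tw_dual :
  Rcmp Rev (Rten (Rtw [:: false]) (Rid [:: true])) ≈
  Rcmp Rev (Rten (Rid [:: false]) (Rtw [:: true])).
Proof.
split=> // H H'.
apply: (@teq_trans _ _ _ _ _
  (Tcmp Tev (Tten (Ttw [:: false]) (Tid [:: true])))).
  by apply: den_cmpE => ?; exact: teq_refl.
apply: teq_trans teq_tw_dual (teq_sym _).
by apply: den_cmpE => ?; exact: teq_refl.
Qed.

#[local] Hint Resolve req_refl : core.

(** * Whiskering and diagram calculus in a strict ribbon category *)

Section GraphicalCalculus.

Local Infix "∘" := Rcmp (at level 50, left associativity).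
Local Notation pos := [:: true].
Local Notation neg := [:: false].
Local Notation posw a := (all id a).

(** A slice: one box between identity strands. The diagram computations below are carried out on
    composites of slices, associated to the right. *)
Definition wh x f y := Rten (Rid x) (Rten f (Rid y)).

#[local] Instance wh_proper : Proper (eq ==> req ==> eq ==> req) wh.
Proof. by move=> x _ <- f g E y _ <-; rewrite /wh E. Qed.

Lemma src_wh x f y : src (wh x f y) = x ++ src f ++ y. Proof. by []. Qed.
Lemma tgt_wh x f y : tgt (wh x f y) = x ++ tgt f ++ y. Proof. by []. Qed.

(** Applies an equation between two adjacent factors in the middle of a right-associated
    composite. *)
Lemma cmp_reassoc g f h t : g ∘ f ≈ h -> g ∘ (f ∘ t) ≈ h ∘ t.
Proof. by move=> <-; rewrite cmpA. Qed.

Lemma eqseq_catr (a b c : word) : (a ++ c == b ++ c) = (a == b).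
Proof.
rewrite -(inj_eq (can_inj revK)) !rev_cat eqseq_cat // eqxx /=.
by rewrite (inj_eq (can_inj revK)).
Qed.

(** Unlike in [ten_cmp], no composability is required: a common right factor cancels in words, so
    both sides are ill-formed together. *)
Lemma ten_cmpl g f c : Rten (g ∘ f) (Rid c) ≈ Rten g (Rid c) ∘ Rten f (Rid c).
Proof.
case: (eqVneq (src g) (tgt f)) => [e|ne].
  by rewrite -{1}(cmp1l (r := Rid c) erefl) ten_cmp.
have F : wf (Rten (g ∘ f) (Rid c)) = false.
  by rewrite /= [tgt f == _]eq_sym (negPf ne) !andbF.
have F' : wf (Rten g (Rid c) ∘ Rten f (Rid c)) = false.
  by rewrite /= eqseq_catr [tgt f == _]eq_sym (negPf ne) !andbF.
by split=> // [|H]; [rewrite F F' | exfalso; move: H; rewrite F].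
Qed.

Lemma ten_cmpr g f c : Rten (Rid c) (g ∘ f) ≈ Rten (Rid c) g ∘ Rten (Rid c) f.
Proof. by rewrite -{1}(cmp1l (r := Rid c) erefl) ten_cmp. Qed.

Lemma wh_cmp x y g f : wh x (g ∘ f) y ≈ wh x g y ∘ wh x f y.
Proof. by rewrite /wh ten_cmpl ten_cmpr. Qed.

Lemma wh_id x a y : wh x (Rid a) y ≈ Rid (x ++ a ++ y).
Proof. by rewrite /wh !ten_id. Qed.

Lemma wh_wh x x' f y' y : wh x (wh x' f y') y ≈ wh (x ++ x') f (y' ++ y).
Proof. by rewrite /wh !tenA ten_id -!tenA ten_id. Qed.

Lemma wh0 f : wh [::] f [::] ≈ f.
Proof. by rewrite /wh ten1r ten1l. Qed.

Lemma ten_whl f c : Rten f (Rid c) ≈ wh [::] f c.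
Proof. by rewrite /wh ten1l. Qed.

Lemma ten_whr f c : Rten (Rid c) f ≈ wh c f [::].
Proof. by rewrite /wh ten1r. Qed.

Lemma ten_split f g : Rten f g ≈ wh [::] f (tgt g) ∘ wh (src f) g [::].
Proof. by rewrite -ten_whl -ten_whr -ten_cmp // cmp1l // cmp1r. Qed.

Lemma ten_split2 f g : Rten f g ≈ wh (tgt f) g [::] ∘ wh [::] f (src g).
Proof. by rewrite -ten_whl -ten_whr -ten_cmp // cmp1l // cmp1r. Qed.

(** Interchange law for two boxes separated by the strands [y]. The outer words enter through
    equations, since at the place of use they are usually bracketed or split differently. *)
Lemma slide y x f y1 x1 g z x2 y2 :
  x1 = x ++ src f ++ y -> y1 = y ++ tgt g ++ z ->
  x2 = x ++ tgt f ++ y -> y2 = y ++ src g ++ z ->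
  wh x f y1 ∘ wh x1 g z ≈ wh x2 g z ∘ wh x f y2.
Proof.
(* Absorbing the strands between the boxes into the second box makes the two boxes adjacent. *)
move=> -> -> -> ->; pose h := Rten (Rid y) g.
have E t : wh (t ++ y) g [::] ≈ wh t h [::] by rewrite /h ten_whr wh_wh.
transitivity (wh x (wh [::] f (tgt h) ∘ wh (src f) h [::]) z).
  by rewrite wh_cmp -E !wh_wh cats0 /= -catA.
rewrite -ten_split ten_split2 wh_cmp -E !wh_wh cats0 /= -catA //.
Qed.

Ltac words := rewrite /= -?catA ?cats0 //=.

Lemma br_natl f c : Rbr (tgt f) c ∘ wh [::] f c ≈ wh c f [::] ∘ Rbr (src f) c.
Proof. by rewrite -ten_whl -ten_whr -(br_nat f (Rid c)). Qed.

Lemma br_natr f c : Rbr c (tgt f) ∘ wh c f [::] ≈ wh [::] f c ∘ Rbr c (src f).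
Proof. by rewrite -ten_whl -ten_whr -(br_nat (Rid c) f). Qed.

Lemma hexl_wh a b c :
  Rbr (a ++ b) c ≈ wh [::] (Rbr a c) b ∘ wh a (Rbr b c) [::].
Proof. by rewrite hexl ten_whl ten_whr. Qed.

Lemma hexr_wh a b c :
  Rbr a (b ++ c) ≈ wh b (Rbr a c) [::] ∘ wh [::] (Rbr a b) c.
Proof. by rewrite hexr ten_whl ten_whr. Qed.

(** A right inverse of an invertible arrow is its inverse; this transfers the hexagons and unit laws
    from the braiding to its inverse. *)
Lemma brV_uniq a b g : tgt g = a ++ b -> Rbr a b ∘ g ≈ Rid (b ++ a) ->
  g ≈ RbrV a b.
Proof.
move=> e E; rewrite -(@cmp1l g (a ++ b)) // -brVbr cmpA E.
by rewrite cmp1r.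
Qed.

Lemma hexlV a b c :
  RbrV (a ++ b) c ≈ wh a (RbrV b c) [::] ∘ wh [::] (RbrV a c) b.
Proof.
symmetry; apply: brV_uniq; first by words.
have I : wh a (Rbr b c) [::] ∘ wh a (RbrV b c) [::] ≈ Rid (a ++ c ++ b).
  by rewrite -wh_cmp brbrV wh_id cats0.
rewrite hexl_wh !cmpA (cmp_reassoc _ I) cmp1l; last by words.
by rewrite -wh_cmp brbrV wh_id /= -catA.
Qed.

Lemma hexrV a b c :
  RbrV a (b ++ c) ≈ wh [::] (RbrV a b) c ∘ wh b (RbrV a c) [::].
Proof.
symmetry; apply: brV_uniq; first by words.
have I : wh [::] (Rbr a b) c ∘ wh [::] (RbrV a b) c ≈ Rid ((b ++ a) ++ c).
  by rewrite -wh_cmp brbrV wh_id.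
rewrite hexr_wh !cmpA (cmp_reassoc _ I) cmp1l; last by words.
by rewrite -wh_cmp brbrV wh_id cats0 /= -catA.
Qed.

(** The hexagon with two empty words makes this braiding idempotent, and an invertible idempotent is
    the identity. *)
Lemma br0l c : Rbr [::] c ≈ Rid c.
Proof.
have := hexl_wh [::] [::] c; rewrite wh0 /= => E.
rewrite -(@cmp1l (Rbr [::] c) c); last by rewrite /= cats0.
have I : RbrV [::] c ∘ Rbr [::] c ≈ Rid c := brVbr [::] c.
by rewrite -I cmpA -E.
Qed.

Lemma br0r c : Rbr c [::] ≈ Rid c.
Proof.
have := hexr_wh c [::] [::]; rewrite wh0 /= => E.
rewrite -(@cmp1l (Rbr c [::]) c); last by words.
have := brVbr c [::]; rewrite cats0 => I.
by rewrite -I cmpA -E.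
Qed.

Lemma brV0l c : RbrV [::] c ≈ Rid c.
Proof.
symmetry; apply: brV_uniq; first by words.
by rewrite br0l cmp1l; words.
Qed.

Lemma brV0r c : RbrV c [::] ≈ Rid c.
Proof.
symmetry; apply: brV_uniq; first by words.
by rewrite br0r cmp1l.
Qed.

(** As for the braiding: [tw_ten] on empty words makes the twist idempotent, and it is
    invertible. *)
Lemma tw0 : Rtw [::] ≈ Rid [::].
Proof.
have := tw_ten [::] [::]; rewrite !br0l ten_split /= wh0.
move/req_sym; rewrite !cmp1l // => E.
by rewrite -{1}(@cmp1l (Rtw [::]) [::]) // -twVtw cmpA E.
Qed.

(** Naturality of the braiding for a box with empty target, so that strands can be pulled across a
    cap. The lemmas that follow are its variants for the other side, for cups and for the inverse
    braiding. *)
Lemma capl f c : tgt f = [::] -> wh [::] f c ≈ wh c f [::] ∘ Rbr (src f) c.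
Proof. by move=> e; rewrite -br_natl e br0l cmp1l; words; rewrite ?e. Qed.

Lemma capr f c : tgt f = [::] -> wh c f [::] ≈ wh [::] f c ∘ Rbr c (src f).
Proof. by move=> e; rewrite -br_natr e br0r cmp1l; words;
  rewrite ?e ?cats0. Qed.

Lemma cupl f c : src f = [::] -> wh c f [::] ≈ Rbr (tgt f) c ∘ wh [::] f c.
Proof. by move=> e; rewrite br_natl e br0l cmp1r; words; rewrite ?e ?cats0. Qed.

Lemma cupr f c : src f = [::] -> wh [::] f c ≈ Rbr c (tgt f) ∘ wh c f [::].
Proof. by move=> e; rewrite br_natr e br0r cmp1r; words; rewrite ?e. Qed.

Lemma caprV f c : tgt f = [::] -> wh c f [::] ∘ RbrV c (src f) ≈ wh [::] f c.
Proof. by move=> e; rewrite capr // cmpA brbrV cmp1r; words. Qed.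

Lemma cuplV f c : src f = [::] -> RbrV (tgt f) c ∘ wh c f [::] ≈ wh [::] f c.
Proof. by move=> e; rewrite cupl // -cmpA brVbr cmp1l; words. Qed.

Lemma cuprV f c : src f = [::] -> RbrV c (tgt f) ∘ wh [::] f c ≈ wh c f [::].
Proof. by move=> e; rewrite cupr // -cmpA brVbr cmp1l; words. Qed.

Local Notation "1" := ([::] : word).

(** * Zigzags, the right evaluation and rotated crossings *)

Lemma zz_pos_wh : wh pos Rev 1 ∘ wh 1 Rcoev pos ≈ Rid pos.
Proof. by rewrite -ten_whl -ten_whr zz_pos. Qed.

Lemma zz_neg_wh : wh 1 Rev neg ∘ wh neg Rcoev 1 ≈ Rid neg.
Proof. by rewrite -ten_whl -ten_whr zz_neg. Qed.

Lemma tw_dual_wh : Rev ∘ wh 1 (Rtw neg) pos ≈ Rev ∘ wh neg (Rtw pos) 1.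
Proof. by rewrite -ten_whl -ten_whr tw_dual. Qed.

(* Locked because rewriting with [wh_cmp] would unfold these terms. *)
Definition Revr := locked (Rev ∘ Rbr pos neg ∘ wh 1 (Rtw pos) neg).
Definition RevV := locked (Rev ∘ RbrV neg pos).

Lemma RevrE : Revr = Rev ∘ Rbr pos neg ∘ wh 1 (Rtw pos) neg.
Proof. by rewrite /Revr -lock. Qed.
Lemma RevVE : RevV = Rev ∘ RbrV neg pos.
Proof. by rewrite /RevV -lock. Qed.

Lemma src_Revr : src Revr = [:: true; false]. Proof. by rewrite RevrE. Qed.
Lemma tgt_Revr : tgt Revr = [::]. Proof. by rewrite RevrE. Qed.
Lemma src_RevV : src RevV = [:: true; false]. Proof. by rewrite RevVE. Qed.
Lemma tgt_RevV : tgt RevV = [::]. Proof. by rewrite RevVE. Qed.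

Ltac words ::= rewrite /= ?src_Revr ?tgt_Revr ?src_RevV ?tgt_RevV -?catA
  ?cats0 //=.

(** By the hexagon the two crossings form one passage of the strand across both legs of the cup;
    naturality removes it and a zigzag remains. *)
Lemma trace_br_cap :
  wh pos (Rev ∘ Rbr pos neg) 1 ∘ wh 1 (Rbr pos pos) neg ∘ wh pos Rcoev 1
    ≈ Rid pos.
Proof.
have H : wh pos (Rbr pos neg) 1 ∘ wh 1 (Rbr pos pos) neg ≈ Rbr pos (pos ++ neg).
  by rewrite hexr_wh.
have C : Rbr pos (pos ++ neg) ∘ wh pos Rcoev 1 ≈ wh 1 Rcoev pos.
  by symmetry; exact: (cupr (f := Rcoev)).
by rewrite wh_cmp !cmpA (cmp_reassoc _ H) C zz_pos_wh.
Qed.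

Lemma trace_brV_cap :
  wh pos RevV 1 ∘ wh 1 (RbrV pos pos) neg ∘ wh pos Rcoev 1 ≈ Rid pos.
Proof.
rewrite RevVE.
have H : wh pos (RbrV neg pos) 1 ∘ wh 1 (RbrV pos pos) neg
  ≈ RbrV (pos ++ neg) pos.
  by rewrite hexlV.
have C : RbrV (pos ++ neg) pos ∘ wh pos Rcoev 1 ≈ wh 1 Rcoev pos.
  exact: (cuplV (f := Rcoev)).
by rewrite wh_cmp !cmpA (cmp_reassoc _ H) C zz_pos_wh.
Qed.

(** The twist in the right evaluation may sit on either leg: it moves through the braiding and
    changes legs by [tw_dual_wh]. *)
Lemma ev_br_tw : Rev ∘ Rbr pos neg ∘ wh pos (Rtw neg) 1 ≈ Revr.
Proof.
have E1 : Rbr pos neg ∘ wh pos (Rtw neg) 1 ≈ wh 1 (Rtw neg) pos ∘ Rbr pos neg.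
  exact: (br_natr (Rtw neg) pos).
have E2 : Rbr pos neg ∘ wh 1 (Rtw pos) neg ≈ wh neg (Rtw pos) 1 ∘ Rbr pos neg.
  exact: (br_natl (Rtw pos) neg).
by rewrite RevrE !cmpA E1 E2 -!cmpA tw_dual_wh.
Qed.

Lemma ev_tw : Rev ∘ Rtw (neg ++ pos) ≈ Rev.
Proof. by rewrite -(tw_nat Rev) tw0 cmp1l. Qed.

(** The evaluation absorbs the twist of [- +], which by [tw_ten] is a double braiding with a twist
    on each strand. Cancelling one braiding leaves two twists, of which [Revr] contains one. *)
Lemma RevV_tw : RevV ≈ Revr ∘ wh 1 (Rtw pos) neg.
Proof.
have E1 : Rbr neg pos ∘ Rten (Rtw neg) (Rtw pos)
  ≈ Rten (Rtw pos) (Rtw neg) ∘ Rbr neg pos.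
  exact: (br_nat (Rtw neg) (Rtw pos)).
have E : Rev ≈ Revr ∘ wh 1 (Rtw pos) neg ∘ Rbr neg pos.
  by rewrite -{1}ev_tw tw_ten E1 ten_split2 -!cmpA -ev_br_tw.
by rewrite RevVE {1}E !cmpA brbrV cmp1r.
Qed.

(** The zigzag for the opposite duality, with a cap on [+ -] and a cup on [- +]. Pulling the strand
    through both, by [capl] and [cuprV], reduces it to the original zigzag. *)
Lemma zz_Vr : wh neg RevV 1 ∘ wh 1 (Rbr pos neg ∘ Rcoev) neg ≈ Rid neg.
Proof.
have E1 : wh 1 (Rbr pos neg) neg ∘ wh pos (Rbr neg neg) 1
  ≈ Rbr (pos ++ neg) neg.
  by rewrite hexl_wh.
have E2 : wh neg RevV 1 ∘ Rbr (pos ++ neg) neg ≈ wh 1 RevV neg.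
  by rewrite (capl _ tgt_RevV) src_RevV.
have E3 : wh neg RevV 1 ∘ wh 1 (Rbr pos neg) neg
  ≈ wh 1 RevV neg ∘ wh pos (RbrV neg neg) 1.
  by rewrite -E2 -E1 !cmpA -wh_cmp brbrV wh_id cmp1r.
have E4 : wh 1 (RbrV neg pos) neg ∘ wh pos (RbrV neg neg) 1
  ≈ RbrV neg (pos ++ neg).
  by rewrite hexrV.
have E5 : RbrV neg (pos ++ neg) ∘ wh 1 Rcoev neg ≈ wh neg Rcoev 1.
  exact: (cuprV (f := Rcoev)).
by rewrite wh_cmp -cmpA E3 RevVE wh_cmp !cmpA (cmp_reassoc _ E4) E5 zz_neg_wh.
Qed.

(* The mate of [ev] under the braiding, used to rotate a crossing. *)
Lemma br_ev X : wh X Rev 1 ∘ wh 1 (Rbr neg X) pos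
  ≈ wh 1 Rev X ∘ wh neg (RbrV pos X) 1.
Proof.
have E : wh 1 (Rbr neg X) pos ∘ wh neg (Rbr pos X) 1
  ≈ Rbr (neg ++ pos) X by rewrite hexl_wh.
have E2 : wh X Rev 1 ∘ Rbr (neg ++ pos) X ≈ wh 1 Rev X.
  by symmetry; exact: (capl (f := Rev)).
by rewrite -E2 -E !cmpA -wh_cmp brbrV wh_id cmp1r; words.
Qed.

(** Rotating by a quarter turn replaces the crossing of [-] by the inverse crossing of [+]: [br_ev]
    moves the crossing across the cap, and a zigzag straightens what remains. *)
Lemma br_neg X : Rbr neg X ≈
  wh 1 Rev (X ++ neg) ∘ wh neg (RbrV pos X) neg ∘ wh (neg ++ X) Rcoev 1.
Proof.
have E : wh 1 Rev (X ++ neg) ∘ wh neg (RbrV pos X) neg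
    ≈ wh X Rev neg ∘ wh 1 (Rbr neg X) (pos ++ neg).
  have := @wh_proper 1 _ erefl _ _ (br_ev X) neg _ erefl.
  by rewrite !wh_cmp !wh_wh cats0 => ->.
have S : wh 1 (Rbr neg X) (pos ++ neg) ∘ wh (neg ++ X) Rcoev 1
    ≈ wh (X ++ neg) Rcoev 1 ∘ wh 1 (Rbr neg X) 1.
  by apply: (slide (y := 1)); words.
have Z : wh X Rev neg ∘ wh (X ++ neg) Rcoev 1 ≈ Rid (X ++ neg).
  have := @wh_proper X _ erefl _ _ zz_neg_wh 1 _ erefl.
  by rewrite !wh_cmp !wh_wh wh_id !cats0.
by rewrite E cmpA S -cmpA Z wh0 cmp1l.
Qed.

(** Here the strand [-] enters on the right and leaves on the left, so the rotation needs a cap on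
    [+ -] and a cup on [- +]; these are the pair of [zz_Vr]. *)
Lemma brV_neg X : RbrV neg X ≈
  wh (neg ++ X) RevV 1 ∘ wh neg (Rbr pos X) neg ∘ wh 1 (Rbr pos neg
    ∘ Rcoev) (X ++ neg).
Proof.
set C := Rbr pos neg ∘ Rcoev.
have E1 : wh neg (Rbr pos X) 1 ∘ wh 1 C X ≈ wh 1 (RbrV neg X) pos ∘ wh X C 1.
  have I : wh 1 (RbrV neg X) pos ∘ wh 1 (Rbr neg X) pos ≈ Rid (neg ++ X ++ pos).
    by rewrite -wh_cmp brVbr wh_id; words.
  have H : wh 1 (Rbr neg X) pos ∘ wh neg (Rbr pos X) 1
    ≈ Rbr (neg ++ pos) X by rewrite hexl_wh.
  have H2 : Rbr (neg ++ pos) X ∘ wh 1 C X ≈ wh X C 1.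
    by symmetry; exact: (cupl (f := C)).
  rewrite -H2 -H !cmpA (cmp_reassoc _ I) cmp1l //; words.
have E : wh neg (Rbr pos X) neg ∘ wh 1 C (X ++ neg)
  ≈ wh 1 (RbrV neg X) (pos ++ neg) ∘ wh X C neg.
  have := @wh_proper 1 _ erefl _ _ E1 neg _ erefl.
  by rewrite !wh_cmp !wh_wh cats0 => ->.
have S : wh (neg ++ X) RevV 1 ∘ wh 1 (RbrV neg X) (pos ++ neg)
    ≈ wh 1 (RbrV neg X) 1 ∘ wh (X ++ neg) RevV 1.
  by symmetry; apply: (slide (y := 1)); words.
have Z : wh (X ++ neg) RevV 1 ∘ wh X C neg ≈ Rid (X ++ neg).
  have := @wh_proper X _ erefl _ _ zz_Vr 1 _ erefl.
  by rewrite !wh_cmp !wh_wh wh_id !cats0.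
by rewrite cmpA E -cmpA S cmpA Z wh0 cmp1r.
Qed.

Ltac ww := rewrite ?wh_cmp ?wh_wh ?cat0s ?cats0 -?catA ?cmpA.

Lemma wh_congr x y f g : f ≈ g -> wh x f y ≈ wh x g y.
Proof. by move->. Qed.

Lemma cmp_reassoc3 g f e h t : g ∘ (f ∘ e) ≈ h -> g ∘ (f ∘ (e ∘ t)) ≈ h ∘ t.
Proof. by move=> <-; rewrite !cmpA. Qed.

Lemma brV_natr f c : RbrV c (tgt f) ∘ wh 1 f c ≈ wh c f 1 ∘ RbrV c (src f).
Proof.
rewrite -(@cmp1r (RbrV c (tgt f) ∘ wh 1 f c) (src f ++ c)); last by words.
rewrite -(brbrV c (src f)) !cmpA (cmp_reassoc _ (req_sym (br_natr f c))) cmpA.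
rewrite -cmpA brVbr cmp1l //; words.
Qed.

(** * Closing the last strand *)

Definition Rtr a c k := wh c Revr 1 ∘ wh 1 k neg ∘ wh a Rcoev 1.

#[local] Instance Rtr_proper : Proper (eq ==> eq ==> req ==> req) Rtr.
Proof. by move=> a _ <- c _ <- f g E; rewrite /Rtr E. Qed.

Lemma Rtr_natl a k f : tgt k = src f ++ pos ->
  Rtr a (tgt f) (wh 1 f pos ∘ k) ≈ f ∘ Rtr a (src f) k.
Proof.
move=> e; rewrite /Rtr; ww.
have S : wh (tgt f) Revr 1 ∘ wh 1 f (pos ++ neg) ≈ wh 1 f 1 ∘ wh (src f) Revr 1.
  by symmetry; apply: (slide (y := 1)); words.
by rewrite (cmp_reassoc _ S) wh0 cmpA.
Qed.

Lemma Rtr_natr c k g : Rtr (src g) c (k ∘ wh 1 g pos) ≈ Rtr (tgt g) c k ∘ g.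
Proof.
rewrite /Rtr; ww.
have S : wh 1 g (pos ++ neg) ∘ wh (src g) Rcoev 1
  ≈ wh (tgt g) Rcoev 1 ∘ wh 1 g 1.
  by apply: (slide (y := 1)); words.
by rewrite S wh0.
Qed.

(** The twist inside [Revr] moves back through the crossing and past the cup to the open input; the
    remaining loop is removed by [trace_br_cap]. *)
Lemma tr_br : Rtr pos pos (Rbr pos pos) ≈ Rtw pos.
Proof.
have E2 : Rtr pos pos (Rbr pos pos) ≈
    wh pos (Rev ∘ Rbr pos neg) 1 ∘ wh 1 (wh pos (Rtw pos) 1 ∘ Rbr pos pos) neg
      ∘ wh pos Rcoev 1.
  by rewrite /Rtr RevrE; ww.
have B : wh pos (Rtw pos) 1 ∘ Rbr pos pos ≈ Rbr pos pos ∘ wh 1 (Rtw pos) pos.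
  by symmetry; exact: (br_natl (Rtw pos) pos).
have S : wh 1 (Rtw pos) (pos ++ neg) ∘ wh pos Rcoev 1
  ≈ wh pos Rcoev 1 ∘ wh 1 (Rtw pos) 1.
  by apply: (slide (y := 1)); words.
rewrite E2 B (wh_cmp 1 neg) wh_wh !cmpA S -!cmpA trace_br_cap wh0 cmp1l //.
Qed.

(** A twist put on the open input moves through the inverse crossing to the cap, where it turns
    [Revr] into [RevV]; then [trace_brV_cap] applies. Hence the trace is inverse to the twist. *)
Lemma tr_brV : Rtr pos pos (RbrV pos pos) ≈ RtwV pos.
Proof.
have B : RbrV pos pos ∘ wh 1 (Rtw pos) pos ≈ wh pos (Rtw pos) 1 ∘ RbrV pos pos.
  exact: (brV_natr (Rtw pos) pos).
have E : Rtr pos pos (RbrV pos pos) ∘ Rtw pos ≈ Rid pos.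
  by rewrite -(Rtr_natr pos _ (Rtw pos)) B -trace_brV_cap RevV_tw /Rtr; ww.
rewrite -(@cmp1r (Rtr pos pos (RbrV pos pos)) pos) // -(twtwV pos) -cmpA E
  cmp1l //.
Qed.

Lemma cap_swap : wh pos Revr 1 ∘ wh 1 (Rbr pos pos) neg
  ≈ wh 1 Revr pos ∘ wh pos (RbrV neg pos) 1.
Proof.
have E : wh 1 (Rbr pos pos) neg ∘ wh pos (Rbr neg pos) 1
  ≈ Rbr (pos ++ neg) pos by rewrite hexl_wh.
have E2 : wh pos Revr 1 ∘ Rbr (pos ++ neg) pos ≈ wh 1 Revr pos.
  by rewrite (capl _ tgt_Revr) src_Revr.
by rewrite -E2 -E !cmpA -wh_cmp brbrV wh_id cmp1r.
Qed.

Lemma cup_swap : wh 1 (RbrV pos pos) neg ∘ wh pos Rcoev 1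
  ≈ wh pos (Rbr neg pos) 1 ∘ wh 1 Rcoev pos.
Proof.
have E : wh 1 (Rbr pos pos) neg ∘ wh pos (Rbr neg pos) 1
  ≈ Rbr (pos ++ neg) pos by rewrite hexl_wh.
have E2 : Rbr (pos ++ neg) pos ∘ wh 1 Rcoev pos ≈ wh pos Rcoev 1.
  by symmetry; exact: (cupl (f := Rcoev)).
by rewrite -E2 -E -!cmpA -wh_cmp brVbr wh_id cmp1l.
Qed.

(** The added strand is pulled through both arcs into the loop. Its two crossings with the returning
    [-] cancel once [k] is slid away, and those with the closed [+] remain below and above [k]. *)
Lemma Rtr_superpose a c k : src k = a ++ pos -> tgt k = c ++ pos ->
  wh 1 (Rtr a c k) pos ≈
  Rtr (a ++ pos) (c ++ pos) (wh c (Rbr pos pos) 1 ∘ wh 1 k pos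
    ∘ wh a (RbrV pos pos) 1).
Proof.
move=> sk tk; rewrite /Rtr !wh_cmp !wh_wh !cats0 !cmpA.
have C := wh_congr c 1 cap_swap; rewrite !wh_cmp !wh_wh !cats0 in C.
have D := wh_congr a 1 cup_swap; rewrite !wh_cmp !wh_wh !cats0 in D.
rewrite /= in C D *; rewrite (cmp_reassoc _ C) D !cmpA.
have S : wh 1 k [:: true; false] ∘ wh (a ++ pos) (Rbr neg pos) 1
    ≈ wh (c ++ pos) (Rbr neg pos) 1 ∘ wh 1 k [:: false; true].
  by apply: (slide (y := 1)); rewrite ?sk ?tk; words.
rewrite (cmp_reassoc _ S) cmpA.
have I : wh (c ++ pos) (RbrV neg pos) 1 ∘ wh (c ++ pos) (Rbr neg pos) 1
    ≈ Rid (c ++ [:: true; false; true]).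
  by rewrite -wh_cmp brVbr wh_id; words.
rewrite (cmp_reassoc _ I) cmp1l //; words; by rewrite tk -catA.
Qed.

(* For [h] with target [x - b]: the strand ending at this [-] is turned down
  into
   a new rightmost input, passing across [b]. *)
Definition bend x b h := wh x Rev b ∘ wh (x ++ neg) (Rbr b pos) 1 ∘ wh 1 h pos.

#[local] Instance bend_proper : Proper (eq ==> eq ==> req ==> req) bend.
Proof. by move=> a _ <- c _ <- f g E; rewrite /bend E. Qed.

(** * Bending and elementary slices *)

Lemma bend_cmp x b h g : bend x b (h ∘ g) ≈ bend x b h ∘ wh 1 g pos.
Proof. by rewrite /bend wh_cmp !cmpA. Qed.

(** After [Rtr_superpose] the crossing above [k] merges, by the hexagon, into the passage of the
    bent strand across [b ++ pos]; only the crossing below [k] stays visible. *)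
Lemma bend_tr a x b k : src k = a ++ pos -> tgt k = x ++ neg ++ b ++ pos ->
  bend x b (Rtr a (x ++ neg ++ b) k) ≈
  Rtr (a ++ pos) (x ++ b) (bend x (b ++ pos) k ∘ wh a (RbrV pos pos) 1).
Proof.
move=> sk tk; rewrite /bend Rtr_superpose //; last by rewrite tk -!catA.
set f := wh x Rev b ∘ wh (x ++ neg) (Rbr b pos) 1.
have sf : src f = (x ++ neg ++ b) ++ pos by rewrite /f; words.
have tf : tgt f = x ++ b by words.
rewrite -tf -sf -Rtr_natl; last by rewrite sf; words.
apply: Rtr_proper => //; rewrite /f.
have := wh_congr (x ++ neg) 1 (hexl_wh b pos pos); ww => H.
by rewrite H; ww.
Qed.

Lemma bend_ten_p x b h : tgt h = x ++ neg ++ b ->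
  bend x (b ++ pos) (wh 1 h pos) ≈ wh 1 (bend x b h) pos
    ∘ wh (src h) (Rbr pos pos) 1.
Proof.
move=> th; rewrite /bend.
have := wh_congr (x ++ neg) 1 (hexl_wh b pos pos); ww => H.
rewrite H; ww.
have S : wh (x ++ neg ++ b) (Rbr pos pos) 1 ∘ wh 1 h (pos ++ pos)
    ≈ wh 1 h (pos ++ pos) ∘ wh (src h) (Rbr pos pos) 1.
  by symmetry; apply: (slide (y := 1)); rewrite ?th; words.
by rewrite S.
Qed.

Lemma bend_slice u f v b h :
  bend (u ++ tgt f ++ v) b (wh u f (v ++ neg ++ b) ∘ h) ≈
  wh u f (v ++ b) ∘ bend (u ++ src f ++ v) b h.
Proof.
rewrite /bend; ww.
have S1 : wh (u ++ tgt f ++ v ++ neg) (Rbr b pos) 1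
  ∘ wh u f (v ++ neg ++ b ++ pos)
    ≈ wh u f (v ++ neg ++ pos ++ b) ∘ wh (u ++ src f ++ v ++ neg) (Rbr b pos) 1.
  by symmetry; apply: (slide (y := v ++ neg)); words.
have S2 : wh (u ++ tgt f ++ v) Rev b ∘ wh u f (v ++ neg ++ pos ++ b)
    ≈ wh u f (v ++ b) ∘ wh (u ++ src f ++ v) Rev b.
  by symmetry; apply: (slide (y := v)); words.
by rewrite (cmp_reassoc _ S1) cmpA (cmp_reassoc _ S2) cmpA.
Qed.

(** The new [-] is the other end of the new [+], so bending it completes a zigzag: the result is a
    straight strand led past [b]. *)
Lemma bend_coev u b h :
  bend (u ++ pos) b (wh u Rcoev b ∘ h) ≈ wh u (Rbr b pos) 1 ∘ wh 1 h pos.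
Proof.
rewrite /bend; ww.
have S1 : wh (u ++ pos ++ neg) (Rbr b pos) 1 ∘ wh u Rcoev (b ++ pos)
    ≈ wh u Rcoev (pos ++ b) ∘ wh u (Rbr b pos) 1.
  by symmetry; apply: (slide (y := 1)); words.
have := wh_congr u b zz_pos_wh; ww => Z.
rewrite (cmp_reassoc _ S1) cmpA (cmp_reassoc _ Z) wh_id -cmpA cmp1l //; words.
Qed.

(** The bent strand crosses the [+] once as [-] and once on its way down; together these pull the
    cap across the [+], so both crossings disappear. *)
Lemma bend_pn x b h :
  bend x (pos ++ b) (wh x (Rbr pos neg) b ∘ h) ≈ bend (x ++ pos) b h.
Proof.
rewrite /bend; ww.
have := wh_congr (x ++ neg) 1 (hexl_wh pos b pos); ww => ->; ww.
have S1 : wh (x ++ neg ++ pos) (Rbr b pos) 1 ∘ wh x (Rbr pos neg) (b ++ pos)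
    ≈ wh x (Rbr pos neg) (pos ++ b) ∘ wh (x ++ pos ++ neg) (Rbr b pos) 1.
  by symmetry; apply: (slide (y := 1)); words.
have E : wh 1 Rev pos ∘ wh neg (Rbr pos pos) 1 ∘ wh 1 (Rbr pos neg) pos
  ≈ wh pos Rev 1.
  by rewrite cmpA (capr _ (f := Rev)) // (hexr_wh pos neg pos).
have := wh_congr x b E; ww => E'.
rewrite (cmp_reassoc _ S1) -E'; ww; by [].
Qed.

Lemma bend_twn x b h : tgt h = x ++ neg ++ b ->
  bend x b (wh x (Rtw neg) b ∘ h) ≈ bend x b h ∘ wh (src h) (Rtw pos) 1.
Proof.
move=> th; rewrite /bend; ww.
have S1 : wh (x ++ neg) (Rbr b pos) 1 ∘ wh x (Rtw neg) (b ++ pos)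
    ≈ wh x (Rtw neg) (pos ++ b) ∘ wh (x ++ neg) (Rbr b pos) 1.
  by symmetry; apply: (slide (y := 1)); words.
have := wh_congr x b tw_dual_wh; ww => D.
have := wh_congr (x ++ neg) 1 (br_natr (Rtw pos) b); ww => /req_sym B.
have S2 : wh (x ++ neg ++ b) (Rtw pos) 1 ∘ wh 1 h pos
    ≈ wh 1 h pos ∘ wh (src h) (Rtw pos) 1.
  by symmetry; apply: (slide (y := 1)); rewrite ?th; words.
by rewrite (cmp_reassoc _ S1) cmpA (cmp_reassoc _ D) cmpA (cmp_reassoc _ B)
  cmpA S2.
Qed.

(** Bend the [-] down, lead the adjacent [+] to the far right and close: the closing arc joins the
    two strands again. The [RtwV] cancels the twist contained in [Revr], and [RbrV b pos] is
    cancelled when the cap is pulled across [b]. *)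
Lemma ev_trace x b h : tgt h = x ++ neg ++ pos ++ b ->
  wh x Rev b ∘ h ≈
  Rtr (src h) (x ++ b)
    (wh x (RbrV b pos) 1 ∘ bend x (pos ++ b) (wh (x ++ neg) (RtwV pos) b ∘ h)).
Proof.
move=> th; set h1 := wh (x ++ neg) (RtwV pos) b ∘ h.
have th1 : tgt h1 = x ++ neg ++ pos ++ b by rewrite /h1; words.
have -> : src h = src h1 by [].
have -> : wh x Rev b ∘ h ≈ wh x (Rev ∘ wh neg (Rtw pos) 1) b ∘ h1.
  rewrite /h1; ww.
  have I : wh (x ++ neg) (Rtw pos) b ∘ wh (x ++ neg) (RtwV pos) b
    ≈ Rid (x ++ neg ++ pos ++ b).
    by rewrite -wh_cmp twtwV wh_id -catA.
  by rewrite (cmp_reassoc _ I) cmp1l.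
move: h1 th1 => {th}{}h th; set A := pos ++ b.
rewrite /Rtr /bend; ww.
have S1 : wh 1 h (pos ++ neg) ∘ wh (src h) Rcoev 1
  ≈ wh (x ++ neg ++ A) Rcoev 1 ∘ h.
  transitivity (wh (x ++ neg ++ A) Rcoev 1 ∘ wh 1 h 1); last by rewrite wh0.
  by apply: (slide (y := 1)); rewrite ?th; words.
have C : wh 1 (Rbr A pos) neg ∘ wh A Rcoev 1 ≈ wh pos (RbrV A neg) 1
  ∘ wh 1 Rcoev A.
  have H : wh pos (Rbr A neg) 1 ∘ wh 1 (Rbr A pos) neg
    ≈ Rbr A (pos ++ neg) by rewrite hexr_wh.
  have H2 : Rbr A (pos ++ neg) ∘ wh A Rcoev 1 ≈ wh 1 Rcoev A.
    by symmetry; exact: (cupr (f := Rcoev)).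
  by rewrite -H2 -H -!cmpA -wh_cmp brVbr wh_id cmp1l //; words.
have := wh_congr (x ++ neg) 1 C; ww => C'.
rewrite S1 (cmp_reassoc _ C') cmpA.
have S2 : wh x Rev (A ++ neg) ∘ wh (x ++ neg ++ pos) (RbrV A neg) 1
    ≈ wh x (RbrV A neg) 1 ∘ wh x Rev (neg ++ A).
  by apply: (slide (y := 1)); words.
have := wh_congr x A zz_neg_wh; ww => Z.
rewrite (cmp_reassoc _ S2) cmpA (cmp_reassoc _ Z) wh_id cmp1l ?th;
  last by words.
have := wh_congr x 1 (hexlV pos b neg); ww => ->; ww.
have K : wh b Revr 1 ∘ (wh 1 (RbrV b pos) neg ∘ wh pos (RbrV b neg) 1)
  ≈ wh 1 Revr b.
  by rewrite -hexrV -(caprV b tgt_Revr) src_Revr.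
have := wh_congr x 1 K; ww => K'.
rewrite (cmp_reassoc3 _ K').
have R : Revr ∘ RbrV pos neg ≈ Rev ∘ wh neg (Rtw pos) 1.
  have B : Rbr pos neg ∘ wh 1 (Rtw pos) neg ≈ wh neg (Rtw pos) 1 ∘ Rbr pos neg.
    exact: (br_natl (Rtw pos) neg).
  by rewrite RevrE !cmpA (cmp_reassoc _ B) cmpA brbrV cmp1r.
have := wh_congr x b R; ww => R'.
by rewrite (cmp_reassoc _ R') cmpA.
Qed.

(** A box to the right of the [-] lies under way of the bent strand, and naturality of the braiding
    lets it pass; in [bend_slice] the two are disjoint. *)
Lemma bend_sliceR x b1 f v h :
  bend x (b1 ++ tgt f ++ v) (wh (x ++ neg ++ b1) f v ∘ h) ≈
  wh (x ++ b1) f v ∘ bend x (b1 ++ src f ++ v) h.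
Proof.
rewrite /bend; ww.
have := wh_congr (x ++ neg) 1 (br_natl (wh b1 f v) pos).
rewrite src_wh tgt_wh; ww => S1.
have S2 : wh x Rev (b1 ++ tgt f ++ v) ∘ wh (x ++ neg ++ pos ++ b1) f v
    ≈ wh (x ++ b1) f v ∘ wh x Rev (b1 ++ src f ++ v).
  by apply: (slide (y := b1)); words.
by rewrite (cmp_reassoc _ S1) cmpA (cmp_reassoc _ S2) cmpA.
Qed.

Lemma twV_ten a b : RtwV (a ++ b) ≈
  Rten (RtwV a) (RtwV b) ∘ (RbrV a b ∘ RbrV b a).
Proof.
set g := _ ∘ _; have E : g ∘ Rtw (a ++ b) ≈ Rid (a ++ b).
  rewrite /g tw_ten -!cmpA !(cmpA _ (RbrV _ _) (Rbr _ _)) brVbr.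
  rewrite (cmpA _ (RbrV a b)) cmp1r // (cmpA _ (RbrV a b)) brVbr cmp1r //.
  by rewrite -ten_cmp // !twVtw ten_id.
by rewrite -(@cmp1r g (a ++ b)) // -(twtwV (a ++ b)) -cmpA E cmp1l.
Qed.

(** * Generation of the positive tangles by crossings and traces *)

(** Abstract in [G], so that the generation theorem becomes an induction principle once [G]
    expresses the property to be proved. *)
Record traced_class (G : raw -> Prop) : Prop := TracedClass {
  g_req : forall f g, f ≈ g -> G f -> G g;
  g_wf : forall f, G f -> wf f;
  g_src : forall f, G f -> posw (src f);
  g_tgt : forall f, G f -> posw (tgt f);
  g_id : forall a, posw a -> G (Rid a);
  g_cmp : forall g f, G g -> G f -> src g = tgt f -> G (g ∘ f);
  g_ten : forall f g, G f -> G g -> G (Rten f g);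
  g_br : G (Rbr pos pos);
  g_brV : G (RbrV pos pos);
  g_tr : forall a c k, G k -> src k = a ++ pos -> tgt k = c ++ pos ->
    G (Rtr a c k)
}.

Lemma last_minus w : posw w \/ exists x b, w = x ++ neg ++ b /\ posw b.
Proof.
elim: w => [|e w [IH|[x [b [-> Hb]]]]]; first by left.
  by case: e; [left | right; exists [::], w].
by right; exists (e :: x), b.
Qed.

(** Makes the cut at the last [-] a function of the word, so that [bent] can be inverted along any
    given decomposition of the target. The size of [b] is read off by searching the reversed
    word. *)
Lemma minus_uniq x b x' b' : posw b -> posw b' ->
  x ++ neg ++ b = x' ++ neg ++ b' -> x = x' /\ b = b'.
Proof.
have F y c : posw c -> find negb (rev (y ++ neg ++ c)) = size c.
  move=> Hc; have /negbTE Nc : ~~ has negb (rev c).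
    by rewrite has_rev -all_predC; apply: sub_all Hc => -[].
  by rewrite !rev_cat !find_cat has_cat Nc /= size_rev addn0.
move=> Hb Hb' E; have S : size b = size b'.
  by rewrite -(F x) // -(F x') // E.
have Sx : size x = size x'.
  by move/(congr1 size): E; rewrite !size_cat S => /addIn.
by move/eqP: E; rewrite eqseq_cat // => /andP [/eqP-> /eqP [->]].
Qed.

Section Generation.

Variables (G : raw -> Prop) (HG : traced_class G).

(* [q] is the number of [-] in the target of [h]; as [b] is positive, the bent
   strand is always the last negative one. *)
Fixpoint bent q h : Prop :=
  if q is q'.+1 then
    exists x b, [/\ posw b, tgt h = x ++ neg ++ b & bent q' (bend x b h)]
  else G h.

Lemma g_wh x f y : G f -> posw x -> posw y -> G (wh x f y).
Proof.
move=> Gf px py; apply: (g_ten HG); first exact: g_id.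
by apply: (g_ten HG) => //; exact: g_id.
Qed.

Lemma g_tw : G (Rtw pos).
Proof. by apply: g_req tr_br _ => //; apply: g_tr => //; exact: g_br. Qed.

Lemma g_twV : G (RtwV pos).
Proof. by apply: g_req tr_brV _ => //; apply: g_tr => //; exact: g_brV. Qed.

Lemma g_brs a b : posw a -> posw b -> G (Rbr a b).
Proof.
have Gp c : posw c -> G (Rbr pos c).
  elim: c => [_|[] // c IH pc].
    by apply: (g_req HG (req_sym (br0r _))); exact: g_id.
  apply: (g_req HG (req_sym (hexr_wh pos pos c))); apply: g_cmp => //.
  - by apply: g_wh => //; exact: IH.
  - by apply: g_wh => //; exact: g_br.
  - by words.
elim: a b => [|[] // a IH] b pa pb.
  by apply: (g_req HG (req_sym (br0l _))); exact: g_id.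
apply: (g_req HG (req_sym (hexl_wh pos a b))); apply: g_cmp => //.
- by apply: g_wh => //; exact: Gp.
- by apply: g_wh => //; exact: IH.
- by words.
Qed.

Lemma g_brVs a b : posw a -> posw b -> G (RbrV a b).
Proof.
have Gp c : posw c -> G (RbrV pos c).
  elim: c => [_|[] // c IH pc].
    by apply: (g_req HG (req_sym (brV0r _))); exact: g_id.
  apply: (g_req HG (req_sym (hexrV pos pos c))); apply: g_cmp => //.
  - by apply: g_wh => //; exact: g_brV.
  - by apply: g_wh => //; exact: IH.
  - by words.
elim: a b => [|[] // a IH] b pa pb.
  by apply: (g_req HG (req_sym (brV0l _))); exact: g_id.
apply: (g_req HG (req_sym (hexlV pos a b))); apply: g_cmp => //.
- by apply: g_wh => //; exact: IH.
- by apply: g_wh => //; exact: Gp.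
- by words.
Qed.

Lemma bent_req q h h' : h ≈ h' -> bent q h -> bent q h'.
Proof.
elim: q h h' => [|q IH] h h' E; first exact: g_req.
case=> x [b [pb th Nb]]; exists x, b; split=> //; first by case: E => _ e _ _;
  rewrite -e.
by apply: IH Nb; rewrite E.
Qed.

Lemma bent_src q h : bent q h -> posw (src h).
Proof.
elim: q h => [|q IH] h; first exact: g_src.
by case=> x [b [_ _ /IH]] /=; rewrite all_cat andbT.
Qed.

Lemma bent_pos q h : bent q h -> posw (tgt h) -> G h.
Proof.
by case: q => // q [x [b [_ -> _]]]; rewrite !all_cat andbF.
Qed.

Lemma bent_dec q h x b : bent q h -> tgt h = x ++ neg ++ b -> posw b ->
  exists2 q', q = q'.+1 & bent q' (bend x b h).
Proof.
case: q => [/(g_tgt HG) P th|q [x' [b' [pb' th' Nb]]] th pb].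
  by rewrite th all_cat andbF in P.
exists q => //; rewrite th' in th.
by case: (minus_uniq pb' pb th) => <- <-.
Qed.

Lemma bent_pre q h g : bent q h -> G g -> src h = tgt g -> bent q (h ∘ g).
Proof.
elim: q h g => [|q IH] h g; first exact: g_cmp.
case=> x [b [pb th Nb]] Gg e; exists x, b; split=> //.
apply: (bent_req (req_sym (bend_cmp _ _ _ _))); apply: IH => //.
  exact: g_wh.
by words; rewrite e.
Qed.

Lemma bent_tenp q h : bent q h -> bent q (wh 1 h pos).
Proof.
elim: q h => [|q IH] h; first by move=> Gh; exact: g_wh.
move=> Nh; have psh := bent_src Nh; case: Nh => x [b [pb th Nb]].
exists x, (b ++ pos); split; first by rewrite all_cat pb.
  by rewrite tgt_wh th -!catA.
apply: (bent_req (req_sym (bend_ten_p th))); apply: bent_pre; first exact: IH.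
  by apply: g_wh => //; exact: g_br.
by words.
Qed.

Lemma bent_tr q a c k : bent q k -> src k = a ++ pos -> tgt k = c ++ pos ->
  bent q (Rtr a c k).
Proof.
elim: q a c k => [|q IH] a c k; first exact: g_tr.
move=> Nk sk tk; have := bent_src Nk; rewrite sk all_cat => /andP [pa _].
case: Nk => x [b [pb th Nb]].
(* The target of [k] ends in the [+] to be closed, so [b] is not empty and its last letter is this
   strand. *)
move: th pb Nb; case/lastP: b => [|b e] th.
  by move: th; rewrite tk !cats1 => /rcons_inj [].
have [-> ec] : e = true /\ c = x ++ neg ++ b.
  by move: th; rewrite tk -cats1 !catA !cats1 => /rcons_inj [-> <-].
rewrite -cats1 all_cat => /andP [pb _] Nb.
exists x, b; split=> //; first by words; rewrite ec.
rewrite ec; apply: (bent_req (req_sym (bend_tr sk _))).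
  by rewrite tk ec -!catA.
apply: IH; [|by words|by words]; apply: bent_pre => //.
  by apply: g_wh => //; exact: g_brV.
by words; rewrite sk -catA.
Qed.

(** A box in [G] has positive ends, so the last [-] lies on one side of it, and the box passes out
    of the bend by [bend_slice] or [bend_sliceR]. The number of [-] does not change. *)
Lemma bent_slice q f h u v : G f -> bent q h -> tgt h = u ++ src f ++ v ->
  bent q (wh u f v ∘ h).
Proof.
move=> Gf; elim: q u v h => [|q IH] u v h Nh th.
  have := g_tgt HG Nh; rewrite th !all_cat => /and3P [pu _ pv].
  by apply: g_cmp => //; exact: g_wh.
case: Nh => x [b [pb th' Nb]].
case: (last_minus v) => [pv|[v' [b' [ev pb']]]].
  case: (last_minus u) => [pu|[x' [b1 [eu pb1]]]].
    have : posw (tgt h) by rewrite th !all_cat pu pv (g_src HG Gf).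
    by rewrite th' !all_cat andbF.
  have pb2 : posw (b1 ++ src f ++ v) by rewrite !all_cat pb1 pv (g_src HG Gf).
  have [ex eb] : x = x' /\ b = b1 ++ src f ++ v.
    by apply: minus_uniq => //; rewrite -th' th eu -!catA.
  rewrite ex eb in Nb; rewrite eu.
  exists x', (b1 ++ tgt f ++ v); split.
  - by rewrite !all_cat pb1 pv (g_tgt HG Gf).
  - by words.
  apply: (bent_req (req_sym (bend_sliceR _ _ _ _ _))); apply: IH => //.
  by words.
have [ex eb] : x = u ++ src f ++ v' /\ b = b'.
  by apply: minus_uniq => //; rewrite -th' th ev -!catA.
rewrite ex eb in Nb; rewrite ev.
exists (u ++ tgt f ++ v'), b'; split=> //; first by words.
apply: (bent_req (req_sym (bend_slice _ _ _ _ _))); apply: IH => //.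
by words.
Qed.

(** The depth [q'] is left open because evaluations lower it and coevaluations raise it. *)
Definition slice_closed f := forall u v q h, bent q h ->
  tgt h = u ++ src f ++ v ->
  exists q', bent q' (wh u f v ∘ h).

(** Every [-] to the right of the slice can be bent away first, since bending commutes with a slice
    on its left. *)
Lemma closed_right f :
  (forall u v q h, posw v -> bent q h -> tgt h = u ++ src f ++ v ->
    exists q', bent q' (wh u f v ∘ h)) -> slice_closed f.
Proof.
(* Bending replaces [v] by [v' ++ b], which is shorter than [v] but not a tail of it, hence an
   induction on the size. *)
move=> H u v; move: {2}(size v).+1 (ltnSn (size v)) => s.
elim: s v => // s IH v; rewrite ltnS => sv q h Nh th.
case: (last_minus v) => [pv|[v' [b [ev pb]]]]; first exact: H Nh th.
have [|q' _ Nb] := @bent_dec q h (u ++ src f ++ v') b Nh _ pb.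
  by rewrite th ev -!catA.
have [||q'' N''] := IH (v' ++ b) _ _ _ Nb.
- by apply: leq_trans sv; rewrite ev !size_cat /= add1n addnS.
- by words.
exists q''.+1, (u ++ tgt f ++ v'), b; split=> //; first by rewrite ev; words.
by rewrite ev; apply: (bent_req (req_sym (bend_slice _ _ _ _ _))).
Qed.

Lemma closed_G f : G f -> slice_closed f.
Proof. by move=> Gf u v q h Nh th; exists q; exact: bent_slice. Qed.

Lemma closed_req f g : f ≈ g -> slice_closed f -> slice_closed g.
Proof.
move=> E Hf u v q h Nh th; case: (E) => sE _ _ _.
have [|q' Nq'] := Hf u v q h Nh; first by rewrite sE.
by exists q'; apply: bent_req Nq'; rewrite E.
Qed.

Lemma closed_cmp g f : slice_closed g -> slice_closed f -> src g = tgt f ->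
  slice_closed (g ∘ f).
Proof.
move=> Hg Hf e u v q h Nh th; have [q1 N1] := Hf u v q h Nh th.
have [|q2 N2] := Hg u v q1 _ N1; first by words; rewrite e.
by exists q2; apply: bent_req N2; rewrite wh_cmp cmpA.
Qed.

Lemma closed_wh x f y : slice_closed f -> slice_closed (wh x f y).
Proof.
move=> Hf u v q h Nh th.
have [|q' N'] := Hf (u ++ x) (y ++ v) q h Nh; first by rewrite th; words.
by exists q'; apply: bent_req N'; rewrite wh_wh.
Qed.

Lemma closed_id a : slice_closed (Rid a).
Proof.
move=> u v q h Nh th; exists q; apply: bent_req Nh.
by rewrite wh_id cmp1l.
Qed.

Lemma closed_ten f g : slice_closed f -> slice_closed g ->
  slice_closed (Rten f g).
Proof.
move=> Hf Hg; apply: (closed_req (req_sym (ten_split f g))).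
apply: closed_cmp; [exact: closed_wh | exact: closed_wh |].
by words.
Qed.

Lemma closed_coev : slice_closed Rcoev.
Proof.
apply: closed_right => u v q h pv Nh th.
exists q.+1, (u ++ pos), v; split=> //; first by words.
apply: (bent_req (req_sym (bend_coev _ _ _))); apply: bent_slice.
- exact: g_brs.
- exact: bent_tenp.
- by words; rewrite th -!catA.
Qed.

Lemma closed_ev : slice_closed Rev.
Proof.
apply: closed_right => u v q h pv Nh th.
have th' : tgt h = u ++ neg ++ pos ++ v by [].
(* The inverse twist required by [ev_trace] is inserted before the [-] is bent. *)
have N1 : bent q (wh (u ++ neg) (RtwV pos) v ∘ h).
  by apply: bent_slice => //; [exact: g_twV | rewrite th' -!catA].
have [||q' _ N2] := @bent_dec _ _ u (pos ++ v) N1 => //; first by words.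
exists q'; apply: (bent_req (req_sym (ev_trace th'))); apply: bent_tr.
- by apply: bent_slice => //; [exact: g_brVs | words].
- by words.
- by words.
Qed.

Lemma closed_pn : slice_closed (Rbr pos neg).
Proof.
apply: closed_right => u v q h pv Nh th.
have [||q' _ N2] := @bent_dec _ _ (u ++ pos) v Nh => //;
  first by rewrite th -!catA.
exists q'.+1, u, (pos ++ v); split=> //.
exact: (bent_req (req_sym (bend_pn _ _ _))).
Qed.

(** This is [bend_pn] read backwards: bending after the inverse crossing gives what bending before
    it gave. *)
Lemma closed_pnV : slice_closed (RbrV pos neg).
Proof.
apply: closed_right => u v q h pv Nh th.
have [||q' _ N2] := @bent_dec _ _ u (pos ++ v) Nh => //.
exists q'.+1, (u ++ pos), v; split=> //; first by words.
apply: (bent_req _ N2); rewrite -bend_pn -cmpA -wh_cmp brbrV wh_id cmp1l //.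
Qed.

Lemma closed_twn : slice_closed (Rtw neg).
Proof.
apply: closed_right => u v q h pv Nh th.
have [||q' _ N2] := @bent_dec _ _ u v Nh => //.
exists q'.+1, u, v; split=> //.
apply: (bent_req (req_sym (bend_twn th))); apply: bent_pre => //.
by apply: g_wh => //; [exact: g_tw | exact: bent_src Nh].
Qed.

Lemma closed_twVn : slice_closed (RtwV neg).
Proof.
apply: closed_right => u v q h pv Nh th.
have [||q' _ N2] := @bent_dec _ _ u v Nh => //.
exists q'.+1, u, v; split=> //.
set h' := wh u (RtwV neg) v ∘ h.
have E : bend u v h ≈ bend u v h' ∘ wh (src h) (Rtw pos) 1.
  rewrite -(@bend_twn u v h') // -cmpA -wh_cmp twtwV wh_id cmp1l //.
have I : wh (src h) (Rtw pos) 1 ∘ wh (src h) (RtwV pos) 1 ≈ Rid (src h ++ pos).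
  by rewrite -wh_cmp twtwV wh_id cats0.
have E2 : bend u v h ∘ wh (src h) (RtwV pos) 1 ≈ bend u v h'.
  by rewrite E cmpA I cmp1r.
apply: (bent_req E2); apply: bent_pre => //.
by apply: g_wh => //; [exact: g_twV | exact: bent_src Nh].
Qed.

Lemma closed_RevV : slice_closed RevV.
Proof.
have T : slice_closed (wh 1 (Rtw pos) neg) by apply/closed_wh/closed_G/g_tw.
apply: (closed_req (req_sym RevV_tw)); apply: closed_cmp => //; last first.
  by words.
rewrite RevrE; apply: closed_cmp => //; apply: closed_cmp => //.
  exact: closed_ev.
exact: closed_pn.
Qed.

(** A [-] on the left is removed by [br_neg], which leaves an inverse crossing with [+] on the
    left. *)
Lemma closed_br1 e e' : slice_closed (Rbr [:: e] [:: e']).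
Proof.
case: e.
  by case: e'; [exact/closed_G/(g_br HG) | exact: closed_pn].
apply: (closed_req (req_sym (br_neg _))).
apply: closed_cmp; [apply: closed_cmp|..] => //.
- exact/closed_wh/closed_ev.
- by apply: closed_wh; case: e'; [exact/closed_G/(g_brV HG) | exact:
  closed_pnV].
- exact/closed_wh/closed_coev.
Qed.

Lemma closed_brV1 e e' : slice_closed (RbrV [:: e] [:: e']).
Proof.
case: e.
  by case: e'; [exact/closed_G/(g_brV HG) | exact: closed_pnV].
apply: (closed_req (req_sym (brV_neg _))).
apply: closed_cmp; [apply: closed_cmp|..].
- exact/closed_wh/closed_RevV.
- by apply: closed_wh; case: e'; [exact/closed_G/(g_br HG) | exact: closed_pn].
- by words.
- apply: closed_wh; apply: closed_cmp => //; first exact: closed_pn.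
  exact: closed_coev.
- by words.
Qed.

Lemma closed_br a b : slice_closed (Rbr a b).
Proof.
have H e c : slice_closed (Rbr [:: e] c).
  elim: c => [|e' c IH].
    by apply: (closed_req (req_sym (br0r _))); exact: closed_id.
  apply: (closed_req (req_sym (hexr_wh [:: e] [:: e'] c))).
  apply: closed_cmp; [exact: closed_wh | exact/closed_wh/closed_br1 | by words].
elim: a b => [|e a IH] b.
  by apply: (closed_req (req_sym (br0l _))); exact: closed_id.
apply: (closed_req (req_sym (hexl_wh [:: e] a b))).
by apply: closed_cmp; [exact: closed_wh | exact: closed_wh | words].
Qed.

Lemma closed_brV a b : slice_closed (RbrV a b).
Proof.
have H e c : slice_closed (RbrV [:: e] c).
  elim: c => [|e' c IH].
    by apply: (closed_req (req_sym (brV0r _))); exact: closed_id.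
  apply: (closed_req (req_sym (hexrV [:: e] [:: e'] c))).
  apply: closed_cmp; [exact/closed_wh/closed_brV1 | exact:
    closed_wh | by words].
elim: a b => [|e a IH] b.
  by apply: (closed_req (req_sym (brV0l _))); exact: closed_id.
apply: (closed_req (req_sym (hexlV [:: e] a b))).
by apply: closed_cmp; [exact: closed_wh | exact: closed_wh | words].
Qed.

Lemma closed_tw a : slice_closed (Rtw a).
Proof.
elim: a => [|e a IH].
  by apply: (closed_req (req_sym tw0)); exact: closed_id.
apply: (closed_req (req_sym (tw_ten [:: e] a))); apply: closed_cmp => //.
  exact: closed_br.
apply: closed_cmp => //; first exact: closed_br.
apply: closed_ten => //.
by case: e; [exact/closed_G/g_tw | exact: closed_twn].
Qed.

Lemma closed_twV a : slice_closed (RtwV a).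
Proof.
elim: a => [|e a IH].
  apply: (@closed_req (Rid [::])); last exact: closed_id.
  by rewrite -(@cmp1r (RtwV [::]) [::]) // -{2}tw0 twVtw.
apply: (closed_req (req_sym (twV_ten [:: e] a))); apply: closed_cmp => //.
  apply: closed_ten => //.
  by case: e; [exact/closed_G/g_twV | exact: closed_twVn].
by apply: closed_cmp => //; exact: closed_brV.
Qed.

Lemma closed_all f : wf f -> slice_closed f.
Proof.
elim: f => /=.
- by move=> a _; exact: closed_id.
- by move=> g Hg f Hf /and3P [/Hg ? /Hf ? /eqP e]; exact: closed_cmp.
- by move=> f Hf g Hg /andP [/Hf ? /Hg ?]; exact: closed_ten.
- by move=> *; exact: closed_br.
- by move=> *; exact: closed_brV.
- by move=> *; exact: closed_tw.
- by move=> *; exact: closed_twV.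
- by move=> _; exact: closed_ev.
- by move=> _; exact: closed_coev.
Qed.

(** The whole of [f] is treated as one slice on top of an identity, which is bent of depth 0. The
    result has a target without [-], so its depth is again 0 and it lies in [G]. *)
Theorem traced_generation f : wf f -> posw (src f) -> posw (tgt f) -> G f.
Proof.
move=> wff ps pt; have N0 : bent 0 (Rid (src f)) by exact: g_id.
have [|q Nq] := @closed_all f wff [::] [::] 0 _ N0; first by words.
apply: (g_req HG _ (bent_pos Nq _)); last by words.
by rewrite wh0 cmp1r.
Qed.

End Generation.

(** * Passage between typed and untyped tangles *)

Lemma teq_ends a b (f : tangle a b) a' b' (f' : tangle a' b') :
  teq f f' -> a = a' /\ b = b'.
Proof.
elim=> //; try by intuition congruence.
- by move=> *; rewrite !catA.
- by move=> *; rewrite !cats0.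
- by move=> *; rewrite !catA.
- by move=> *; rewrite !catA.
Qed.

Fixpoint erase a b (f : tangle a b) : raw :=
  match f with
  | Tid a => Rid a
  | Tcmp _ _ _ g f => Rcmp (erase g) (erase f)
  | Tten _ _ _ _ f g => Rten (erase f) (erase g)
  | Tbr a b => Rbr a b
  | TbrV a b => RbrV a b
  | Ttw a => Rtw a
  | TtwV a => RtwV a
  | Tev => Rev
  | Tcoev => Rcoev
  end.

Lemma erase_ends a b (f : tangle a b) :
  src (erase f) = a /\ tgt (erase f) = b.
Proof.
elim: f => //=; first by move=> ? ? ? g [_ ->] f [-> _].
by move=> ? ? ? ? f [-> ->] g [-> ->].
Qed.

Lemma erase_wf a b (f : tangle a b) : wf (erase f).
Proof.
elim: f => //=; last by move=> ? ? ? ? f -> g ->.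
move=> ? ? ? g -> f ->.
by case: (erase_ends g) => -> _; case: (erase_ends f) => _ ->; rewrite eqxx.
Qed.

Lemma den_erase a b (f : tangle a b) : forall H, teq (@den (erase f) H) f.
Proof.
elim: f => *; try exact: teq_refl.
- exact: den_cmpE.
- exact: den_tenE.
Qed.

Lemma posw_plus a : posw a -> a = plus (size a).
Proof. by move=> H; apply/all_pred1P; apply: sub_all H => -[]. Qed.

Lemma plus_posw k : posw (plus k).
Proof. by rewrite all_nseq orbT. Qed.

Section Bridge.

Variable P : forall k m, tangle (plus k) (plus m) -> Prop.
Hypothesis P_teq : forall k m (f g : tangle (plus k) (plus m)),
  teq f g -> P f -> P g.
Hypothesis P_id : forall k, P (Tid (plus k)).
Hypothesis P_cmp : forall k l m (g : tangle (plus l) (plus m))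
  (f : tangle (plus k) (plus l)), P g -> P f -> P (Tcmp g f).
Hypothesis P_ten : forall k m k' m' (f : tangle (plus k) (plus m))
  (g : tangle (plus k') (plus m')), P f -> P g ->
  @P (k + k') (m + m') (@tarr Tplus _ _ _ _ f g).
Hypothesis P_br : @P 2 2 (Tbr pos pos).
Hypothesis P_brV : @P 2 2 (TbrV pos pos).
Hypothesis P_tr : forall k m (f : tangle (plus (k + 1)) (plus (m + 1))),
  P f -> P (Ttr f).

(** Asking for [P] on every typed form of the term avoids the choice of casts; [teq_ends] shows that
    all these forms have the same ends. *)
Definition rawP r := [/\ posw (src r), posw (tgt r) & exists H : wf r,
  forall k m (f : tangle (plus k) (plus m)), teq (den H) f -> P f].

Lemma plus_inj k m : plus k = plus m -> k = m.
Proof. by move/(congr1 size); rewrite !size_nseq. Qed.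

Lemma P_hteq k m (f : tangle (plus k) (plus m)) k' m'
    (g : tangle (plus k') (plus m')) : teq f g -> P f -> P g.
Proof.
move=> E; have [/plus_inj ek /plus_inj em] := teq_ends E.
by subst k' m'; exact: P_teq.
Qed.

Lemma rawPI r (H : wf r) k m (f : tangle (plus k) (plus m)) :
  teq (den H) f -> P f -> rawP r.
Proof.
move=> E Pf; have [es et] := teq_ends E.
split; [by rewrite es plus_posw | by rewrite et plus_posw |].
exists H => k' m' g E'; apply: (P_hteq _ Pf).
exact: teq_trans (teq_sym E) E'.
Qed.

Lemma rawPE r : rawP r -> exists (H : wf r) k m
  (f : tangle (plus k) (plus m)),
  [/\ src r = plus k, tgt r = plus m, teq (den H) f & P f].
Proof.
case=> /posw_plus ps /posw_plus pt [H HP].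
exists H, (size (src r)), (size (tgt r)), (castT ps pt (den H)).
by split=> //; [|apply: HP]; apply: teq_castr; exact: teq_refl.
Qed.

Lemma rawP_req f g : f ≈ g -> rawP f -> rawP g.
Proof.
move=> [es et ew T] [ps pt [H HP]].
split; [by rewrite -es|by rewrite -et|].
have H' : wf g by rewrite -ew.
by exists H' => k m t E; apply: HP; apply: teq_trans E; exact: T.
Qed.

Lemma rawP_class : traced_class rawP.
Proof.
split.
- exact: rawP_req.
- by move=> f [_ _ []].
- by move=> f [].
- by move=> f [].
- move=> a /posw_plus ->; have H : wf (Rid (plus (size a))) by [].
  by apply: (rawPI (H := H) _ (P_id _)); exact: den_idE.
- move=> g f /rawPE [Hg [k [m [g0 [sg tg Eg Pg]]]]].
  case/rawPE=> [Hf [k' [m' [f0 [sf tf Ef Pf]]]]] e.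
  have em : m' = k by apply: plus_inj; rewrite -sg e tf.
  subst m'; have H : wf (g ∘ f) by rewrite /= Hg Hf e eqxx.
  apply: (rawPI (H := H) _ (P_cmp Pg Pf)).
  by apply: den_cmpE => ?; [apply: teq_trans Eg|apply: teq_trans Ef];
    exact: den_self.
- move=> f g /rawPE [Hf [k [m [f0 [sf tf Ef Pf]]]]].
  case/rawPE=> [Hg [k' [m' [g0 [sg tg Eg Pg]]]]].
  have H : wf (Rten f g) by rewrite /= Hg Hf.
  apply: (rawPI (H := H) _ (P_ten Pf Pg)); apply: teq_castr.
  by apply: den_tenE => ?; [apply: teq_trans Ef|apply: teq_trans Eg];
    exact: den_self.
- have H : wf (Rbr pos pos) by [].
  by apply: (rawPI (H := H) _ P_br); exact: den_brE.
- have H : wf (RbrV pos pos) by [].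
  by apply: (rawPI (H := H) _ P_brV); exact: teq_refl.
- move=> a c k /rawPE [Hk [k' [m' [k0 [sk tk Ek Pk]]]]] ea ec.
  (* [r] copies the syntax of [Tclose] and [Tevr], so that it can be compared with [Ttr] constructor
     by constructor; [Rtr] is its whiskered form. *)
  pose r := Rten (Rid c) (Rev ∘ (Rbr pos neg ∘ Rten (Rtw pos) (Rid neg))) ∘
    (Rten k (Rid neg) ∘ Rten (Rid a) Rcoev).
  have E : r ≈ Rtr a c k.
    by rewrite /r /Rtr RevrE !ten_whl !ten_whr !cmpA.
  have H : wf r by rewrite /r /= Hk ea ec -!catA !eqxx.
  have pa : a = plus (size a).
    by apply: posw_plus; have := plus_posw k';
      rewrite -sk ea all_cat => /andP [].
  have pc : c = plus (size c).
    by apply: posw_plus; have := plus_posw m';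
      rewrite -tk ec all_cat => /andP [].
  move: (size a) (size c) pa pc => i j pa pc; subst a c.
  have ei : k' = i + 1 by apply: plus_inj; rewrite -sk ea plusD.
  have ej : m' = j + 1 by apply: plus_inj; rewrite -tk ec plusD.
  subst k' m'.
  have rP : rawP r.
    apply: (rawPI (H := H) _ (P_tr Pk)).
    apply: teq_castr; apply: den_cmpE => [?|].
      apply: teq_castr; apply: den_tenE => [?|?].
        by rewrite addn0; exact: den_idE.
      apply: den_cmpE => [?|?]; first exact: teq_refl.
      apply: den_cmpE => ?; exact: teq_refl.
    apply: den_cmpE => ?; apply: teq_castr; last first.
      apply: den_tenE => ?; last exact: teq_refl.
      by rewrite addn0; exact: den_idE.
    apply: den_tenE => ?; last exact: teq_refl.
    apply: teq_castr; apply: teq_trans Ek; exact: den_self.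
  exact: rawP_req E rP.
Qed.

Theorem plus_ind k m (f : tangle (plus k) (plus m)) : P f.
Proof.
have [es et] := erase_ends f.
have [||_ _ [H]] := traced_generation rawP_class (erase_wf f).
- by rewrite es plus_posw.
- by rewrite et plus_posw.
by apply; exact: den_erase.
Qed.

End Bridge.

End GraphicalCalculus.

(** * Multilinear algebra *)

Local Open Scope ring_scope.

Section LinearMaps.

Variables (k : comNzRingType) (M N : lmodType k).

Lemma lin_comb (f : M -> N) I (r : seq I) (a : I -> k) (F : I -> M) :
  linear f -> f (\sum_(i <- r) a i *: F i) = \sum_(i <- r) a i *: f (F i).
Proof.
move=> Hf; pose f' : {linear M -> N} :=
  HB.pack f (GRing.isLinear.Build k M N *:%R f Hf).
rewrite -[f]/(f' : M -> N) linear_sum.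
by apply: eq_bigr => i _; rewrite linearZ.
Qed.

Lemma lin_sum (f : M -> N) I (r : seq I) (F : I -> M) :
  linear f -> f (\sum_(i <- r) F i) = \sum_(i <- r) f (F i).
Proof.
move=> Hf; pose f' : {linear M -> N} :=
  HB.pack f (GRing.isLinear.Build k M N *:%R f Hf).
by rewrite -[f]/(f' : M -> N) linear_sum.
Qed.

Lemma lin_scale (f : M -> N) a x : linear f -> f (a *: x) = a *: f x.
Proof.
by move=> Hf; have := lin_comb [:: tt] (fun=> a) (fun=> x) Hf;
  rewrite !big_seq1.
Qed.

Lemma lin_sumf I (r : seq I) (a : I -> k) (F : I -> M -> N) :
  (forall i, linear (F i)) -> linear (fun x => \sum_(i <- r) a i *: F i x).
Proof.
move=> HF c u v; rewrite scaler_sumr -big_split; apply: eq_bigr => i _.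
by rewrite HF scalerDr !scalerA mulrC.
Qed.

End LinearMaps.

Lemma lin_comp (k : comNzRingType) (M N L : lmodType k) (g : N -> L)
  (f : M -> N) : linear g -> linear f -> linear (fun x => g (f x)).
Proof. by move=> Hg Hf c u v; rewrite Hf Hg. Qed.

Section Tensors.

Variables (k : comNzRingType) (X : Type) (c : X -> lmodType k).
Implicit Types (s t : seq X) (M N : lmodType k).
Local Notation H s := (@hlist k X c s).
Local Notation T s := (@tens k X c s).

Lemma mlin_ext s M (f g : H s -> M) : f =1 g -> mlin f -> mlin g.
Proof. by move=> E Hf; have <- : f = g by exact: funext. Qed.

Lemma mlin_comp s M N (g : M -> N) (f : H s -> M) :
  linear g -> mlin f -> mlin (fun h => g (f h)).
Proof.
move=> Hg; elim: s f => //= a s IH f [H1 H2]; split=> [h|v].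
  exact: (lin_comp Hg (H1 h)).
exact: IH (H2 v).
Qed.

Lemma mlin_sum s M I (r : seq I) (a : I -> k) (F : I -> H s -> M) :
  (forall i, mlin (F i)) -> mlin (fun h => \sum_(i <- r) a i *: F i h).
Proof.
elim: s F => //= x s IH F HF; split=> [h|v].
  by apply: lin_sumf => i; case: (HF i).
by apply: IH => i; case: (HF i).
Qed.

(** Multilinearity consists of equations in the target, so a separating family of linear maps
    detects it. It is meant for [pure], whose target is a quotient known only through [tensP]. *)
Lemma mlin_sep s M (f : H s -> M) (K : forall N, (M -> N) -> Prop) :
  (forall N g, K N g -> linear g /\ mlin (fun h => g (f h))) ->
  (forall x y, (forall N g, K N g -> g x = g y) -> x = y) -> mlin f.
Proof.
move=> HK sepK; elim: s f HK => //= a s IH f HK; split=> [h b u v|v].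
  by apply: sepK => N g /HK [Hg [Hf _]]; rewrite Hf Hg.
by apply: IH => N g /HK [Hg [_ Hf]].
Qed.

Lemma pure_mlin s : mlin (@pure k X c s).
Proof.
apply: (@mlin_sep s (T s) _
  (fun N g => exists2 f : H s -> N, mlin f & g = lift f)).
  move=> N _ [f Hf ->]; split; first exact: lift_linear.
  by apply: (mlin_ext _ Hf) => h; rewrite lift_pure.
by move=> x y E; apply: tensP => N f Hf; apply: E; exists f.
Qed.

Lemma tens_span s (x : T s) :
  x = \sum_(p <- generic_quotient.repr x) p.1 *: pure p.2.
Proof.
apply: tensP => N f Hf; rewrite (lin_comb _ _ _ (lift_linear Hf)).
by apply: eq_bigr => p _; rewrite lift_pure.
Qed.

Lemma tens_ext s M (f g : T s -> M) : linear f -> linear g ->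
  (forall h, f (pure h) = g (pure h)) -> f =1 g.
Proof.
move=> Hf Hg E x; rewrite (tens_span x) !lin_comb //.
by apply: eq_bigr => p _; rewrite E.
Qed.

(** By definition [lift] is a finite sum over a representative of [y], so dependence on a parameter
    is treated termwise, whatever [f h] does in its tensor variable. *)
Lemma lift_param s t M (f : H s -> H t -> M) y :
  (forall h', mlin (fun h => f h h')) -> mlin (fun h => lift (f h) y).
Proof. by move=> Hf; apply: mlin_sum => p. Qed.

Lemma lin_lift_param N s M (f : N -> H s -> M) y :
  (forall h, linear (fun x => f x h)) -> linear (fun x => lift (f x) y).
Proof. by move=> Hf; apply: lin_sumf => p. Qed.

Lemma mlin_hcatl s t M (f : H (s ++ t) -> M) h' :
  mlin f -> mlin (fun h : H s => f (hcat h h')).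
Proof.
elim: s f => //= a s IH f [H1 H2]; split=> [h|v]; first exact: H1.
exact: IH (H2 v).
Qed.

Lemma mlin_hcatr s t M (f : H (s ++ t) -> M) (h : H s) :
  mlin f -> mlin (fun h' => f (hcat h h')).
Proof.
by elim: s f h => //= a s IH f [v h] [H1 H2]; exact: IH (H2 v).
Qed.

Lemma tcat_mlinr s t (h : H s) : mlin (fun h' : H t => pure (hcat h h')).
Proof. exact/mlin_hcatr/pure_mlin. Qed.

Lemma tcat_mlinl s t (y : T t) :
  mlin (fun h : H s => lift (fun h' => pure (hcat h h')) y).
Proof. by apply: lift_param => h'; exact/mlin_hcatl/pure_mlin. Qed.

Lemma tcat_linl s t (y : T t) : linear (fun x : T s => tcat x y).
Proof. exact/lift_linear/tcat_mlinl. Qed.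

Lemma tcat_linr s t (x : T s) : linear (fun y : T t => tcat x y).
Proof. by apply: lin_lift_param => h; exact/lift_linear/tcat_mlinr. Qed.

Lemma tcat_pure s t (h : H s) (h' : H t) :
  tcat (pure h) (pure h') = pure (hcat h h').
Proof. by rewrite /tcat lift_pure ?lift_pure //;
  [exact: tcat_mlinr | exact: tcat_mlinl]. Qed.

Lemma htake_hcat s t (h : H s) (h' : H t) : htake (hcat h h') = h.
Proof. by elim: s h => [[]|a s IH [v h]] //=; rewrite IH. Qed.

Lemma hdrop_hcat s t (h : H s) (h' : H t) : hdrop (hcat h h') = h'.
Proof. by elim: s h => [[]|a s IH [v h]] //=; rewrite IH. Qed.

(** Words that agree only up to provable equality index different tensor products; this relation
    hides the casts, and their proofs, from statements. *)
Definition heq s t (x : T s) (y : T t) :=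
  exists e : s = t, ecast z (T z) e x = y.

Lemma heq_refl s (x : T s) : heq x x. Proof. by exists erefl. Qed.

Lemma heq_sym s t (x : T s) (y : T t) : heq x y -> heq y x.
Proof. by case=> e <-; case: _ / e; exists erefl. Qed.

Lemma heq_trans s t r (x : T s) (y : T t) (z : T r) :
  heq x y -> heq y z -> heq x z.
Proof. by case=> e <- [e' <-]; case: _ / e'; case: _ / e; exists erefl. Qed.

(** The labels may be modules, without decidable equality, so irrelevance of the equality proof is
    taken from classical logic. *)
Lemma heq_eq s (x y : T s) : heq x y -> x = y.
Proof. by case=> e <-; rewrite (Prop_irrelevance e erefl). Qed.

Lemma heq_cast s t (e : s = t) (x : T s) : heq x (ecast z (T z) e x).
Proof. by exists e. Qed.

Lemma heq_tcat s t s' t' (x : T s) (y : T t) (x' : T s') (y' : T t') :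
  heq x x' -> heq y y' -> heq (tcat x y) (tcat x' y').
Proof. by case=> e <- [e' <-]; case: _ / e; case: _ / e'; exists erefl. Qed.

Lemma cast_linear s t (e : s = t) : linear (fun x : T s => ecast z (T z) e x).
Proof. by case: _ / e => a u v. Qed.

Lemma heq_sum s t I (r : seq I) (F : I -> T s) (G : I -> T t) :
  s = t -> (forall i, heq (F i) (G i)) ->
  heq (\sum_(i <- r) F i) (\sum_(i <- r) G i).
Proof.
move=> e; case: _ / e G => G E.
by have -> : F = G; [apply: funext => i; exact: heq_eq | exact: heq_refl].
Qed.

Lemma heq_scale s t b (x : T s) (y : T t) : heq x y -> heq (b *: x) (b *: y).
Proof. by case=> e <-; case: _ / e; exact: heq_refl. Qed.

Lemma heq_ex s t (x : T s) : s = t -> exists y : T t, heq x y.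
Proof. by move=> e; case: _ / e; exists x; exact: heq_refl. Qed.

(** Extensionality on pure tensors for linear maps whose sources and targets are only provably
    equal. *)
Lemma heq_ext s s' t t' (G : T s -> T t) (I : T s' -> T t') :
  linear G -> linear I -> t = t' ->
  (forall (h : H s') x, heq (pure h) x -> heq (G x) (I (pure h))) ->
  forall x x', heq x x' -> heq (G x') (I x).
Proof.
move=> HG HI et; case: _ / et I HI => I HI E x x' [e <-] {x'}.
case: _ / e G HG E => G HG E; have -> : G = I; last exact: heq_refl.
by apply/funext/tens_ext => // h; exact/heq_eq/E/heq_refl.
Qed.

Lemma hcast_cons a s t (e : s = t) (e' : a :: s = a :: t) v (h : H s) :
  ecast z (H z) e' ((v, h) : H (a :: s)) =
  ((v, ecast z (H z) e h) : H (a :: t)).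
Proof. by case: _ / e e' => e'; rewrite (Prop_irrelevance e' erefl). Qed.

Lemma pure_cast s t (e : s = t) (h : H s) :
  ecast z (T z) e (pure h) = pure (ecast z (H z) e h).
Proof. by case: _ / e. Qed.

Lemma hcatA s t r (h : H s) (h' : H t) (h'' : H r) :
  ecast z (H z) (catA s t r) (hcat h (hcat h' h'')) = hcat (hcat h h') h''.
Proof.
elim: s h => [h|a s IH [v h]].
  by rewrite (Prop_irrelevance (catA [::] t r) erefl).
by rewrite (hcast_cons (catA s t r)) IH.
Qed.

Lemma hcats0 s (h : H s) (h0 : H [::]) :
  ecast z (H z) (cats0 s) (hcat h h0) = h.
Proof.
elim: s h => [|a s IH].
  by case; case: h0; rewrite (Prop_irrelevance (cats0 [::]) erefl).
by case=> v h; rewrite (hcast_cons (cats0 s)) IH.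
Qed.

Lemma tcatA s t r (x : T s) (y : T t) (z : T r) :
  heq (tcat x (tcat y z)) (tcat (tcat x y) z).
Proof.
exists (catA s t r); have C := cast_linear (catA s t r).
have [Ll Lr] := (tcat_linl, tcat_linr).
move: x; apply: tens_ext.
- by apply: (lin_comp C) => a u v; rewrite Ll.
- by move=> a u v; rewrite !Ll.
move=> h; move: y; apply: tens_ext.
- by move=> a u v; rewrite Ll Lr C.
- by move=> a u v; rewrite Lr Ll.
move=> h'; move: z; apply: tens_ext.
- by move=> a u v; rewrite !Lr C.
- by move=> a u v; rewrite Lr.
by move=> h''; rewrite !tcat_pure pure_cast hcatA.
Qed.

Lemma tcat1 s (x : T s) (h0 : H [::]) : heq (tcat x (pure h0)) x.
Proof.
exists (cats0 s); have C := cast_linear (cats0 s).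
move: x; apply: tens_ext => //.
  by apply: (lin_comp C); exact: tcat_linl.
by move=> h; rewrite tcat_pure pure_cast hcats0.
Qed.

End Tensors.

(** * Multilinear functions of finite families *)

Definition upd (V : Type) m (i : 'I_m) (v : V) (x : 'I_m -> V) : 'I_m -> V :=
  fun j => if j == i then v else x j.

Definition multilin (k : comNzRingType) (V M : lmodType k) m
    (F : ('I_m -> V) -> M) :=
  forall i x, linear (fun v => F (upd i v x)).

Section Multilinear.

Variable k : comNzRingType.
Implicit Types (V M N : lmodType k).

(** A substitution preserves multilinearity when each variable feeds exactly one argument, and does
    so linearly. *)
Lemma multilin_sub V N M m l (F : ('I_l -> N) -> M)
    (G : ('I_m -> V) -> 'I_l -> N) : multilin F ->
  (forall j x, exists i (g : V -> N),
    linear g /\ forall v, G (upd j v x) =1 upd i (g v) (G x)) ->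
  multilin (fun x => F (G x)).
Proof.
move=> HF HG j x; have [i [g [Hg E]]] := HG j x.
have {}E v : G (upd j v x) = upd i (g v) (G x) by exact/funext/E.
by move=> a u v; rewrite !E Hg HF.
Qed.

Lemma multilin_sum V M m I (r : seq I) (a : I -> k) (F :
  I -> ('I_m -> V) -> M) :
  (forall i, multilin (F i)) -> multilin (fun x => \sum_(i <- r) a i *: F i x).
Proof. by move=> HF j x; apply: lin_sumf => i; exact: HF. Qed.

Variables (X : Type) (c : X -> lmodType k) (a : X).
Local Notation H m := (@hlist k X c (nseq m a)).
Local Notation T m := (@tens k X c (nseq m a)).

Lemma hnth_hmk m (x : 'I_m -> c a) : hnth (hmk c a x) =1 x.
Proof.
elim: m x => [|m IH] x i; first by case: i.
by rewrite /=; case: unliftP => [j ->|->] //; rewrite IH.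
Qed.

Lemma hmk_ext m (x y : 'I_m -> c a) : x =1 y -> hmk c a x = hmk c a y.
Proof. by move=> E; congr hmk; exact: funext. Qed.

Lemma hmk_hnth m (h : H m) : hmk c a (hnth h) = h.
Proof.
elim: m h => [|m IH] h; first by case: h.
case: h => v h /=; congr pair; first by rewrite unlift_none.
by rewrite -[RHS]IH; apply: hmk_ext => i; rewrite liftK.
Qed.

Lemma multilin_mlin M m (F : ('I_m -> c a) -> M) :
  multilin F -> mlin (fun h : H m => F (hnth h)).
Proof.
pose cons l (v : c a) (y : 'I_l -> c a) (i : 'I_l.+1) :=
  if unlift ord0 i is Some j then y j else v.
elim: m F => //= m IH F HF; split=> [h|v].
  suff -> : (fun v => F (hnth ((v, h) : H m.+1))) =
      (fun v => F (upd ord0 v (cons m 0 (hnth h)))) by exact: HF.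
  apply: funext => v; congr F; apply: funext => i; rewrite /cons /upd /=.
  by case: unliftP => [j ->|->]; rewrite ?eqxx.
apply: (IH (fun y => F (cons m v y))); apply: multilin_sub => // j x.
exists (fintype.lift ord0 j), id; split=> // w i; rewrite /cons /upd.
case: unliftP => [j' ->|->]; first by rewrite (inj_eq lift_inj).
by rewrite (negPf (neq_lift _ _)).
Qed.

Lemma mlin_multilin M m (f : H m -> M) :
  mlin f -> multilin (fun x => f (hmk c a x)).
Proof.
elim: m f => [|m IH] f /=; first by move=> _ [].
case=> H1 H2 i x; case: (unliftP ord0 i) => [j|] -> b u v.
  have E w : (fun i => upd (fintype.lift ord0 j) w x (fintype.lift ord0 i))
      = upd j w (fun i => x (fintype.lift ord0 i)).
    by apply: funext => l; rewrite /upd (inj_eq lift_inj).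
  by rewrite /= !E; exact: (IH _ (H2 (x ord0))).
have E w : (fun i => upd ord0 w x (fintype.lift ord0 i))
    = (fun i => x (fintype.lift ord0 i)).
  by apply: funext => l; rewrite /upd.
by rewrite /= !E /upd eqxx; exact: H1.
Qed.

Definition pv m (x : 'I_m -> c a) : T m := pure (hmk c a x).

Lemma pv_ext m (x y : 'I_m -> c a) : x =1 y -> pv x = pv y.
Proof. by move=> E; rewrite /pv (hmk_ext E). Qed.

Lemma pure_pv m (h : H m) : pure h = pv (hnth h).
Proof. by rewrite /pv hmk_hnth. Qed.

Lemma pv_multilin m : multilin (@pv m).
Proof. exact/mlin_multilin/pure_mlin. Qed.

Lemma lift_pv M m (F : ('I_m -> c a) -> M) x :
  multilin F -> lift (fun h : H m => F (hnth h)) (pv x) = F x.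
Proof.
move=> HF; rewrite lift_pure; last exact: multilin_mlin.
by congr F; exact/funext/hnth_hmk.
Qed.

Lemma lin_lift_pv M m (F : ('I_m -> c a) -> M) :
  multilin F -> linear (lift (fun h : H m => F (hnth h))).
Proof. by move=> HF; exact/lift_linear/multilin_mlin. Qed.

Lemma pow_ext M m (f g : T m -> M) : linear f -> linear g ->
  (forall x, f (pv x) = g (pv x)) -> f =1 g.
Proof. by move=> Hf Hg E; apply: tens_ext => // h; rewrite pure_pv E. Qed.

Lemma perm_multilin m (s : 'S_m) :
  multilin (fun x : 'I_m -> c a => pv (fun i => x (s i))).
Proof.
apply: (multilin_sub (@pv_multilin m)) => j x.
exists (s^-1%g j), id; split=> // v i; rewrite /upd.
by rewrite -(inj_eq (@perm_inj _ s) i) permKV.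
Qed.

Lemma sperm_pv m (s : 'S_m) (x : 'I_m -> c a) :
  sperm s (pv x) = pv (fun i => x (s^-1%g i)).
Proof. exact: (lift_pv (F := fun x => pv (fun i => x (s^-1%g i))) _
  (perm_multilin _)). Qed.

Lemma sperm_linear m (s : 'S_m) : linear (@sperm k X c a m s).
Proof. exact: (lin_lift_pv (perm_multilin s^-1%g)). Qed.

End Multilinear.

Section TensorPowers.

Variables (k : comNzRingType) (V : lmodType k).

Lemma tsum_tvec (M : lmodType k) m (F : ('I_m -> V) -> M) x :
  multilin F -> tsum F (tvec x) = F x.
Proof. exact: (@lift_pv k unit (fun=> V) tt). Qed.

Lemma tsum_linear (M : lmodType k) m (F : ('I_m -> V) -> M) :
  multilin F -> linear (tsum F).
Proof. exact: (@lin_lift_pv k unit (fun=> V) tt). Qed.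

Lemma tvec_multilin m : multilin (@tvec k V m).
Proof. exact: (@pv_multilin k unit (fun=> V) tt). Qed.

Lemma tpow_ext (M : lmodType k) m (f g : tpow V m -> M) :
  linear f -> linear g -> (forall x, f (tvec x) = g (tvec x)) -> f =1 g.
Proof. exact: (@pow_ext k unit (fun=> V) tt). Qed.

Lemma tvec_ext m (x y : 'I_m -> V) : x =1 y -> tvec x = tvec y.
Proof. exact: (@pv_ext k unit (fun=> V) tt). Qed.

Lemma tmul_multilin (mul : V -> V -> V) m (x : 'I_m -> V) : bilin mul ->
  multilin (fun y : 'I_m -> V => tvec (fun i => mul (x i) (y i))) /\
  multilin (fun y : 'I_m -> V => tvec (fun i => mul (y i) (x i))).
Proof.
move=> [Hl Hr]; split; apply: (multilin_sub (@tvec_multilin m)) => j y.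
  exists j, (mul (x j)); split=> // v i; rewrite /upd.
  by case: (i =P j) => [->|].
exists j, (mul^~ (x j)); split=> // v i; rewrite /upd.
by case: (i =P j) => [->|].
Qed.

Lemma tmul_tvec (mul : V -> V -> V) m (x y : 'I_m -> V) : bilin mul ->
  tmul mul (tvec x) (tvec y) = tvec (fun i => mul (x i) (y i)).
Proof.
move=> Hm; rewrite /tmul tsum_tvec.
  by rewrite tsum_tvec //; case: (tmul_multilin x Hm).
by apply: multilin_sum => p; case: (tmul_multilin (hnth p.2) Hm).
Qed.

Lemma tmul_linear (mul : V -> V -> V) m (x : tpow V m) : bilin mul ->
  linear (tmul mul x) /\ linear (fun y => tmul mul y x).
Proof.
move=> Hm; split; last first.
  apply: tsum_linear; apply: multilin_sum => p.
  by case: (tmul_multilin (hnth p.2) Hm).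
apply: lin_sumf => p; apply: tsum_linear.
by case: (tmul_multilin (hnth p.2) Hm).
Qed.

End TensorPowers.

(** * The embedding of the category of elements *)

Definition join (V : Type) m l (x : 'I_m -> V) (y : 'I_l -> V)
    (i : 'I_(m + l)) : V :=
  match split i with inl j => x j | inr j => y j end.

Lemma joinl V m l (x : 'I_m -> V) (y : 'I_l -> V) j :
  join x y (lshift l j) = x j.
Proof. by rewrite /join (unsplitK (inl j)). Qed.

Lemma joinr V m l (x : 'I_m -> V) (y : 'I_l -> V) j :
  join x y (rshift m j) = y j.
Proof. by rewrite /join (unsplitK (inr j)). Qed.

Lemma join_updl V m l (x : 'I_m -> V) (y : 'I_l -> V) j v :
  join (upd j v x) y =1 upd (lshift l j) v (join x y).
Proof.
move=> i; rewrite /upd; case: (split_ordP i) => i' ->.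
  by rewrite !joinl (inj_eq (@lshift_inj _ _)).
by rewrite !joinr eq_rlshift.
Qed.

Lemma join_updr V m l (x : 'I_m -> V) (y : 'I_l -> V) j v :
  join x (upd j v y) =1 upd (rshift m j) v (join x y).
Proof.
move=> i; rewrite /upd; case: (split_ordP i) => i' ->.
  by rewrite !joinl eq_lrshift.
by rewrite !joinr (inj_eq (@rshift_inj _ _)).
Qed.

Section Join.

Variables (k : comNzRingType) (X : Type) (c : X -> lmodType k) (a : X).
Local Notation H s := (@hlist k X c s).

Lemma hcat_join m l (x : 'I_m -> c a) (y : 'I_l -> c a) :
  ecast z (H z) (esym (nseqD m l a)) (hcat (hmk c a x) (hmk c a y)) =
  hmk c a (join x y).
Proof.
elim: m x => [|m IH] x.
  rewrite (Prop_irrelevance (esym _) erefl) /=; apply: hmk_ext => i.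
  by rewrite -[i in RHS](_ : rshift 0 i = i) ?joinr //; exact/val_inj.
rewrite (hcast_cons (esym (nseqD m l a))) IH /=; congr pair.
  by rewrite -(joinl x y); congr join; exact/val_inj.
apply: hmk_ext => i; case: (split_ordP i) => j ->.
  rewrite joinl -(joinl x y); congr join; exact/val_inj.
rewrite joinr -(joinr x y); congr join; exact/val_inj.
Qed.

Lemma tcat_pv m l (x : 'I_m -> c a) (y : 'I_l -> c a) :
  heq (pv (join x y)) (tcat (pv x) (pv y)).
Proof.
apply: heq_sym; exists (esym (nseqD m l a)).
by rewrite tcat_pure pure_cast hcat_join.
Qed.

End Join.

Section Iota.

Variables (k : comNzRingType) (A : ribbonHopf k) (W : fMod A).
Local Notation B := (end_xc W).
Local Notation T s := (tens (@fmodl k A) s).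
Local Notation pvW := (@pv k (fMod A) (@fmodl k A) W).

Lemma comp_bilin : bilin (@xmul k B).
Proof.
split=> [g|g] b u v /=.
  exact: etrans (comp_lfunDl _ _ _) (congr1 (fun f => f + _) (esym (comp_lfunZl
    _ _ _))).
exact: etrans (comp_lfunDr _ _ _) (congr1 (fun f => f + _) (esym (comp_lfunZr _
  _ _))).
Qed.

Lemma lfun_eval_linear (w : W) : linear (fun f : 'End(W) => f w : W).
Proof. by move=> b f g; rewrite add_lfunE scale_lfunE. Qed.

Lemma lapp_multilinr m (f : 'I_m -> 'End(W)) :
  multilin (fun w : 'I_m -> fmodl W => pvW (fun i => f i (w i))).
Proof.
apply: (multilin_sub (@pv_multilin _ _ _ _ m)) => j w.
exists j, (f j); split=> [|v i]; first exact: linearP.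
by rewrite /upd; case: (i =P j) => [->|].
Qed.

Lemma lapp_multilinl m (w : 'I_m -> W) :
  multilin (fun f : 'I_m -> 'End(W) => pvW (fun i => f i (w i))).
Proof.
apply: (multilin_sub (@pv_multilin _ _ _ _ m)) => j f.
exists j, (fun g : 'End(W) => g (w j)); split; first exact: lfun_eval_linear.
by move=> v i; rewrite /upd; case: (i =P j) => [->|].
Qed.

Definition lapp m (w : T (nseq m W)) (f : 'I_m -> 'End(W)) : T (nseq m W) :=
  lift (fun h : hlist (@fmodl k A) (nseq m W) =>
    pvW (fun i => f i (hnth h i))) w.

Lemma lapp_pv m (w : 'I_m -> W) f : lapp (pvW w) f = pvW (fun i => f i (w i)).
Proof. exact: (@lift_pv _ _ (@fmodl k A) W _ m _ w (lapp_multilinr f)). Qed.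

Lemma lapp_multilin m (w : T (nseq m W)) : multilin (lapp w).
Proof. by apply: multilin_sum => q; exact: lapp_multilinl. Qed.

Lemma lapp_linear m (f : 'I_m -> 'End(W)) : linear (fun w => lapp w f).
Proof. exact: (@lin_lift_pv _ _ (@fmodl k A) W _ m _ (lapp_multilinr f)). Qed.

Lemma iota_eltE m (x : elt B m) w : iota_elt x w = sperm x.2 (tsum (lapp w)
  x.1).
Proof. by []. Qed.

Lemma iota_linear m (x : elt B m) : linear (iota_elt x).
Proof.
move=> b u v; rewrite !iota_eltE -sperm_linear; congr sperm.
exact: (@lin_lift_param _ _ _ _ (nseq m tt) _ (fun w h => lapp w (hnth h))
  x.1 (fun h => lapp_linear (hnth h))).
Qed.

Lemma iota_linear_elt m (s : 'S_m) w :
  linear (fun t : tpow B m => iota_elt (t, s) w).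
Proof.
move=> b u v; rewrite !iota_eltE -sperm_linear; congr sperm.
exact: (tsum_linear (lapp_multilin w)).
Qed.

Lemma iota_pv m (f : 'I_m -> B) (s : 'S_m) (w : 'I_m -> W) :
  iota_elt (tvec f, s) (pvW w) = pvW (fun i => f (s^-1%g i) (w (s^-1%g i))).
Proof.
by rewrite iota_eltE tsum_tvec ?lapp_pv ?sperm_pv //; exact: lapp_multilin.
Qed.

Lemma iota_elt1 m (w : T (nseq m W)) : iota_elt (elt1 B m) w = w.
Proof.
move: w; apply: pow_ext => [||w]; [exact: iota_linear | by move=> ? |].
by rewrite iota_pv invg1; apply: pv_ext => i; rewrite !perm1 id_lfunE.
Qed.

(** With permutations composed from left to right, [(t * s)%g] is the map [t] followed by [s], so
    the factor [f (t i)] acts after [g i]. *)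
Lemma emul_tvec m (f g : 'I_m -> B) (s t : 'S_m) :
  emul (tvec f, s) (tvec g, t) =
  (tvec (fun i => (f (t i) \o g i)%VF), (t * s)%g).
Proof.
rewrite /emul /=; congr pair.
have -> : sperm t^-1%g (tvec f) = tvec (fun i => f (t i)).
  rewrite [LHS](@sperm_pv k unit (fun=> B : lmodType k) tt) invgK //.
by rewrite tmul_tvec //; exact: comp_bilin.
Qed.

Lemma iota_emul m (x y : elt B m) w :
  iota_elt (emul x y) w = iota_elt x (iota_elt y w).
Proof.
have Lc := tmul_linear _ comp_bilin.
case: x y => [t s] [t' s']; rewrite /emul /=.
move: t; apply: tpow_ext => [b u v|b u v|f].
- rewrite -iota_linear_elt (sperm_linear (c := fun=> B : lmodType k)).
  by case: (Lc m t') => _ /= ->.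
- exact: iota_linear_elt.
move: t'; apply: tpow_ext => [b u v|b u v|g].
- rewrite -iota_linear_elt; case: (Lc m (sperm s'^-1%g (tvec f))) => -> _ //.
- by rewrite -iota_linear; congr iota_elt; exact: iota_linear_elt.
move: w; apply: pow_ext => [b u v|b u v|w].
- exact: iota_linear.
- by rewrite -iota_linear; congr iota_elt; exact: iota_linear.
rewrite -[(tmul _ _ _, _)]/(emul (tvec f, s) (tvec g, s')) emul_tvec.
rewrite !iota_pv; apply: pv_ext => i; rewrite comp_lfunE invMg !permM permKV //.
Qed.

End Iota.

Lemma block_permV_l m l (s : 'S_m) (t : 'S_l) j :
  ((block_perm s t)^-1)%g (lshift l j) = lshift l ((s^-1)%g j).
Proof.
apply: (@perm_inj _ (block_perm s t)); rewrite permKV permE.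
by rewrite (unsplitK (inl _)) permKV.
Qed.

Lemma block_permV_r m l (s : 'S_m) (t : 'S_l) j :
  ((block_perm s t)^-1)%g (rshift m j) = rshift m ((t^-1)%g j).
Proof.
apply: (@perm_inj _ (block_perm s t)); rewrite permKV permE.
by rewrite (unsplitK (inr _)) permKV.
Qed.

Lemma lift_del_perm m (s : 'S_m.+1) i :
  let l := fintype.lift ord_max i in
  fintype.lift ord_max (del_perm s i) =
  if s l == ord_max then s ord_max else s l.
Proof.
rewrite /= permE /del_perm_fun; case: unliftP => [j ->//|] /=.
case: ifP => [/eqP E1 E2|E1 E2]; last by rewrite E2 eqxx in E1.
by have := neq_lift ord_max i; rewrite -(inj_eq (@perm_inj _ s)) E1 E2 eqxx.
Qed.

Definition rext (V : Type) m (x : 'I_m -> V) (v : V) (i : 'I_m.+1) : V :=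
  if unlift ord_max i is Some j then x j else v.

Lemma rext_max V m (x : 'I_m -> V) v : rext x v ord_max = v.
Proof. by rewrite /rext unlift_none. Qed.

Lemma rext_lift V m (x : 'I_m -> V) v i :
  rext x v (fintype.lift ord_max i) = x i.
Proof. by rewrite /rext liftK. Qed.

Lemma tr_lfun (k : comNzRingType) (V : vectType k) (f : 'End(V)) :
  \tr (f2mx f) = \sum_i v2r (f (r2v (delta_mx 0 i))) 0 i.
Proof.
apply: eq_bigr => i _; rewrite unlock /= !r2vK -rowE mxE //.
Qed.

Lemma vect_sum (k : comNzRingType) (V : vectType k) (v : V) :
  v = \sum_i v2r v 0 i *: r2v (delta_mx 0 i).
Proof.
rewrite -{1}[v]v2rK {1}[v2r v]row_sum_delta linear_sum.
by apply: eq_bigr => i _; rewrite linearZ.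
Qed.

(** * Tensor products and partial traces under the embedding *)

Section Trace.

Variables (k : comNzRingType) (A : ribbonHopf k) (W : fMod A).
Local Notation B := (end_xc W).
Local Notation T s := (tens (@fmodl k A) s).
Local Notation pvW := (@pv k (fMod A) (@fmodl k A) W).
Local Notation H s := (hlist (@fmodl k A) s).

Definition tcatn m l (z : T (nseq m W)) (z' : T (nseq l W)) :
  T (nseq (m + l) W) :=
  ecast s (T s) (esym (nseqD m l W)) (tcat z z').

Lemma tcatn_heq m l (z : T (nseq m W)) (z' : T (nseq l W)) :
  heq (tcatn z z') (tcat z z').
Proof. by apply: heq_sym; exact: heq_cast. Qed.

Lemma tcatn_pv m l (x : 'I_m -> W) (y : 'I_l -> W) :
  tcatn (pvW x) (pvW y) = pvW (join x y).
Proof.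
apply: heq_eq; apply: heq_trans (tcatn_heq _ _) _; apply: heq_sym.
exact: (@tcat_pv k _ (@fmodl k A)).
Qed.

Lemma tcatn_linl m l (z' : T (nseq l W)) : linear (fun z :
  T (nseq m W) => tcatn z z').
Proof. by apply: (lin_comp (cast_linear _)); exact: tcat_linl. Qed.

Lemma tcatn_linr m l (z : T (nseq m W)) : linear (fun z' :
  T (nseq l W) => tcatn z z').
Proof. by apply: (lin_comp (cast_linear _)); exact: tcat_linr. Qed.

Definition tjoin (V : lmodType k) m l (t : tpow V m) (t' : tpow V l) :
    tpow V (m + l) :=
  tsum (fun u => tsum (fun v => tvec (join u v)) t') t.

Lemma join_multilin (V : lmodType k) m l :
  (forall v : 'I_l -> V, multilin (fun u : 'I_m -> V => tvec (join u v))) /\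
  (forall u : 'I_m -> V, multilin (fun v : 'I_l -> V => tvec (join u v))).
Proof.
split=> u; apply: (multilin_sub (@tvec_multilin _ _ _)) => j x.
  by exists (lshift l j), id; split=> // v; exact: join_updl.
by exists (rshift m j), id; split=> // v; exact: join_updr.
Qed.

Lemma tjoin_tvec (V : lmodType k) m l (u : 'I_m -> V) (v : 'I_l -> V) :
  tjoin (tvec u) (tvec v) = tvec (join u v).
Proof.
have [Jl Jr] := join_multilin V m l.
by rewrite /tjoin !tsum_tvec //; apply: multilin_sum => q.
Qed.

Lemma tjoin_linear (V : lmodType k) m l :
  (forall t' : tpow V l, linear (fun t : tpow V m => tjoin t t')) /\
  (forall t : tpow V m, linear (fun t' : tpow V l => tjoin t t')).
Proof.
have [Jl Jr] := join_multilin V m l; split=> t.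
  by apply: tsum_linear; apply: multilin_sum => q.
by apply: lin_sumf => q; exact: tsum_linear.
Qed.

Lemma iota_tjoin m l (x : elt B m) (y : elt B l) z z' :
  iota_elt ((tjoin x.1 y.1, block_perm x.2 y.2) : elt B (m + l)) (tcatn z z') =
  tcatn (iota_elt x z) (iota_elt y z').
Proof.
have [Tl Tr] := tjoin_linear B m l.
case: x y => [t s] [t' s'] /=.
move: t; apply: tpow_ext => [b u v|b u v|f].
- by rewrite -iota_linear_elt; congr iota_elt; congr pair; exact: Tl.
- by rewrite -tcatn_linl; congr tcatn; exact: iota_linear_elt.
move: t'; apply: tpow_ext => [b u v|b u v|g].
- by rewrite -iota_linear_elt; congr iota_elt; congr pair; exact: Tr.
- by rewrite -tcatn_linr; congr tcatn; exact: iota_linear_elt.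
rewrite tjoin_tvec.
move: z; apply: pow_ext => [b u v|b u v|x].
- by rewrite tcatn_linl; exact: iota_linear.
- by rewrite iota_linear; exact: tcatn_linl.
move: z'; apply: pow_ext => [b u v|b u v|y].
- by rewrite tcatn_linr; exact: iota_linear.
- by rewrite iota_linear; exact: tcatn_linr.
rewrite tcatn_pv !iota_pv tcatn_pv; apply: pv_ext => i.
by case: (split_ordP i) => j ->; rewrite ?block_permV_l ?block_permV_r
  ?joinl ?joinr.
Qed.

Definition push m (z : T (nseq m W)) (w : W) : T (nseq m.+1 W) :=
  lift (fun h : H (nseq m W) => pvW (rext (hnth h) w)) z.

Definition contr m (om : W -> k) (z : T (nseq m.+1 W)) : T (nseq m W) :=
  lift (fun h : H (nseq m.+1 W) => om (hnth h ord_max) *: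
    pvW (fun j => hnth h (fintype.lift ord_max j))) z.

(** The partial trace over the last factor, weighted by the balancing element: a sum over dual
    bases, where the contracting form is the coordinate composed with [bal A]. *)
Definition ptr m l (Phi : T (nseq m.+1 W) -> T (nseq l.+1 W)) (z :
  T (nseq m W)) :
    T (nseq l W) :=
  \sum_i contr (fun w : W => v2r (fmod_act W (bal A) w) 0 i)
           (Phi (push z (fbasis i))).

Lemma push_multilin m w : multilin (fun x : 'I_m -> fmodl W => pvW (rext x w)).
Proof.
apply: (multilin_sub (@pv_multilin _ _ _ _ _)) => j x.
exists (fintype.lift ord_max j), id; split=> // v i; rewrite /rext /upd.
case: unliftP => [j' ->|->]; first by rewrite (inj_eq lift_inj).
by rewrite (negPf (neq_lift _ _)).
Qed.

Lemma push_pv m (x : 'I_m -> W) w : push (pvW x) w = pvW (rext x w).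
Proof. exact: (@lift_pv _ _ (@fmodl k A) W _ m _ x (push_multilin w)). Qed.

Lemma push_linear m w : linear (fun z : T (nseq m W) => push z w).
Proof. exact: (@lin_lift_pv _ _ (@fmodl k A) W _ m _ (push_multilin w)). Qed.

Lemma contr_multilin m (om : W -> k) : linear (om : W -> k^o) ->
  multilin (fun x : 'I_m.+1 -> W =>
    om (x ord_max) *: pvW (fun j => x (fintype.lift ord_max j))).
Proof.
move=> Hom i x; case: (unliftP ord_max i) => [j|] -> b u v; rewrite /upd.
  rewrite (negPf (neq_lift _ _)).
  have := @pv_multilin k _ (@fmodl k A) W m j
    (fun j => x (fintype.lift ord_max j)) b u v.
  have E w : upd j w (fun j => x (fintype.lift ord_max j)) =
      (fun j0 => if fintype.lift ord_max j0 == fintype.lift ord_max j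
                 then w else x (fintype.lift ord_max j0)).
    by apply: funext => j0; rewrite /upd (inj_eq lift_inj).
  by rewrite !E => ->; rewrite scalerDr !scalerA mulrC.
have E w : pvW (fun j => if fintype.lift ord_max j == ord_max then w
    else x (fintype.lift ord_max j)) =
    pvW (fun j => x (fintype.lift ord_max j)).
  by apply: pv_ext => j; rewrite eq_sym (negPf (neq_lift _ _)).
by rewrite !E eqxx Hom scalerDl scalerA.
Qed.

Lemma contr_pv m (om : W -> k) (x : 'I_m.+1 -> W) : linear (om : W -> k^o) ->
  contr om (pvW x) =
  om (x ord_max) *: pvW (fun j => x (fintype.lift ord_max j)).
Proof.
by move=> Hom; exact: (@lift_pv _ _ (@fmodl k A) W _ _ _ x (contr_multilin
  Hom)).
Qed.

Lemma contr_linear m (om : W -> k) : linear (om : W -> k^o) ->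
  linear (contr om : T (nseq m.+1 W) -> T (nseq m W)).
Proof.
by move=> Hom; exact: (@lin_lift_pv _ _ (@fmodl k A) W _ _ _ (contr_multilin
  Hom)).
Qed.

Lemma coord_linear (f : 'End(W)) i :
  linear ((fun w : W => v2r (f w) 0 i) : W -> k^o).
Proof. by move=> b u v; rewrite !linearP !mxE. Qed.

Lemma ptr_linear m l (Phi : T (nseq m.+1 W) -> T (nseq l.+1 W)) :
  linear Phi -> linear (ptr Phi).
Proof.
move=> HP b u v; rewrite /ptr scaler_sumr -big_split; apply: eq_bigr => i _.
by rewrite push_linear HP (contr_linear (coord_linear _ i)).
Qed.

Definition phi1_fun m (s : 'S_m.+1) (u : 'I_m.+1 -> B) : tpow B m :=
  let j := (s^-1)%g ord_max in
  if j == ord_max then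
    xtr (xmul (xkap B) (u ord_max)) *:
      tvec (fun i : 'I_m => u (fintype.lift ord_max i))
  else
    tvec (fun i : 'I_m => let l := fintype.lift ord_max i in
      if l == j then xmul (u ord_max) (xmul (xkap B) (u j)) else u l).

Lemma phi1E m (x : elt B m.+1) :
  phi1 x = (tsum (phi1_fun x.2) x.1, del_perm x.2).
Proof. by []. Qed.

Lemma xtr_linear : linear (@xtr k B : B -> k^o).
Proof.
move=> b u v; rewrite /= !tr_lfun scaler_sumr -big_split; apply: eq_bigr => i _.
by rewrite add_lfunE scale_lfunE linearP !mxE.
Qed.

(** When the last index is not fixed, the entries at the last index and at [j] are composed in
    factor [j] and every other entry keeps its own factor, so [multilin_sub] applies. In the fixed
    case the last entry enters only through the trace. *)
Lemma phi1_multilin m (s : 'S_m.+1) : multilin (phi1_fun s).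
Proof.
rewrite /phi1_fun; case: eqP => [_ i x|/eqP ne].
  case: (unliftP ord_max i) => [j|] -> b u v; rewrite /upd.
    rewrite (negPf (neq_lift _ _)).
    have E w : upd j w (fun j => x (fintype.lift ord_max j)) =
        (fun j0 => if fintype.lift ord_max j0 == fintype.lift ord_max j
                   then w else x (fintype.lift ord_max j0)).
      by apply: funext => j0; rewrite /upd (inj_eq lift_inj).
    by rewrite -!E tvec_multilin scalerDr !scalerA mulrC.
  have E w : tvec (fun j => if fintype.lift ord_max j == ord_max then w
      else x (fintype.lift ord_max j)) =
      tvec (fun j => x (fintype.lift ord_max j)).
    by apply: tvec_ext => j; rewrite eq_sym (negPf (neq_lift _ _)).
  rewrite !E eqxx; have [_ Hr] := comp_bilin W.
  by rewrite Hr xtr_linear scalerDl scalerA.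
apply: (multilin_sub (@tvec_multilin _ _ _)) => i x.
have [Hl Hr] := comp_bilin W.
have [j1 ej] : exists j1, (s^-1)%g ord_max = fintype.lift ord_max j1.
  by case: (unliftP ord_max ((s^-1)%g ord_max)) ne => [j1 ->|->];
    [exists j1 | rewrite eqxx].
rewrite ej /upd; case: (unliftP ord_max i) => [i'|] ->.
  case: (eqVneq i' j1) => [->|ni].
    exists j1, (fun v => xmul (x ord_max) (xmul (xkap B) v)).
    split=> [|v l]; first exact: (lin_comp (Hr _) (Hr _)).
    rewrite (inj_eq lift_inj) (negPf (neq_lift _ _)) eqxx.
    by case: ifP => // ->.
  exists i', id; split=> // v l; rewrite !(inj_eq lift_inj).
  rewrite (negPf (neq_lift _ _)) [j1 == _]eq_sym (negPf ni).
  case: (eqVneq l j1) => // ->; by rewrite eq_sym (negPf ni).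
exists j1, (fun v => xmul v (xmul (xkap B) (x (fintype.lift ord_max j1)))).
split=> [|v l]; first exact: Hl.
rewrite eqxx !(inj_eq lift_inj) ![_ == ord_max]eq_sym !(negPf (neq_lift _ _)).
by case: ifP.
Qed.

(** On pure tensors the sum over the basis either computes a trace, when the last index is fixed, or
    expands a vector in coordinates and reassembles it, which composes [f ord_max], [kap] and
    [f j]. *)
Lemma ptr_iota m (x : elt B m.+1) (z : T (nseq m W)) :
  ptr (iota_elt x) z = iota_elt (phi1 x) z.
Proof.
rewrite phi1E; case: x => t s /=.
move: t; apply: tpow_ext => [b u v|b u v|f].
- rewrite /ptr scaler_sumr -big_split; apply: eq_bigr => i _ /=.
  rewrite -(contr_linear (coord_linear _ i)); congr contr.
  exact: iota_linear_elt.
- rewrite -iota_linear_elt; congr iota_elt; congr pair.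
  exact: (tsum_linear (phi1_multilin s)).
rewrite tsum_tvec; last exact: phi1_multilin.
move: z; apply: pow_ext => [||w].
- exact/ptr_linear/iota_linear.
- exact: iota_linear.
pose kap := fmod_act W (bal A).
pose base l := let i := ((del_perm s)^-1)%g l in
  f (fintype.lift ord_max i) (w i).
have L l : let i := ((del_perm s)^-1)%g l in
    fintype.lift ord_max l = if s (fintype.lift ord_max i) == ord_max
      then s ord_max else s (fintype.lift ord_max i).
  by rewrite /= -lift_del_perm permKV.
rewrite /ptr /phi1_fun.
under eq_bigr => i _.
  rewrite push_pv iota_pv (contr_pv _ (coord_linear _ i)).
  over.
(* Deleting the last index short-circuits it: an output factor comes from index [i] under both
   permutations, except when [s] sends [i] to the last index; then under [s] it comes from the last
   index. *)
have sV l : let i := ((del_perm s)^-1)%g l in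
    (s^-1)%g (fintype.lift ord_max l) =
    if fintype.lift ord_max i == (s^-1)%g ord_max then ord_max
    else fintype.lift ord_max i.
  have /= := L l; set i := ((del_perm s)^-1)%g l => ->.
  rewrite -[X in _ = if X then _ else _](inj_eq (@perm_inj _ s)) permKV.
  by case: ifP => _; rewrite permK.
case: eqP => [j_max|/eqP j_ne].
  rewrite (lin_scale _ _ (iota_linear_elt (del_perm s) (pvW w))) iota_pv.
  rewrite /= tr_lfun scaler_suml; apply: eq_bigr => i _.
  rewrite j_max rext_max comp_lfunE; congr (_ *: _); apply: pv_ext => l.
  by rewrite sV j_max eq_sym (negPf (neq_lift _ _)) rext_lift.
have [j ej] : exists j, (s^-1)%g ord_max = fintype.lift ord_max j.
  by case: (unliftP ord_max ((s^-1)%g ord_max)) j_ne => [j ->|->];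
    [exists j | rewrite eqxx].
rewrite iota_pv ej; pose l0 := del_perm s j.
(* Only the factor [l0] depends on the basis vector, so linearity there moves the sum inside, where
   [vect_sum] evaluates it. *)
have Lg := @pv_multilin k _ (@fmodl k A) W m l0 base.
transitivity (\sum_i v2r (kap (f (fintype.lift ord_max j) (w j))) 0 i *:
    pvW (upd l0 (f ord_max (fbasis i)) base)).
  apply: eq_bigr => i _; rewrite rext_lift; congr (_ *: _).
  apply: pv_ext => l; rewrite sV ej /upd (inj_eq lift_inj) /l0.
  rewrite -(inj_eq (@perm_inj _ (del_perm s)^-1%g) l) permK.
  by case: eqP => _; rewrite ?rext_max ?rext_lift.
rewrite -(lin_comb _ _ _ Lg) -(lin_comb _ _ _ (linearP (f ord_max))).
rewrite -vect_sum; apply: pv_ext => l; rewrite /upd /l0.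
rewrite (inj_eq lift_inj) -(inj_eq (@perm_inj _ (del_perm s)^-1%g) l) permK.
by case: eqP => [->|_] //; rewrite /= !comp_lfunE.
Qed.

End Trace.

(** * Comparison of the two functors *)

Section TensorMaps.
Variables (k : comNzRingType) (X : Type) (c : X -> lmodType k).
Local Notation H s := (@hlist k X c s).
Local Notation T s := (@tens k X c s).

Lemma mlin_cat s t (M : lmodType k) (f : H s -> H t -> M) :
  (forall h', mlin (fun h => f h h')) -> (forall h, mlin (f h)) ->
  mlin (fun h : H (s ++ t) => f (htake h) (hdrop h)).
Proof.
elim: s f => [|a s IH] f H1 H2 /=; first exact: H2.
split=> [h|v]; first by case: (H1 (hdrop h)) => + _; apply.
apply: (IH (fun h h' => f (v, h) h')) => [h'|h]; last exact: H2.
by case: (H1 h') => _ /(_ v).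
Qed.

(** Pushes a linear map through a sum known only up to [heq], so that the sum over dual bases can be
    followed from the cup to the cap. *)
Lemma heq_lin s t r q I (l : seq I) (G : T s -> T t) y (Y : I -> T r) (Z :
  I -> T q) :
  linear G -> heq y (\sum_(i <- l) Y i) -> t = q ->
  (forall i y', heq y' (Y i) -> heq (G y') (Z i)) ->
  heq (G y) (\sum_(i <- l) Z i).
Proof.
move=> HG Ey etq; case: _ / etq Z => Z E.
have [esr _] := Ey; case: _ / esr Y Ey E => Y /heq_eq -> E.
rewrite lin_sum //; have -> : Z = (fun i => G (Y i)); last exact: heq_refl.
by apply: funext => i; apply/esym/heq_eq/E/heq_refl.
Qed.

End TensorMaps.

(** * The structure maps of the module category on small tensors *)

Section Actions.

Variables (k : comNzRingType) (A : ribbonHopf k).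
Local Notation T s := (tens (@fmodl k A) s).
Local Notation H s := (hlist (@fmodl k A) s).

Lemma castm_heq s s' t t' (es : s = s') (et : t = t')
    (f : T s -> T t) (x : T s) (x' : T s') :
  heq x' x -> heq (castm (H := @arr (FModStr A)) es et f x') (f x).
Proof.
case: _ / es x' => x' /heq_eq ->; case: _ / et; exact: heq_refl.
Qed.

Lemma tarr_tcat s t s' t' (f : T s -> T s') (g : T t -> T t') x y :
  linear f -> linear g ->
  @tarr (FModStr A) s s' t t' f g (tcat x y) = tcat (f x) (g y).
Proof.
move=> Hf Hg; rewrite /=.
have M : mlin (fun h : H (s ++ t) =>
    tcat (f (pure (htake h))) (g (pure (hdrop h)))).
  apply: (mlin_cat (f := fun h h' => tcat (f (pure h)) (g (pure h')))) => h.
    apply: (mlin_comp (g := fun x => tcat (f x) (g (pure h)))).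
      exact: (lin_comp (tcat_linl _) Hf).
    exact: pure_mlin.
  apply: (mlin_comp (g := fun x => tcat (f (pure h)) (g x))).
    exact: (lin_comp (tcat_linr _) Hg).
  exact: pure_mlin.
have LM := lift_linear M.
move: x; apply: tens_ext => [b u v|b u v|h].
- by rewrite tcat_linl LM.
- by rewrite Hf tcat_linl.
move: y; apply: tens_ext => [b u v|b u v|h'].
- by rewrite tcat_linr LM.
- by rewrite Hg tcat_linr.
by rewrite tcat_pure lift_pure // htake_hcat hdrop_hcat.
Qed.

Lemma tcons_linr (V : fMod A) s (v : V) : linear (@tcons k A V s v).
Proof.
by apply: lift_linear; case: (@pure_mlin k _ (@fmodl k A) (V :: s)) => _ /(_ v).
Qed.

Lemma tcons_linl (V : fMod A) s (x : T s) : linear (fun v : V => tcons v x).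
Proof.
apply: lin_lift_param => h.
by case: (@pure_mlin k _ (@fmodl k A) (V :: s)) => /(_ h).
Qed.

Lemma hact_mlin s a : mlin (@hact k A s a).
Proof.
elim: s a => //= V s IH a; split=> [h|v].
  apply: lin_sumf => q b u v; rewrite -tcons_linl; congr tcons; exact: linearP.
apply: mlin_sum => q; apply: mlin_comp (tcons_linr _) _; exact: IH.
Qed.

Lemma tact_linear s a : linear (@tact k A s a).
Proof. exact/lift_linear/hact_mlin. Qed.

Definition vec1 (V : fMod A) (v : V) : T [:: V] := pure ((v, tt) : H [:: V]).
Definition vec2 (V V' : fMod A) (v : V) (v' : V') : T [:: V; V'] :=
  pure ((v, (v', tt)) : H [:: V; V']).

Lemma tcat_vec1 (V V' : fMod A) (v : V) (v' : V') :
  tcat (vec1 v) (vec1 v') = vec2 v v'.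
Proof. by rewrite tcat_pure. Qed.

Lemma vec1_linear (V : fMod A) : linear (@vec1 V).
Proof. by case: (@pure_mlin k _ (@fmodl k A) [:: V]) => H1 _; exact: H1. Qed.

Lemma vec2_bilin (V V' : fMod A) :
  (forall v', linear (fun v : V => vec2 v v' : T [:: V; V'])) /\
  (forall v, linear (fun v' : V' => vec2 v v' : T [:: V; V'])).
Proof.
case: (@pure_mlin k _ (@fmodl k A) [:: V; V']) => H1 H2.
by split=> v; [exact: H1 | case: (H2 v) => H3 _; exact: H3].
Qed.

Lemma act_linear (V : fMod A) (v : V) : linear (fun a : A => fmod_act V a v).
Proof. by move=> b u w; rewrite linearP add_lfunE scale_lfunE. Qed.

(** [hact] splits off the empty tail with a coproduct and lets the second leg act there by the
    counit; the counit axiom restores [a]. *)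
Lemma tact_vec1 (V : fMod A) a (v : V) : tact a (vec1 v) = vec1 (fmod_act V a
  v).
Proof.
rewrite /tact lift_pure; last exact: hact_mlin.
rewrite -{2}(cou_r a) /=.
rewrite (linear_tsum2 _ _ (lin_comp (@vec1_linear V) (act_linear v))).
apply: eq_tsum2 => a1 a2; rewrite (lin_scale _ _ (tcons_linr _)).
rewrite (lin_scale _ _ (act_linear v)) (lin_scale _ _ (@vec1_linear V)).
congr (_ *: _); rewrite /tcons lift_pure //.
Qed.

Lemma fbraid_tcat s t (x : T s) (y : T t) :
  @fbraid k A s t (tcat x y) =
  tsum2 (fun a b : A => tcat (tact b y) (tact a x)) (Rmx A).
Proof.
have M : mlin (fun h : H (s ++ t) => tsum2 (fun a b : A =>
    tcat (tact b (pure (hdrop h))) (tact a (pure (htake h)))) (Rmx A)).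
  apply: (mlin_cat (f := fun h h' => tsum2 (fun a b : A =>
    tcat (tact b (pure h')) (tact a (pure h))) (Rmx A))) => h;
    apply: mlin_sum => q.
    apply: (mlin_comp (g := fun x => tcat (tact _ (pure h)) (tact _ x))).
      exact: (lin_comp (tcat_linr _) (@tact_linear _ _)).
    exact: pure_mlin.
  apply: (mlin_comp (g := fun x => tcat (tact _ x) (tact _ (pure h)))).
    exact: (lin_comp (tcat_linl _) (@tact_linear _ _)).
  exact: pure_mlin.
have LM := lift_linear M.
move: x; apply: tens_ext => [b u v|b u v|h].
- by rewrite tcat_linl; exact: LM.
- rewrite /tsum2 /lift /ev scaler_sumr -big_split; apply: eq_bigr => q _.
  by rewrite tact_linear tcat_linr scalerDr !scalerA mulrC.
move: y; apply: tens_ext => [b u v|b u v|h'].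
- by rewrite tcat_linr; exact: LM.
- rewrite /tsum2 /lift /ev scaler_sumr -big_split; apply: eq_bigr => q _.
  by rewrite tact_linear tcat_linl scalerDr !scalerA mulrC.
by rewrite tcat_pure /fbraid lift_pure // htake_hcat hdrop_hcat.
Qed.

Lemma fbraid_vec (V V' : fMod A) (v : V) (v' : V') :
  @fbraid k A [:: V] [:: V'] (vec2 v v') =
  tsum2 (fun a b : A => vec2 (fmod_act V' b v') (fmod_act V a v)) (Rmx A).
Proof.
rewrite -tcat_vec1 fbraid_tcat.
by apply: eq_tsum2 => a b; rewrite !tact_vec1 tcat_vec1.
Qed.

Variable W : fMod A.

Lemma fev_vec (om : dual W) (w : W) :
  fev (vec2 om w) = ((om : 'Hom(W, k^o)) w : k) *: pure (tt : H [::]).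
Proof.
rewrite /fev lift_pure //; split=> [h|om'] /=.
  by move=> b u v; rewrite add_lfunE scale_lfunE scalerDl scalerA.
by split=> // h b u v; rewrite linearP scalerDl scalerA.
Qed.

(* [u v^-1 = kappa] since [v = kappa^-1 u]. *)
Lemma evr_vec (w : W) (om : dual W) :
  fev (@fbraid k A [:: W] [:: dual W]
         (vec2 (fmod_act W (ribbon_elt_inv A) w) om)) =
  ((om : 'Hom(W, k^o)) (fmod_act W (bal A) w) : k) *: pure (tt : H [::]).
Proof.
have Lev : linear (@fev k A W).
  apply: lift_linear; split=> [h|om'] /=.
    by move=> b u v; rewrite add_lfunE scale_lfunE scalerDl scalerA.
  by split=> // h b u v; rewrite linearP scalerDl scalerA.
rewrite fbraid_vec (linear_tsum2 _ _ Lev).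
transitivity (tsum2 (fun a b : A =>
    ((om : 'Hom(W, k^o)) (fmod_act W (antip A b * a * ribbon_elt_inv A) w) : k)
      *: pure (tt : H [::])) (Rmx A)).
  apply: eq_tsum2 => a b; rewrite fev_vec dual_actE.
  by rewrite !fmod_actM !comp_lfunE.
have L : linear (fun x : A =>
    ((om : 'Hom(W, k^o)) (fmod_act W (x * ribbon_elt_inv A) w) : k)
      *: pure (tt : H [::])).
  move=> b u v; rewrite mulrDl -scalerAl linearP add_lfunE scale_lfunE.
  by rewrite linearP scalerDl scalerA.
rewrite -(linear_tsum2 _ _ L) -/(drin A) /ribbon_elt_inv mulrA drin_mulV mul1r
  //.
Qed.

End Actions.

(** * Agreement on generators and its stability *)

Section Agreement.

Variables (k : comNzRingType) (A : ribbonHopf k) (W : fMod A).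
Local Notation B := (end_xc W).
Local Notation T s := (tens (@fmodl k A) s).
Local Notation H s := (hlist (@fmodl k A) s).
Local Notation pvW := (@pv k (fMod A) (@fmodl k A) W).
Local Notation sg := (map (sgn_mod W)).
Local Notation unitT := (pure (tt : H [::])).

Lemma iota_cast m m' (e : m = m') (x : elt B m) (w : T (nseq m' W))
    (w0 : T (nseq m W)) :
  heq w w0 -> heq (iota_elt (ecast z (elt B z) e x) w) (iota_elt x w0).
Proof. by case: _ / e w => w /heq_eq ->; exact: heq_refl. Qed.

Lemma rext_ord0 (V : Type) m (x : 'I_m.+1 -> V) v : rext x v ord0 = x ord0.
Proof.
by rewrite -(rext_lift x v); congr (rext _ _ _); apply: val_inj;
  rewrite /= /bump leqn0.
Qed.

Lemma rext_liftS (V : Type) m (x : 'I_m.+1 -> V) v i :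
  rext x v (fintype.lift ord0 i) = rext (fun j => x (fintype.lift ord0 j)) v i.
Proof.
case: (unliftP ord_max i) => [j|] ->.
  rewrite rext_lift -(rext_lift x v); congr (rext _ _ _); apply: val_inj.
  by rewrite /= /bump !leq0n ltnS add1n addnS.
transitivity (rext x v ord_max); last by rewrite !rext_max.
by congr (rext _ _ _); apply: val_inj.
Qed.

Lemma hcat_rext m (e : nseq m W ++ [:: W] = nseq m.+1 W) (x : 'I_m -> W) (w :
  W) :
  ecast z (H z) e (hcat (hmk (@fmodl k A) W x) ((w, tt) : H [:: W])) =
  hmk (@fmodl k A) W (rext x w).
Proof.
elim: m e x => [|m IH] e x.
  rewrite (Prop_irrelevance e erefl) /=; congr pair.
  transitivity (rext x w ord_max); first by rewrite rext_max.
  by congr (rext _ _ _); apply: val_inj.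
have e' : nseq m W ++ [:: W] = nseq m.+1 W by case: e.
rewrite (hcast_cons e' e) IH [RHS]/=; congr pair; first by rewrite rext_ord0.
transitivity (hmk (@fmodl k A) W
  (fun i : 'I_m.+1 => rext x w (fintype.lift ord0 i))) => //.
by apply: (@hmk_ext k _ (@fmodl k A) W m.+1) => i; rewrite rext_liftS.
Qed.

Lemma push_heq m (z : T (nseq m W)) (w : W) : heq (push z w) (tcat z (vec1 w)).
Proof.
have e : nseq m W ++ [:: W] = nseq m.+1 W.
  by elim: m {z} => //= m ->.
apply: heq_sym; exists e; move: z.
apply: pow_ext => [||x].
- by apply: (lin_comp (cast_linear _)); exact: tcat_linl.
- exact: push_linear.
by rewrite push_pv tcat_pure pure_cast hcat_rext.
Qed.

(** [F] and [Z] stand for the two functors after transport to the computed objects. Stating only the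
    laws needed, with [heq] for tensor products and braidings, keeps the casts of the actual
    functors out of the argument. *)
Variables
  (F : forall a b, tangle a b -> T (sg a) -> T (sg b))
  (F_teq : forall a b (f g : tangle a b), teq f g -> F f =1 F g)
  (F_lin : forall a b (f : tangle a b), linear (F f))
  (F_id : forall a, F (Tid a) =1 id)
  (F_cmp : forall a b c (g : tangle b c) (f : tangle a b) x,
     F (Tcmp g f) x = F g (F f x))
  (F_ten : forall a b c d (f : tangle a b) (g : tangle c d) x y z,
     heq z (tcat x y) -> heq (F (Tten f g) z) (tcat (F f x) (F g y)))
  (F_br : forall a b x y, heq x y ->
     heq (F (Tbr a b) x) (@fbraid k A (sg a) (sg b) y))
  (F_tw : forall a, F (Ttw a) =1 @ftwist k A (sg a))
  (F_ev : F Tev =1 @fev k A W)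
  (F_coev : F Tcoev =1 @fcoev k A W)
  (Z : forall m l, tangle (plus m) (plus l) -> earr B m l)
  (Z_teq : forall m l (f g : tangle (plus m) (plus l)), teq f g -> Z f = Z g)
  (Z_id : forall m, Z (Tid (plus m)) = EArr erefl (elt1 B m))
  (Z_cmp : forall m l q (g : tangle (plus l) (plus q))
     (f : tangle (plus m) (plus l)), Z (Tcmp g f) = ecmp (Z g) (Z f))
  (Z_ten : forall m l m' l' (f : tangle (plus m) (plus l))
     (g : tangle (plus m') (plus l')),
     @Z (m + m') (l + l') (@tarr Tplus m l m' l' f g) = eten (Z f) (Z g))
  (Z_br : @Z 2 2 (Tbr [:: true] [:: true]) = ebraid11 B)
  (Z_tr : forall m l (f : tangle (plus (m + 1)) (plus (l + 1))),
     Z (Ttr f) = etr (Z f)).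

Definition agree m l (f : tangle (plus m) (plus l)) :=
  forall x x', heq x x' -> heq (F f x') (iota_elt (earr_el (Z f)) x).

Lemma F_cast a b a' b' (ea : a = a') (eb : b = b') (f : tangle a b) x x' :
  heq x' x -> heq (F (castT ea eb f) x') (F f x).
Proof. by case: _ / ea x'; case: _ / eb => x' /heq_eq ->; exact: heq_refl. Qed.

Lemma agree_teq m l (f g : tangle (plus m) (plus l)) :
  teq f g -> agree f -> agree g.
Proof. by move=> E Hf x x' Ex; rewrite -(F_teq E) -(Z_teq E); exact: Hf. Qed.

Lemma agree_id m : agree (Tid (plus m)).
Proof. by move=> x x' E; rewrite F_id Z_id iota_elt1; exact: heq_sym. Qed.

Lemma iota_ecmp m l q (g : earr B l q) (f : earr B m l) x y :
  heq (iota_elt (earr_el f) x) y ->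
  heq (iota_elt (earr_el g) y) (iota_elt (earr_el (ecmp g f)) x).
Proof.
case: f => e f; case: _ / e g y => -[e g] y /heq_eq <-.
by rewrite /= iota_emul; exact: heq_refl.
Qed.

Lemma agree_cmp m l q (g : tangle (plus l) (plus q))
  (f : tangle (plus m) (plus l)) : agree g -> agree f -> agree (Tcmp g f).
Proof.
move=> Hg Hf x x' E; rewrite F_cmp Z_cmp.
have Ef := Hf _ _ E.
have e : nseq m W = nseq l W by rewrite (earr_eq (Z f)).
apply: heq_trans (Hg (ecast z (T z) e (iota_elt (earr_el (Z f)) x)) _ _) _.
  by apply: heq_sym; apply: heq_trans Ef _; exact: heq_cast.
by apply: iota_ecmp; exact: heq_cast.
Qed.

Lemma sg_plus m : sg (plus m) = nseq m W.
Proof. by rewrite map_nseq. Qed.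

Lemma agree_ten m l m' l' (f : tangle (plus m) (plus l))
    (g : tangle (plus m') (plus l')) :
  agree f -> agree g -> @agree (m + m') (l + l') (@tarr Tplus m l m' l' f g).
Proof.
move=> Hf Hg; rewrite /agree Z_ten; apply: heq_ext.
- exact: F_lin.
- exact: iota_linear.
- by rewrite sg_plus (earr_eq (Z f)) (earr_eq (Z g)).
move=> h x'; rewrite pure_pv => E; set y := hnth h in E *.
pose y1 j := y (lshift m' j); pose y2 j := y (rshift m j).
have Ey : pvW y = pvW (join y1 y2).
  by apply: pv_ext => i; case: (split_ordP i) => j ->; rewrite ?joinl ?joinr.
have [x1 E1] := heq_ex (pvW y1) (esym (sg_plus m)).
have [x2 E2] := heq_ex (pvW y2) (esym (sg_plus m')).
have [z Ez] := heq_ex x' (congr1 sg (plusD m m')).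
apply: heq_trans (F_cast _ _ _ Ez) _.
have Ez' : heq z (tcat x1 x2).
  apply: heq_trans (heq_sym Ez) _; apply: heq_trans (heq_sym E) _.
  by rewrite Ey; apply: heq_trans (tcat_pv _ _) _; exact: heq_tcat.
apply: heq_trans (F_ten _ _ Ez') _.
rewrite Ey -tcatn_pv; apply: heq_sym.
rewrite [X in heq X](iota_tjoin (earr_el (Z f)) (earr_el (Z g))).
apply: heq_trans (tcatn_heq _ _) _; apply: heq_tcat; apply: heq_sym.
  exact: Hf.
exact: Hg.
Qed.

Lemma pv2 (x : 'I_2 -> W) : pvW x = vec2 (x ord0) (x ord_max).
Proof.
by rewrite /pv /vec2 /= (_ : fintype.lift ord0 ord0 = ord_max) //;
  exact: val_inj.
Qed.

Lemma iota_Rhat (x : 'I_2 -> W) :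
  iota_elt (Rhat B ord0 ord_max) (pvW x) =
  tsum2 (fun a b : A => vec2 (fmod_act W b (x ord_max)) (fmod_act W a (x ord0)))
    (Rmx A).
Proof.
pose s := tperm (ord0 : 'I_2) ord_max.
have L := iota_linear_elt s (pvW x).
rewrite /Rhat (linear_tsum2 _ _ L) /=.
have [Vl Vr] := vec2_bilin W W.
pose Fn (f g : 'End(W)) : T [:: W; W] := vec2 (g (x ord_max)) (f (x ord0)).
have bF : @bilin k B _ Fn.
  split=> [g|f]; first exact: (lin_comp (Vr _) (@lfun_eval_linear _ _ W (x
    ord0))).
  exact: (lin_comp (Vl _) (@lfun_eval_linear _ _ W (x ord_max))).
transitivity (@tsum2 k B _ Fn (xR B)).
  by apply: eq_tsum2 => f g; rewrite iota_pv pv2 /Fn tpermV tpermL tpermR /=.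
have E := @linear_tsum2 k A (tpow B 2) (T [:: W; W]) (@tsum2 k B _ Fn)
  (fun a b : A => @ten2 k B (fmod_act W a) (fmod_act W b)) (Rmx A)
  (tsum2_linear bF).
apply: (etrans E).
by apply: eq_tsum2 => a b; rewrite tsum2_ten2.
Qed.

Lemma agree_br : @agree 2 2 (Tbr [:: true] [:: true]).
Proof.
rewrite /agree Z_br; apply: (heq_ext (s' := nseq 2 W) (t' := nseq 2 W)) => //.
  exact: iota_linear.
move=> h x'; rewrite pure_pv => /heq_sym E.
apply: heq_trans (@F_br [:: true] [:: true] _ _ E) _;
  rewrite iota_Rhat pv2 fbraid_vec.
exact: heq_refl.
Qed.

(** The value on an inverse is forced: [Z] makes it a right inverse of the image of the crossing,
    [F] a left inverse, and the images of the crossing agree. *)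
Lemma agree_brV : @agree 2 2 (TbrV [:: true] [:: true]).
Proof.
move=> x x' E; set y := iota_elt _ x.
have [y' Ey] := heq_ex y (erefl : nseq 2 W = sg [:: true; true]).
have : heq (iota_elt (earr_el (@Z 2 2 (Tbr [:: true] [:: true]))) y) x.
  apply: heq_trans (iota_ecmp _ (heq_refl _)) _.
  rewrite -(@Z_cmp 2 2 2) (@Z_teq 2 2 _ _ (teq_Vbr [:: true] [::
    true])) (Z_id 2) iota_elt1.
  exact: heq_refl.
move=> E2; have /heq_eq Ex := heq_trans (agree_br Ey) (heq_trans E2 E).
apply: heq_trans (heq_sym Ey); rewrite -Ex -F_cmp (F_teq (teq_brV [:: true] [::
  true])) F_id.
exact: heq_refl.
Qed.

Lemma F_evr (v : W) (om : dual W) :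
  F Tevr (vec2 v om) = ((om : 'Hom(W, k^o)) (fmod_act W (bal A) v) : k) *:
    unitT.
Proof.
rewrite /Tevr !F_cmp.
have E : F (Tten (Ttw [:: true]) (Tid [:: false])) (vec2 v om) =
    vec2 (fmod_act W (ribbon_elt_inv A) v) om.
  have Ez : heq (vec2 v om) (tcat (vec1 v) (vec1 om)).
    by rewrite tcat_vec1; exact: heq_refl.
  rewrite (heq_eq (@F_ten [:: true] [:: true] [:: false] [:: false] _ _
    (vec1 v) (vec1 om) _ Ez)) F_tw F_id /ftwist tact_vec1.
  exact: tcat_vec1.
by rewrite E (heq_eq (@F_br [:: true] [:: false] _ _ (heq_refl _))) F_ev
  evr_vec.
Qed.

Lemma F_cap m (w : T (nseq m.+1 W)) (om : dual W) y :
  heq y (tcat w (vec1 om)) ->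
  heq (F (Tten (Tid (plus m)) Tevr) y)
    (contr (fun v => (om : 'Hom(W, k^o)) (fmod_act W (bal A) v)) w).
Proof.
have Lom : linear ((fun v => (om : 'Hom(W, k^o)) (fmod_act W (bal A) v)) :
  W -> k^o).
  by move=> b u v; rewrite !linearP.
have e : nseq m.+1 W ++ [:: dual W] = sg (plus m ++ [:: true; false]).
  rewrite map_cat sg_plus /= -[RHS]/(nseq m W ++ [:: W; dual W]).
  by elim: (m) => //= q ->.
have e2 : sg (plus m ++ [::]) = nseq m W by rewrite cats0 sg_plus.
(* Writing [y] as a linear function of [w] reduces the claim to pure tensors [w]. *)
move=> Ey; have -> : y = ecast z (T z) e (tcat w (vec1 om)).
  by apply/heq_eq/(heq_trans Ey)/heq_cast.
exists e2; move: w {y Ey}; apply: pow_ext.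
- apply: (lin_comp (cast_linear e2)); apply: (lin_comp (@F_lin _ _ _)).
  apply: (lin_comp (cast_linear e)); exact: tcat_linl.
- exact: contr_linear.
move=> x; rewrite contr_pv //; apply: heq_eq.
apply: heq_trans (heq_sym (heq_cast _ _)) _.
set x1 := fun j => x (fintype.lift ord_max j); set v := x ord_max.
have Ex : pvW x = push (pvW x1) v.
  rewrite push_pv; apply: pv_ext => i; rewrite /rext.
  by case: unliftP => [j ->|->].
have [z Ez] := heq_ex (pvW x1) (esym (sg_plus m)).
apply: heq_trans (@F_ten (plus m) (plus m) [:: true; false] [::] _ _ z
  (vec2 v om) _ _) _.
  apply: heq_trans (heq_sym (heq_cast _ _)) _; rewrite Ex.
  apply: heq_trans (heq_tcat (push_heq _ _) (heq_refl _)) _.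
  apply: heq_trans (heq_sym (tcatA _ _ _)) _; rewrite tcat_vec1.
  exact: heq_tcat Ez (heq_refl _).
rewrite F_id F_evr (lin_scale _ _ (tcat_linr _)); apply: heq_scale.
by apply: heq_trans (tcat1 _ _) (heq_sym Ez).
Qed.

Lemma F_cup m (x : T (nseq m W)) y : heq x y ->
  heq (F (Tten (Tid (plus m)) Tcoev) y)
    (\sum_i tcat (push x (fbasis i)) (vec1 (fcoord i))).
Proof.
move=> E; have [z Ez] := heq_ex x (esym (sg_plus m)).
apply: heq_trans (@F_ten (plus m) (plus m) [::] [:: true; false] _ _ z
  unitT _ _) _.
  apply: heq_trans (heq_sym E) _; apply: heq_trans Ez _.
  exact: heq_sym (tcat1 _ _).
rewrite F_id F_coev /fcoev lift_pure // (lin_sum _ _ (tcat_linr _)).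
apply: heq_sum => [|i].
  by rewrite sg_plus -[RHS]/(nseq m.+1 W ++ [:: dual W]); elim: (m) => //= q ->.
rewrite -[pure _]/(vec2 (fbasis i) (fcoord i)) -tcat_vec1.
apply: heq_trans (@tcatA k _ (@fmodl k A) _ [:: W] [:: dual W] z _ _) _.
apply: heq_tcat (heq_refl _); apply: heq_sym; apply: heq_trans (push_heq _ _) _.
exact: heq_tcat Ez (heq_refl _).
Qed.

Lemma fcoordE i (w : W) : (fcoord i : 'Hom(W, k^o)) w = v2r w 0 i.
Proof.
have L : linear ((fun w : W => v2r w 0 i) : W -> k^o).
  by move=> b u v; rewrite linearP !mxE.
pose g : {linear W -> k^o} := HB.pack (fun w : W => v2r w 0 i : k^o)
  (GRing.isLinear.Build k W k^o *:%R _ L).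
exact: (lfunE g).
Qed.

(** Following a tensor through the cup, [f] and the cap produces the terms of [ptr], and [ptr_iota]
    turns this into [phi1]. The index [m + 0] comes from the last step of the recursions defining
    [Ttr] and [phi]. *)
Lemma agree_tr m l (f : tangle (plus (m + 1)) (plus (l + 1))) :
  agree f -> agree (Ttr f).
Proof.
have [e] : l = m by have := earr_eq (Z f); rewrite !addn1 => -[].
subst l => Hf x x' E; rewrite Z_tr.
have [x0 E0] := heq_ex x (congr1 (fun q => nseq q W) (esym (addn0 m))).
set y := earr_el (Z f).
pose y' : elt B (m + 0).+1 := ecast z (elt B z) (addnS m 0) y.
have -> : earr_el (etr (Z f)) = ecast z (elt B z) (addn0 m) (phi1 y') by [].
apply: heq_trans (heq_sym (iota_cast _ _ E0)); rewrite -ptr_iota.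
have Hy w w' : heq w w' -> heq (F f w') (iota_elt y' w).
  move=> Ew; have [w0 Ew0] := heq_ex w (congr1 (fun q => nseq q W) (esym (addnS
    m 0))).
  apply: heq_trans (Hf _ _ (heq_trans (heq_sym Ew0) Ew)) _; apply: heq_sym.
  exact: iota_cast.
have [x1 E1] := heq_ex x' (congr1 (fun q => sg (plus q)) (esym (addn0 m))).
rewrite /Ttr; apply: heq_trans (F_cast _ _ _ E1) _.
rewrite /Tclose !F_cmp; set a := plus (m + 0).
have Ex1 : heq x0 x1.
  by apply: heq_trans (heq_sym E0) _; apply: heq_trans E E1.
have S1 : heq (F (castT (cats0 a) erefl (Tten (Tid a) Tcoev)) x1)
    (\sum_i tcat (push x0 (fbasis i)) (vec1 (fcoord i))).
  have [x2 E2] := heq_ex x1 (congr1 sg (esym (cats0 a))).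
  apply: heq_trans (F_cast _ _ _ E2) _; apply: F_cup.
  exact: heq_trans Ex1 E2.
have ea : sg (a ++ [:: true; false]) = nseq (m + 0).+1 W ++ [:: dual W].
  by rewrite map_cat sg_plus; elim: (m + 0)%N => //= q ->.
have S2 := heq_lin (F_lin _) S1 ea
  (Z := fun i => tcat (iota_elt y' (push x0 (fbasis i))) (vec1 (fcoord i))).
apply: heq_lin (F_lin _) (S2 _ _) _ _.
- move=> i z Ez.
  have [z1 Ez1] := heq_ex z (congr1 sg (catA a [:: true] [:: false])).
  have [q Eq] : exists q : T (sg (a ++ [:: true])), heq (push x0 (fbasis i)) q.
    by apply: heq_ex; rewrite map_cat sg_plus; elim: (m + 0)%N => //= r ->.
  apply: heq_trans (F_cast _ _ _ Ez1) _.
  apply: heq_trans (@F_ten (a ++ [:: true]) (a ++ [:: true])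
    [:: false] [:: false] _ _ q (vec1 (fcoord i)) _ _) _.
    apply: heq_trans (heq_sym Ez1) _; apply: heq_trans Ez _.
    exact: heq_tcat Eq (heq_refl _).
  rewrite F_id; apply: heq_tcat (heq_refl _).
  have [q' Eq'] := heq_ex q (congr1 sg (esym (plusSr m 0))).
  apply: heq_trans (F_cast _ _ _ Eq') _; apply: Hy.
  exact: heq_trans Eq Eq'.
- by rewrite sg_plus.
move=> i z Ez.
apply: heq_trans (F_cast _ _ _ (heq_refl _)) _.
apply: heq_trans (F_cap Ez) _.
have -> : (fun v => (fcoord i : 'Hom(W, k^o)) (fmod_act W (bal A) v)) =
    (fun v => v2r (fmod_act W (bal A) v) 0 i); last exact: heq_refl.
by apply: funext => v; rewrite fcoordE.
Qed.

Theorem agree_all m l (f : tangle (plus m) (plus l)) : agree f.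
Proof.
apply: (plus_ind (P := agree)).
- exact: agree_teq.
- exact: agree_id.
- exact: agree_cmp.
- exact: agree_ten.
- exact: agree_br.
- exact: agree_brV.
- exact: agree_tr.
Qed.

End Agreement.

(** * Transport along equalities of objects *)

Section Casts.

Variables (k : comNzRingType) (A : ribbonHopf k).
Local Notation T s := (tens (@fmodl k A) s).

Lemma castm_linear s s' t t' (es : s = s') (et : t = t') (f : T s -> T t) :
  linear f -> linear (castm (H := @arr (FModStr A)) es et f : T s' -> T t').
Proof. by case: _ / es; case: _ / et. Qed.

Lemma fbraid_heq s t s' t' (es : s = s') (et : t = t') (x : T (s ++ t))
    (y : T (s' ++ t')) : heq x y -> heq (fbraid x) (fbraid y).
Proof.
by case: _ / es y; case: _ / et => y /heq_eq ->; exact: heq_refl.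
Qed.

Lemma tact_heq a s t (x : T s) (y : T t) :
  heq x y -> heq (tact a x) (tact a y).
Proof. by case=> e <-; case: _ / e; exact: heq_refl. Qed.

Variable W : fMod A.
Local Notation B := (end_xc W).
Local Notation castE := (@castm nat (earr B) _ _ _ _).

Lemma castm_ecmp a b c a' b' c' (ea : a = a') (eb : b = b') (ec : c = c')
    (g : earr B b c) (f : earr B a b) :
  castE ea ec (ecmp g f) = ecmp (castE eb ec g) (castE ea eb f).
Proof. by case: _ / ea; case: _ / eb; case: _ / ec. Qed.

Lemma castm_eid a a' (e : a = a') :
  castE e e (EArr erefl (elt1 B a)) = EArr erefl (elt1 B a').
Proof. by case: _ / e. Qed.

(** The casts given by [ftob] and those identifying each [Z n] with [n] involve different proofs of
    the same equalities; on natural numbers such proofs coincide. *)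
Lemma castm_eten a b a1 b1 a2 b2 a1' b1' a2' b2' (G : earr B a b)
    (f : earr B a1 b1) (g : earr B a2 b2)
    (ea : a = (a1 + a2)%N) (eb : b = (b1 + b2)%N)
    (ea' : a = (a1' + a2')%N) (eb' : b = (b1' + b2')%N)
    (e1 : a1 = a1') (d1 : b1 = b1') (e2 : a2 = a2') (d2 : b2 = b2') :
  castE ea eb G = eten f g ->
  castE ea' eb' G = eten (castE e1 d1 f) (castE e2 d2 g).
Proof.
case: _ / e1 ea'; case: _ / e2; case: _ / d1 eb'; case: _ / d2 => eb' ea' <-.
by rewrite (eq_irrelevance ea' ea) (eq_irrelevance eb' eb).
Qed.

Lemma iota_castm a b a' b' (ea : a = a') (eb : b = b') (g : earr B a b) x x' :
  heq x x' ->
  heq (iota_elt (earr_el (castE ea eb g)) x') (iota_elt (earr_el g) x).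
Proof.
by case: _ / ea x'; case: _ / eb => x' /heq_eq ->; exact: heq_refl.
Qed.

Lemma iota_embE a b (g : earr B a b) x :
  heq (parr (iota_emb W) g x) (iota_elt (earr_el g) x).
Proof. by case: g => e g; case: _ / e; exact: heq_refl. Qed.

End Casts.

Theorem theorem5p4 (k : comNzRingType) (A : ribbonHopf k) (W : fMod A)
    (RT : strict_functor Tcat (FModStr A)) (RT_ribbon : preserves_ribbon W RT)
    (Z : strict_functor Tplus (Ecat (end_xc W)))
    (Z_traced : preserves_traced Z) :
  premap_eq (premap_comp RT Tincl) (premap_comp (iota_emb W) Z).
Proof.
case: RT_ribbon => F1 [RTbr RTtw RTev RTcoev]; pose Eob := fob_word F1.
case: Z_traced => Z1 [Zbr _ Ztr]; pose Zob := fob_nat Z1.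
(* Both functors are transported to the computed objects, signed words of modules and natural
   numbers, as [agree_all] expects; the casts are undone at the end. *)
pose F a b (f : tangle a b) := castm (H := @arr (FModStr A))
  (Eob a) (Eob b) (parr RT f).
pose Z0 m l (f : tangle (plus m) (plus l)) := castm (H := earr (end_xc W))
  (Zob m) (Zob l) (@parr _ _ Z m l f).
have FE a b (f : tangle a b) x x' : heq x' x -> heq (F a b f x') (parr RT f x).
  exact: castm_heq.
have FEx a b (f : tangle a b) x' : exists2 x, heq x' x &
    heq (F a b f x') (parr RT f x).
  by have [x E] := heq_ex x' (esym (Eob a)); exists x => //; exact: FE.
have agreeP : forall m l (f : tangle (plus m) (plus l)), agree F Z0 f.
  apply: agree_all.
  - move=> a b f g E x; have [y Ey Ef] := FEx _ _ f x.
    apply: heq_eq; apply: heq_trans Ef _; apply: heq_sym.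
    by rewrite (@feq _ _ RT _ _ f g I I E y); exact: FE.
  - move=> a b f; apply: castm_linear.
    by case: (@fhom _ _ RT _ _ f I).
  - move=> a x; have [y Ey Ef] := FEx _ _ (Tid a) x.
    apply: heq_eq; apply: heq_trans Ef _.
    by rewrite (@fid _ _ RT a y); exact: heq_sym.
  - move=> a b c g f x; have [y Ey Ef] := FEx _ _ (Tcmp g f) x.
    apply: heq_eq; apply: heq_trans Ef _.
    rewrite (@fcmp _ _ RT _ _ _ g f I I y); apply: heq_sym.
    by do 2!apply: (FE _ _ _ _ _ _).
  - move=> a b c d f g x y z E.
    have [x0 Ex Ef] := FEx _ _ f x; have [y0 Ey Eg] := FEx _ _ g y.
    have [z0 Ez Efg] := FEx _ _ (Tten f g) z.
    apply: heq_trans Efg _.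
    have E0 : heq (tcat x0 y0) z0.
      apply: heq_trans (heq_sym (heq_tcat Ex Ey)) _.
      exact: heq_trans (heq_sym E) Ez.
    apply: heq_trans (heq_sym (castm_heq (ftob RT a c) (ftob RT b d) _ E0)) _.
    rewrite (@ftarr _ _ RT _ _ _ _ f g I I (tcat x0 y0)) tarr_tcat.
    - by apply: heq_tcat; exact: heq_sym.
    - by case: (@fhom _ _ RT _ _ f I).
    - by case: (@fhom _ _ RT _ _ g I).
  - move=> a b x y E; have [x0 Ex Ef] := FEx _ _ (Tbr a b) x.
    apply: heq_trans Ef _.
    have [y0 Ey] := heq_ex x0 (ftob RT a b).
    apply: heq_trans (heq_sym (castm_heq (ftob RT a b) (ftob RT b a) _
      (heq_sym Ey))) _.
    rewrite RTbr; apply: fbraid_heq => //.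
    by apply: heq_trans (heq_sym Ey) _; apply: heq_trans (heq_sym Ex) E.
  - move=> a x; have [x0 Ex Ef] := FEx _ _ (Ttw a) x.
    apply: heq_eq; apply: heq_trans Ef _; rewrite RTtw.
    by apply: tact_heq; exact: heq_sym.
  - exact: RTev.
  - exact: RTcoev.
  - by move=> m l f g E; rewrite /Z0 (@feq _ _ Z _ _ f g I I E).
  - by move=> m; rewrite /Z0 (@fid _ _ Z m); exact: castm_eid.
  - move=> m l q g f; rewrite /Z0 (@fcmp _ _ Z _ _ _ g f I I).
    exact: castm_ecmp.
  - move=> m l m' l' f g; have := @ftarr _ _ Z _ _ _ _ f g I I.
    exact: castm_eten.
  - exact: Zbr.
  - by move=> m l f; exact: Ztr.
have e a : RT (plus a) = nseq (Z a) W by rewrite Eob Zob map_nseq.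
exists e => a b f _ x; apply: heq_eq.
have [y Ey] := heq_ex x (esym (e a)).
apply: heq_trans (castm_heq _ _ _ Ey) _.
have [z Ez] := heq_ex y (Eob (plus a)).
apply: heq_trans (heq_sym (FE _ _ f _ _ (heq_sym Ez))) _.
have [w Ew] := heq_ex x (congr1 (fun q => nseq q W) (Zob a)).
apply: heq_trans (agreeP _ _ f w z _) _.
  by apply: heq_trans (heq_sym Ew) _; apply: heq_trans Ey Ez.
apply: heq_trans (iota_castm _ _ _ Ew) _; apply: heq_sym.
exact: iota_embE.
Qed.
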